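(* Let $s_1,s_2\ge1$ and let $a_i,c_i$ ($1\le i\le s_1$), $b_j,d_j$ ($1\le j\le s_2$) be nonnegative integers with $(c_i)_i\neq 0$ and $(d_j)_j\ne0$. Put $\underline x=(x_1,\ldots,x_{s_1})$, $\underline y=(y_1,\ldots,y_{s_2})$, $f_1=x_1^{c_1}\cdots x_{s_1}^{c_{s_1}}$, $f_2=y_1^{d_1}\cdots y_{s_2}^{d_{s_2}}$ and $$f=x_1^{a_1}\cdots x_{s_1}^{a_{s_1}}\,y_1^{b_1}\cdots y_{s_2}^{b_{s_2}}\,(f_1+f_2).$$ Let $k$ be a field of characteristic $p>0$, $R=k[\underline x,\underline y]$, $I=(\underline x,\underline y)$. If $r\ge0$ satisfies $a_ir\le1$ and $b_jr\le 1$ for all $i,j$, then $$h_{R,I,f,p}(r)=1-\prod_{1 \leq i \leq s_1}(1-a_ir)\prod_{1 \leq j \leq s_2}(1-b_jr)+\int_{[0,\infty)^2}D_{T_1+T_2,p}(r_1,r_2,r)\,d(-h'_{k[\underline{x}],0,(\underline{x},f_1)}(\mathbf{1}-r\mathbf{a},r_1))\,d(-h'_{k[\underline{y}],0,(\underline{y},f_2)}(\mathbf{1}-r\mathbf{b},r_2)),$$ where $h_{R,I,f,p}=h_{R,I,f}$ and the derivatives $h'$ are taken in the last variable ($r_1$, resp. $r_2$). In particular, as $p \to \infty$, $h_{R,I,f,p}(r) \to h_{R,I,f,\infty}(r)$, where $$h_{R,I,f,\infty}(r)=1-\prod_{1 \leq i \leq s_1}(1-a_ir)\prod_{1 \leq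 j \leq s_2}(1-b_jr)+\int_{[0,\infty)^2}D_{T_1+T_2,\infty}(r_1,r_2,r)\,d(-h'_{k[\underline{x}],0,(\underline{x},f_1)}(\mathbf{1}-r\mathbf{a},r_1))\,d(-h'_{k[\underline{y}],0,(\underline{y},f_2)}(\mathbf{1}-r\mathbf{b},r_2)).$$
   Context: With $q=p^e$ and $I^{[q]}$ the ideal generated by $q$-th powers of elements of $I$: for a Noetherian ring $R$ of characteristic $p$, an ideal $I$ and a sequence $\underline g=(g_1,\ldots,g_m)$ with $(I,\underline g)$ primary to a maximal ideal $\mathfrak m$, $h_{R,I,\underline g}(\mathbf t)=\lim_{q\to\infty}l(R/(I^{[q]},g_1^{\lceil qt_1\rceil},\ldots,g_m^{\lceil qt_m\rceil}))/q^{\dim R_{\mathfrak m}}$ (nonpositive powers generate the unit ideal). $D_{T_1+T_2,p}=h_{k[T_1,T_2],0,(T_1,T_2,T_1+T_2)}$ for $k$ of characteristic $p$, and $D_{T_1+T_2,\infty}=\lim_{p\to\infty}D_{T_1+T_2,p}$ (which exists on $\mathbb R^3$). Here $\mathbf 1-r\mathbf a=(1-ra_1,\ldots,1-ra_{s_1})$ and $\mathbf 1-r\mathbf b=(1-rb_1,\ldots,1-rb_{s_2})$. The $h$-functions of $(k[\underline x],0,(\underline x,f_1))$ and $(k[\underline y],0,(\underline y,f_2))$, being those of monomials, do not depend on $k$; in their last variable they are concave on $[0,\infty)$ and eventually constant. Integrals are Riemann–Stieltjes integrals (over $[0,C]^2$ for any large $C$) with respect to functions of bounded variation; the derivatives,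 undefined at countably many points, are extended arbitrarily in a monotone way, and their value at $0$ is immaterial because $D_{T_1+T_2}$ vanishes when $r_1=0$ or $r_2=0$. *)

(* Defs.v *)
From HB Require Import structures.
From mathcomp Require Import all_boot all_order all_algebra.
From mathcomp Require Import all_classical all_reals all_analysis.
(* The notations of mpoly clash with those of analysis: import only the ring
   structures. *)
From mathcomp Require mpoly.
Import (canonicals) mpoly.
Import Order.TTheory GRing.Theory Num.Theory numFieldNormedType.Exports.

Set Implicit Arguments.
Unset Strict Implicit.
Unset Printing Implicit Defensive.

Local Open Scope classical_set_scope.
Local Open Scope ring_scope.

Section CommutativeAlgebra.
Variable A : comNzRingType.
Implicit Types (I J P : set A).

(* The unit ideal is included, contrary to idealr_closed of ring_quotient. *)
Definition is_ideal I : Prop :=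
  [/\ I 0, (forall x y, I x -> I y -> I (x + y)) & forall a x, I x -> I (a * x)].

Definition ideal_gen (S : set A) : set A := smallest is_ideal S.

Definition radical I : set A := [set x | exists n : nat, I (x ^+ n)].

Definition is_prime_ideal P : Prop :=
  [/\ is_ideal P, ~ P 1 & forall x y, P (x * y) -> P x \/ P y].

Definition frobenius_power (q : nat) I : set A :=
  ideal_gen [set x ^+ q | x in I].

(* The submodules of A/J correspond to the ideals of A containing J. *)
Definition quotient_chain J (n : nat) : Prop :=
  exists N : nat -> set A,
    (forall i, (i <= n)%N -> is_ideal (N i) /\ J `<=` N i) /\
    (forall i, (i < n)%N -> N i `<` N i.+1).

Definition quotient_length (R : realType) J : \bar R :=
  ereal_sup [set (n%:R)%:E | n in quotient_chain J].

(* The primes of the localization of A at M correspond to the primes of A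
   contained in M. *)
Definition prime_chain (M : set A) (n : nat) : Prop :=
  exists P : nat -> set A,
    (forall i, (i <= n)%N -> is_prime_ideal (P i) /\ P i `<=` M) /\
    (forall i, (i < n)%N -> P i `<` P i.+1).

(* Krull dimension of the localization of A at M, a finite number when A is
   Noetherian; 0 by convention if there is no longest chain. *)
Definition local_dim (M : set A) : nat :=
  xget 0%N [set n | prime_chain M n /\
                    forall n', prime_chain M n' -> (n' <= n)%N].

(* Nonpositive powers are 1, so that they generate the unit ideal. *)
Definition trunc_pow (x : A) (z : int) : A :=
  if z <= 0 then 1 else x ^+ `|z|%N.

Definition h_ideal (R : realType) I l (g : l.-tuple A) (t : l.-tuple R)
    (q : nat) : set A :=
  ideal_gen
    (frobenius_power q I `|`
     range (fun i : 'I_l => trunc_pow (tnth g i) (Num.ceil (q%:R * tnth t i)))).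

(* h_{A,I,g}(t), for A Noetherian of characteristic p and (I, g) primary to a
   maximal ideal. This maximal ideal is then the radical of (I, g), and all the
   lengths below are finite. *)
Definition h_fun (R : realType) (p : nat) I l (g : l.-tuple A)
    (t : l.-tuple R) : R :=
  let M := radical (ideal_gen (I `|` range (tnth g))) in
  limn (fun e : nat => fine (quotient_length R (h_ideal I g t (p ^ e)))
                         / (p ^ e)%:R ^+ local_dim M).

End CommutativeAlgebra.

Definition monomial (A : comNzRingType) (s : nat) (X : 'I_s -> A)
  (c : 'I_s -> nat) : A := \prod_(i < s) X i ^+ c i.

Definition Xvar (k : fieldType) (n : nat) (i : 'I_n) : mpoly.mpoly n k :=
  mpoly.mpolyX k (mpoly.mnm1 i).

Section HFunctions.
Variables (R : realType) (k : fieldType) (p : nat).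

(* h_{k[x], 0, (x, x^c)}(t, u) *)
Definition h_monomial s (c : 'I_s -> nat) (t : 'I_s -> R) (u : R) : R :=
  h_fun p [set (0 : mpoly.mpoly s k)]
    [tuple of rcons [tuple Xvar k i | i < s] (monomial (@Xvar k s) c)]
    [tuple of rcons [tuple t i | i < s] u].

(* D_{T_1 + T_2, p}, where p is the characteristic of k *)
Definition D_sum (r1 r2 r : R) : R :=
  let T1 : mpoly.mpoly 2 k := Xvar k ord0 in
  let T2 : mpoly.mpoly 2 k := Xvar k ord_max in
  h_fun p [set 0] [tuple T1; T2; T1 + T2] [tuple r1; r2; r].

(* h_{k[x, y], (x, y), f}(r), where f = x^a y^b (x^c + y^d) *)
Definition h_f s1 s2 (a c : 'I_s1 -> nat) (b d : 'I_s2 -> nat) (r : R) : R :=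
  let x (i : 'I_s1) : mpoly.mpoly (s1 + s2) k := Xvar k (lshift s2 i) in
  let y (j : 'I_s2) : mpoly.mpoly (s1 + s2) k := Xvar k (rshift s1 j) in
  let f := monomial x a * monomial y b * (monomial x c + monomial y d) in
  h_fun p (ideal_gen (range x `|` range y)) [tuple f] [tuple r].

End HFunctions.

Definition primes_oo : set_system nat := within [set p | prime p] \oo.

(* D_{T_1 + T_2, oo}; k p stands for a field of characteristic p. *)
Definition D_sum_infty (R : realType) (k : nat -> fieldType) (r1 r2 r : R) : R :=
  lim (D_sum (k p) p r1 r2 r @[p --> primes_oo]).

Section RiemannStieltjes.
Variable R : realType.

(* phi extends to (0, +oo) in a monotone way the derivative of the function h,
   which is concave there; the value of phi at 0 is unconstrained. *)
Definition monotone_derivative (h phi : R -> R) : Prop :=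
  (forall u v : R, 0 < u -> u <= v -> phi v <= phi u) /\
  (forall u : R, 0 < u -> derivable h u 1 -> phi u = derive1 h u).

(* The points of a partition of [0, C] are those of 0 :: s. *)
Definition fine_partition (C delta : R) (s : seq R) : Prop :=
  itv_partition 0 C s /\
  forall i, (i < size s)%N -> (0 :: s)`_i.+1 - (0 :: s)`_i < delta.

Definition RS_sum (F : R -> R -> R) (alpha beta : R -> R) (s1 s2 : seq R)
    (xi eta : nat -> nat -> R) : R :=
  \sum_(i < size s1) \sum_(j < size s2)
    F (xi i j) (eta i j)
    * (alpha (0 :: s1)`_i.+1 - alpha (0 :: s1)`_i)
    * (beta (0 :: s2)`_j.+1 - beta (0 :: s2)`_j).

(* The double Riemann-Stieltjes integral over [0, C]^2 of
   F(u, v) d alpha(u) d beta(v) exists and equals L. *)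
Definition is_RS_integral (F : R -> R -> R) (alpha beta : R -> R) (C L : R) :
    Prop :=
  forall eps, 0 < eps -> exists2 delta, 0 < delta &
    forall (s1 s2 : seq R) (xi eta : nat -> nat -> R),
      fine_partition C delta s1 -> fine_partition C delta s2 ->
      (forall i j, (i < size s1)%N -> (j < size s2)%N ->
         (0 :: s1)`_i <= xi i j <= (0 :: s1)`_i.+1 /\
         (0 :: s2)`_j <= eta i j <= (0 :: s2)`_j.+1) ->
      `|RS_sum F alpha beta s1 s2 xi eta - L| < eps.

(* The same over [0, +oo)^2, for eventually constant alpha and beta. *)
Definition is_RS_integral_oo (F : R -> R -> R) (alpha beta : R -> R) (L : R) :
    Prop :=
  exists C0, forall C, C0 <= C -> is_RS_integral F alpha beta C L.

End RiemannStieltjes.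

(* Main.v *)
Require Import Defs.
From HB Require Import structures.
From mathcomp Require Import all_boot all_order all_algebra.
From mathcomp Require Import all_classical all_reals all_analysis.
(* The notations of mpoly clash with those of analysis: import only the ring
   structures. *)
From mathcomp Require mpoly.
Import (canonicals) mpoly.
From mathcomp Require Import ring lra zify.
Import Order.TTheory GRing.Theory Num.Theory numFieldNormedType.Exports.

(** Let T_1 and T_2 act on k[x] and k[y] as f_1 and f_2. A box of monomials in x is a union of
    chains r, r + c, r + 2 c, ..., so that k[x] / (x^u) is a direct sum of modules
    k[T_1] / (T_1^m), one for each chain, where m is the length of the chain; likewise for y.
    Write l(m, n, N) for the length of k[T_1, T_2] / (T_1^m, T_2^n, (T_1 + T_2)^N), and let q = p^e
    and N = ceil(q r). After division by x^(N a) y^(N b) the multiplication by f^N = (x^a y^b)^N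
    (T_1 + T_2)^N becomes block diagonal, with one block for each pair of chains, whence
      length of k[x, y] / (x^q, y^q, f^N)
        = q^(s1 + s2) - prod (q - N a_i) prod (q - N b_j) + sum l(m, n, N),
    the sum being over pairs of chains of lengths m and n in the boxes of sides q - N a and q - N b
    (h_f_length). The first two terms give 1 - prod (1 - a_i r) prod (1 - b_j r), and the theorem is
    about the sum.

    The number of chains of length greater than y is a difference K(y) - K(y + 1), where K(y) is the
    number of monomials in the box of sides q - N a_i - y c_i. Since K, suitably normalized, converges
    to prod t_i - h for the monomial h-function h, and since K is convex, its slopes converge to -h'
    wherever h is differentiable, at all positive points except at most one (concave_slope_limit,
    chain_tail_cvg_phi). The counting measure of the scaled lengths m / q, divided by q^(s1 - 1), thus
    converges to d(-h'), while l(m, n, N) / q^2 is D_p(m / q, n / q, r) up to O(1 / q) (D_sum_cvg). For a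
    fixed partition of mesh delta the Riemann-Stieltjes sum with integrators -h' differs from that with
    the counting measures by a constant times delta: summation by parts moves the increments
    from the integrators to D_p, which is Lipschitz and vanishes on the axes, so that the points 0 and the
    point of non-differentiability are harmless (RS_dist_near). The latter sum differs from the sum
    over pairs of chains by a constant times delta as well (RS_empirical). Hence the normalized sums
    over pairs of chains are Cauchy, the integral exists, and it is their limit (RS_limit).

    What is needed about l and D_p comes from the syzygies of x^a, y^b, (x + y)^c. These form a graded
    free module of rank 2, and if m is the least degree of a syzygy then
      2 l(a, b, c) + a^2 + b^2 + c^2 = m^2 + (a + b + c - m)^2                     (tlenE).
    The degree m changes slowly with a, b, c, which makes l Lipschitz at scale q, and it is multiplied
    by p when a, b, c are (mindeg_mulp), which makes D_p exist with a rate of convergence that does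
    not depend on the field. For p -> oo, let a, b, c be of the order of p. A Wronskian argument shows that
    a syzygy of small degree is a multiple of a Frobenius pullback, so that m is a minimum of
    finitely many expressions which do not depend on the field (mindegE); therefore D_p
    converges pointwise (D_sum_primes_cvg). All the constants above being independent of p, the integral
    of D_oo exists and is the limit of the integrals of D_p (h_f_primes_limit). *)

Set Implicit Arguments.
Unset Strict Implicit.
Unset Printing Implicit Defensive.

Local Open Scope classical_set_scope.
Local Open Scope ring_scope.

(** * Ranks of matrices indexed by finite types *)

Section FunctionMatrices.
Variable k : fieldType.

(** Rows and columns are indexed by finite types, in practice sets of monomials, so that ranks
    can be compared along partial maps between the index sets. *)
Definition fmx (S T : finType) (M : S -> T -> k) : 'M[k]_(#|S|, #|T|) :=
  \matrix_(i, j) M (enum_val i) (enum_val j).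

Definition frank (S T : finType) (M : S -> T -> k) : nat := \rank (fmx M).

Lemma eq_frank (S T : finType) (M M' : S -> T -> k) :
  (forall s t, M s t = M' s t) -> frank M = frank M'.
Proof. by move=> eM; congr (\rank _); apply/matrixP=> i j; rewrite !mxE eM. Qed.

Lemma fmx_mul (S T U : finType) (M : S -> T -> k) (M' : T -> U -> k) :
  fmx M *m fmx M' = fmx (fun s u => \sum_t M s t * M' t u).
Proof.
apply/matrixP=> i j; rewrite !mxE [RHS](reindex (@enum_val T predT)) /=; last first.
  by apply: onW_bij; apply: enum_val_bij.
by apply: eq_bigr => l _; rewrite !mxE.
Qed.

(** Reading off a matrix through partial maps of its rows and columns is a
    product with selection matrices on both sides. *)
Lemma frank_select (S T S' T' : finType) (M : S -> T -> k) (M' : S' -> T' -> k)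
    (f : S -> option S') (g : T -> option T') :
  (forall s t, M s t = match f s, g t with
                       | Some s', Some t' => M' s' t' | _, _ => 0 end) ->
  (frank M <= frank M')%N.
Proof.
move=> eM.
have -> : frank M = \rank (fmx (fun s s' => (f s == Some s')%:R) *m fmx M' *m
    fmx (fun t' t => (g t == Some t')%:R)).
  congr (\rank _); rewrite fmx_mul fmx_mul; apply/matrixP=> i j; rewrite !mxE eM.
  set s := enum_val i; set t := enum_val j.
  case gt : (g t) => [t0|]; last first.
    rewrite big1; last by move=> t' _; rewrite mulr0.
    by case: (f s).
  rewrite (bigD1 t0) //= eqxx mulr1 [X in _ + X]big1 ?addr0; last first.
    move=> t' nt'; case: eqP => [[e]|_]; rewrite ?mulr0 //.
    by rewrite e eqxx in nt'.
  case fs : (f s) => [s0|]; last first.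
    by rewrite big1 // => s' _; rewrite mul0r.
  rewrite (bigD1 s0) //= eqxx mul1r big1 ?addr0 // => s' ns'.
  by case: eqP => [[e]|_]; rewrite ?mul0r //; rewrite e eqxx in ns'.
exact: leq_trans (mxrankM_maxl _ _) (mxrankM_maxr _ _).
Qed.

(** The blocks of a block matrix have supports in disjoint sets of columns, so
    their row spaces form a direct sum. *)
Lemma frank_blocks (S T K : finType) (M : S -> T -> k) (f : S -> K) (g : T -> K) :
  (forall s t, f s != g t -> M s t = 0) ->
  frank M = (\sum_(x : K)
    frank (fun s t => if (f s == x) && (g t == x) then M s t else 0%R))%N.
Proof.
move=> M0.
pose U x := fmx (fun s t => if (f s == x) && (g t == x) then M s t else 0).
pose E x : 'M[k]_#|T| := fmx (fun t t' => ((t == t') && (g t == x))%:R).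
pose L x : 'M[k]_#|S| := fmx (fun s s' => ((s == s') && (f s == x))%:R).
have UE x : U x = fmx M *m E x.
  rewrite fmx_mul; apply/matrixP=> i j; rewrite !mxE.
  rewrite (bigD1 (enum_val j)) //= eqxx /= big1 ?addr0; last first.
    by move=> t /negPf ->; rewrite mulr0.
  have [gx|] := altP (g _ =P x); rewrite ?andbF ?mulr0 // andbT mulr1.
  have [//|nf] := altP (f _ =P x).
  by rewrite M0 // gx.
have UL x : U x = L x *m fmx M.
  rewrite fmx_mul; apply/matrixP=> i j; rewrite !mxE.
  rewrite (bigD1 (enum_val i)) //= eqxx /= big1 ?addr0; last first.
    by move=> t nt; rewrite eq_sym (negPf nt) mul0r.
  have [fx|] := altP (f _ =P x); rewrite /= ?mul0r // mul1r.
  have [//|ng] := altP (g _ =P x).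
  by rewrite M0 // fx eq_sym.
have EE x y : E x *m E y = if x == y then E x else 0.
  rewrite fmx_mul; apply/matrixP=> i j.
  rewrite mxE (bigD1 (enum_val i)) //= eqxx /= big1 ?addr0; last first.
    by move=> t nt; rewrite eq_sym (negPf nt) mul0r.
  have [->|nxy] := eqVneq x y; rewrite !mxE.
    by case: (g _ == y); rewrite ?mul0r ?mul1r ?andbF.
  have [gx|] := altP (g _ =P x); rewrite ?mul0r // mul1r gx (negPf nxy).
  by rewrite andbF.
have sumU : (fmx M :=: \sum_x <<U x>>)%MS.
  apply/eqmxP/andP; split; last first.
    by apply/sumsmx_subP=> x _; rewrite genmxE UL submxMl.
  have -> : fmx M = \sum_x U x.
    apply/matrixP=> i j; rewrite !mxE summxE (bigD1 (g (enum_val j))) //=.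
    rewrite big1 ?addr0; last by move=> x nx; rewrite mxE [g _ == x]eq_sym (negPf nx) andbF.
    by rewrite mxE eqxx andbT; case: eqP => // /eqP nf; rewrite M0.
  by apply: summx_sub => x _; apply: (sumsmx_sup x); rewrite ?genmxE.
rewrite /frank sumU.
transitivity (\sum_x \rank <<U x>>)%N; last by apply: eq_bigr => x _; rewrite mxrank_gen.
apply/mxdirectP => /=.
apply/mxdirect_sumsP => x _; apply/eqP; rewrite -submx0.
apply/row_subP => i; set v := row i _.
have vU : (v <= U x)%MS.
  by rewrite -(genmxE (U x)) (submx_trans (row_sub _ _)) ?capmxSl.
have vS : (v <= \sum_(y | y != x) <<U y>>)%MS.
  by rewrite (submx_trans (row_sub _ _)) ?capmxSr.
have -> : v = v *m E x.
  by case/submxP: vU => w ->; rewrite -mulmxA UE -mulmxA EE eqxx.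
apply: submx_trans (submxMr _ vS) _.
rewrite sumsmxMr; apply/sumsmx_subP => y yx.
by rewrite (eqmxMr _ (genmxE _)) UE -mulmxA EE (negPf yx) mulmx0 sub0mx.
Qed.

Lemma mxrank_mxsub m n m' n' (f : 'I_m' -> 'I_m) (g : 'I_n' -> 'I_n) (A : 'M[k]_(m, n)) :
  (\rank (mxsub f g A) <= \rank A)%N.
Proof.
have -> : mxsub f g A = rowsub f 1%:M *m A *m colsub g 1%:M.
  by rewrite mulmx_colsub mulmx1 mul_rowsub_mx mul1mx mxsubcr.
exact: leq_trans (mxrankM_maxl _ _) (mxrankM_maxr _ _).
Qed.

Lemma frank_mx m n (A : 'M[k]_(m, n)) : frank (fun i j => A i j) = \rank A.
Proof.
apply/eqP; rewrite eqn_leq; apply/andP; split.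
  apply: leq_trans (mxrank_mxsub enum_val enum_val A).
  by rewrite /frank; apply: eq_leq; congr (\rank _); apply/matrixP=> i j; rewrite !mxE.
apply: leq_trans (mxrank_mxsub enum_rank enum_rank (fmx (fun i j => A i j))).
by apply: eq_leq; congr (\rank _); apply/matrixP=> i j; rewrite !mxE !enum_rankK.
Qed.

Lemma frank_le_card (S T : finType) (M : S -> T -> k) : (frank M <= #|S|)%N.
Proof. exact: rank_leq_row. Qed.

(** The partial identities on P and on its complement add up to the identity, and neither
    has a larger rank than it has nonzero rows. *)
Lemma frank_diag (T : finType) (P : pred T) :
  frank (fun s t => ((s == t) && P t)%:R) = #|P|.
Proof.
have le (Q : pred T) : (frank (fun s t => ((s == t) && Q t)%:R) <= #|Q|)%N.
  rewrite -card_sig; apply: leq_trans (frank_le_card (fun s t : {x | Q x} => (s == t)%:R)).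
  apply: (frank_select (f := insub) (g := insub)) => s t.
  case: insubP => [s' Qs es|nQs]; last first.
    by case: (eqVneq s t) => [<-|] //=; rewrite (negPf nQs).
  case: insubP => [t' Qt et|nQt]; last by rewrite (negPf nQt) andbF.
  by rewrite Qt andbT -es -et (inj_eq val_inj).
apply/eqP; rewrite eqn_leq le /= -(leq_add2r #|[predC P]|) cardC.
apply: leq_trans (leq_add (leqnn _) (le [predC P])).
apply: leq_trans (mxrank_add _ _).
have -> : fmx (fun s t => ((s == t) && P t)%:R) + fmx (fun s t => ((s == t) && [predC P] t)%:R)
     = 1%:M.
  apply/matrixP=> i j; rewrite !mxE (inj_eq enum_val_inj) /=.
  rewrite /in_mem /=; by case: (i == j); case: (P _) => /=; rewrite ?mulr1n ?mulr0n ?addr0 ?add0r.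
by rewrite mxrank1.
Qed.

End FunctionMatrices.

(** Both cardinals are ranks of partial identities, and f selects one inside the other. *)
Lemma card_partial_inj (T T' : finType) (P : pred T) (P' : pred T') (f : T -> option T') :
  (forall s, P s -> exists2 s', f s = Some s' & P' s') ->
  (forall s t, P s -> P t -> f s = f t -> s = t) -> (#|P| <= #|P'|)%N.
Proof.
move=> fP inj; rewrite -!(frank_diag rat).
pose f' s := if P s then f s else None.
apply: (frank_select (f := f') (g := f')) => s t; rewrite /f'.
case Ps : (P s); last by case: (eqVneq s t) => [<-|] //=; rewrite Ps.
have [s' fs Ps'] := fP _ Ps; rewrite fs.
case Pt : (P t); last by rewrite andbF.
have [t' ft Pt'] := fP _ Pt; rewrite ft Pt' !andbT.
case: (eqVneq s t) => [e|n]; first by move: fs; rewrite e ft => -[->]; rewrite eqxx.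
case: eqP => // e; case/eqP: n; apply: inj => //.
by rewrite fs ft e.
Qed.

(** * Syzygies of x^a, y^b, (x + y)^c *)

Section Syzygies.
Variable k : fieldType.
Implicit Types (A B C g h : {poly k}).

(** The form x + y, dehomogenized at y = 1. *)
Definition ell : {poly k} := 'X + 1.

(** Multiplication by g on row vectors of coefficients, truncated to degrees less than n. *)
Definition mulmxp g d n : 'M[k]_(d, n) := \matrix_(i, j) (g * 'X^i)`_j.

Lemma mul_mulmxp g d n (u : 'rV_d) :
  u *m mulmxp g d n = poly_rV (g * rVpoly u).
Proof.
apply/rowP=> j; rewrite !mxE /rVpoly poly_def mulr_sumr coef_sum.
apply: eq_bigr => l _; rewrite mxE -scalerAr coefZ insubT //= => h.
by congr (u _ _ * _); apply: val_inj.
Qed.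

Lemma poly_rV_eq0 d g : (size g <= d)%N -> poly_rV g = 0 :> 'rV_d -> g = 0.
Proof. by move=> sg g0; rewrite -(poly_rV_K sg) g0 linear0. Qed.

Lemma sub_mulmxp g d n h : (size h <= d)%N ->
  (poly_rV (g * h) <= mulmxp g d n)%MS.
Proof. by move=> sh; rewrite -{1}(poly_rV_K sh) -mul_mulmxp submxMl. Qed.

(** This and the restatements of size lemmas below fix the ring structure of a field under which
    sizes are taken, so that sizes from different lemmas are the same atoms for linear arithmetic. *)
Lemma fsize_mul g h : g != 0 -> h != 0 -> size (g * h) = (size g + size h).-1.
Proof. exact: size_mul. Qed.

Lemma size_cofactor g h m : (1 < size h)%N -> (size (g * h)%R <= m.+1)%N ->
  (size g <= m)%N.
Proof.
have [->|g0] := eqVneq g 0; first by rewrite size_poly0.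
move=> h1; have h0 : h != 0 by rewrite -size_poly_gt0; lia.
by rewrite fsize_mul //; lia.
Qed.

Lemma size_ellX c : size (ell ^+ c) = c.+1.
Proof. by rewrite /ell -[1]opprK -polyCN size_exp_XsubC. Qed.

Lemma ellX_neq0 c : ell ^+ c != 0.
Proof. by rewrite -size_poly_eq0 size_ellX. Qed.

(** The syzygies of degree n of x^a, y^b, (x + y)^c, dehomogenized at y = 1. *)
Definition is_syz (a b c n : nat) A B C : Prop :=
  [/\ (size A <= n.+1 - a)%N, (size B <= n.+1 - b)%N, (size C <= n.+1 - c)%N
    & 'X^a * A + B + ell ^+ c * C = 0].

Section Fixed.
Variables a b c : nat.

(** The row kernel of this matrix is the space of syzygies of degree n. *)
Definition syzmx n :=
  col_mx (col_mx (mulmxp 'X^a (n.+1 - a) n.+1) (mulmxp 1 (n.+1 - b) n.+1))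
         (mulmxp (ell ^+ c) (n.+1 - c) n.+1).

Definition rVsyz n A B C : 'rV[k]_(n.+1 - a + (n.+1 - b) + (n.+1 - c)) :=
  row_mx (row_mx (poly_rV A) (poly_rV B)) (poly_rV C).

Lemma size_syz n A B C : (size A <= n.+1 - a)%N -> (size B <= n.+1 - b)%N ->
  (size C <= n.+1 - c)%N -> (size ('X^a * A + B + ell ^+ c * C)%R <= n.+1)%N.
Proof.
move=> hA hB hC.
have h1 : (size ('X^a * A)%R <= n.+1)%N.
  have [->|A0] := eqVneq A 0; first by rewrite mulr0 size_poly0.
  rewrite mulrC size_mulXn //.
  by move: A0 hA; rewrite -size_poly_eq0; lia.
have h2 : (size (ell ^+ c * C)%R <= n.+1)%N.
  have [->|C0] := eqVneq C 0; first by rewrite mulr0 size_poly0.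
  rewrite fsize_mul ?ellX_neq0 // size_ellX.
  by move: C0 hC; rewrite -size_poly_gt0; lia.
rewrite (leq_trans (size_polyD _ _)) // geq_max h2 andbT.
by rewrite (leq_trans (size_polyD _ _)) // geq_max h1 (leq_trans hB) // leq_subr.
Qed.

Lemma rVsyzP n (u : 'rV[k]_(n.+1 - a + (n.+1 - b) + (n.+1 - c))) :
  exists A B C, [/\ u = rVsyz n A B C, (size A <= n.+1 - a)%N,
     (size B <= n.+1 - b)%N & (size C <= n.+1 - c)%N].
Proof.
exists (rVpoly (lsubmx (lsubmx u))), (rVpoly (rsubmx (lsubmx u))), (rVpoly (rsubmx u)).
by rewrite !size_poly /rVsyz !rVpolyK !hsubmxK.
Qed.

Lemma rVsyz_eq0 n A B C : (size A <= n.+1 - a)%N ->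
     (size B <= n.+1 - b)%N -> (size C <= n.+1 - c)%N ->
  (rVsyz n A B C == 0) = [&& A == 0, B == 0 & C == 0].
Proof.
move=> hA hB hC; apply/eqP/and3P; last first.
  by case=> /eqP -> /eqP -> /eqP ->; rewrite /rVsyz !linear0 !row_mx0.
move=> e.
have /eqP := e; rewrite /rVsyz -row_mx0 => /eqP/eq_row_mx [].
rewrite -row_mx0 => /eq_row_mx [eA eB] eC.
by rewrite (poly_rV_eq0 hA eA) (poly_rV_eq0 hB eB) (poly_rV_eq0 hC eC).
Qed.

Lemma rVsyz_mul n A B C : (size A <= n.+1 - a)%N ->
     (size B <= n.+1 - b)%N -> (size C <= n.+1 - c)%N ->
  rVsyz n A B C *m syzmx n = 0 <-> is_syz a b c n A B C.
Proof.
move=> hA hB hC.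
rewrite /rVsyz !mul_row_col !mul_mulmxp mul1r !poly_rV_K // -!linearD.
split=> [/poly_rV_eq0 h|[_ _ _ ->]]; last by rewrite linear0.
by split=> //; apply: h; apply: size_syz.
Qed.

Definition has_syz n := ~~ row_free (syzmx n).

Lemma has_syzP n : reflect (exists A B C, is_syz a b c n A B C /\
    ~~ [&& A == 0, B == 0 & C == 0]) (has_syz n).
Proof.
apply: (iffP idP) => [|[A [B [C [s n0]]]]].
  rewrite /has_syz -kermx_eq0 => /rowV0Pn [v /sub_kermxP].
  have [A [B [C [-> hA hB hC]]]] := rVsyzP v.
  move/rVsyz_mul => /(_ hA hB hC) hs; rewrite rVsyz_eq0 // => n0.
  by exists A, B, C.
have [hA hB hC _] := s.
apply/negP=> /row_free_inj inj.
have : rVsyz n A B C == 0.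
  by apply/eqP/inj; rewrite mul0mx; apply/rVsyz_mul.
by rewrite rVsyz_eq0 // (negPf n0).
Qed.

Lemma has_syzS n : has_syz n -> has_syz n.+1.
Proof.
move/has_syzP=> [A [B [C [[hA hB hC e] n0]]]]; apply/has_syzP; exists A, B, C.
by split=> //; split=> //; lia.
Qed.

Lemma has_syz_le n n' : (n <= n')%N -> has_syz n -> has_syz n'.
Proof. by move=> /subnK <-; elim: (n' - n)%N => // i IH /IH; apply: has_syzS. Qed.

Lemma has_syz_ab : has_syz (a + b).
Proof.
apply/has_syzP; exists 1, (- 'X^a), 0; split; last by rewrite oner_eq0.
split; rewrite ?size_poly0 // ?size_polyN ?size_polyXn ?size_poly1; try lia.
by rewrite mulr1 mulr0 addr0 subrr.
Qed.

Lemma has_syz_ac : has_syz (a + c).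
Proof.
apply/has_syzP; exists (ell ^+ c), 0, (- 'X^a); split; last by rewrite (negPf (ellX_neq0 _)).
split; rewrite ?size_poly0 // ?size_polyN ?size_polyXn ?size_ellX; try lia.
by rewrite mulrN addr0 mulrC subrr.
Qed.

Lemma has_syz_bc : has_syz (b + c).
Proof.
apply/has_syzP; exists 0, (ell ^+ c), (- 1); split; last by rewrite (negPf (ellX_neq0 _)) andbF.
split; rewrite ?size_poly0 // ?size_polyN ?size_poly1 ?size_ellX; try lia.
by rewrite mulr0 add0r mulrN mulr1 subrr.
Qed.

(** Three forms of degrees n - a, n - b, n - c have more coefficients than a form
    of degree n. *)
Lemma has_syz_half : has_syz ((a + b + c)./2).
Proof.
apply/negP => /eqP rk; have := rank_leq_col (syzmx ((a + b + c)./2)).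
by rewrite rk; lia.
Qed.

Definition mindeg : nat := ex_minn (ex_intro (fun n => is_true (has_syz n)) _ has_syz_ab).

Lemma mindegP : has_syz mindeg.
Proof. by rewrite /mindeg; case: ex_minnP. Qed.

Lemma mindeg_min n : has_syz n -> (mindeg <= n)%N.
Proof. by rewrite /mindeg; case: ex_minnP => m _ h; apply: h. Qed.

Lemma has_syzE n : has_syz n = (mindeg <= n)%N.
Proof.
by apply/idP/idP => [/mindeg_min //|h]; apply: has_syz_le h mindegP.
Qed.

Lemma min_syz : exists A B C, is_syz a b c mindeg A B C /\
    ~~ [&& A == 0, B == 0 & C == 0].
Proof. by apply/has_syzP/mindegP. Qed.

(** By minimality a syzygy of least degree has neither a common factor nor a power
    of y in common, so that it divides every syzygy parallel to it. *)
Lemma min_syz_dvd A0 B0 C0 n A B C : is_syz a b c mindeg A0 B0 C0 ->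
    ~~ [&& A0 == 0, B0 == 0 & C0 == 0] ->
    is_syz a b c n A B C -> A0 * B = A * B0 ->
  exists2 h : {poly k}, (size h <= n.+1 - mindeg)%N & [/\ A = A0 * h, B = B0 * h & C = C0 * h].
Proof.
move=> s0 nz s eAB; have [hA0 hB0 hC0 e0] := s0; have [hA hB hC e] := s.
(* By minimality no nonzero syzygy has room to spare in all three entries. *)
have low A1 B1 C1 : (size A1 <= mindeg - a)%N -> (size B1 <= mindeg - b)%N ->
    (size C1 <= mindeg - c)%N -> 'X^a * A1 + B1 + ell ^+ c * C1 = 0 ->
    [&& A1 == 0, B1 == 0 & C1 == 0].
  move=> lA lB lC e1; apply: contraT => n1.
  have [m0|m0] := posnP mindeg.
    move: lA lB lC n1; rewrite m0 !sub0n !size_poly_leq0.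
    by move=> -> -> ->.
  have : has_syz mindeg.-1.
    by apply/has_syzP; exists A1, B1, C1; split=> //; split=> //; rewrite prednK.
  by rewrite has_syzE; lia.
(* Hence no common factor can be divided out. *)
have cop : coprimep (gcdp A0 B0) C0.
  rewrite /coprimep; set D := gcdp _ C0.
  have DA : D %| A0 by rewrite (dvdp_trans (dvdp_gcdl _ _)) ?dvdp_gcdl.
  have DB : D %| B0 by rewrite (dvdp_trans (dvdp_gcdl _ _)) ?dvdp_gcdr.
  have DC : D %| C0 by rewrite dvdp_gcdr.
  have D0 : D != 0.
    by rewrite /D !gcdp_eq0 -andbA.
  move: DA DB DC => /dvdpP[A1 eA1] /dvdpP[B1 eB1] /dvdpP[C1 eC1].
  have sD : (0 < size (D : {poly k}))%N by rewrite size_poly_gt0.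
  apply: contraT => sD1.
  have {sD1}sD1 : (1 < size (D : {poly k}))%N by rewrite ltn_neqAle eq_sym sD1.
  have sz X Y m : X = Y * D -> (size X <= m.+1)%N -> (size Y <= m)%N.
    by move=> ->; apply: size_cofactor.
  have sz' X Y x : X = Y * D -> (size X <= mindeg.+1 - x)%N -> (size Y <= mindeg - x)%N.
    move=> eX; have [le|lt] := leqP x mindeg.
      by rewrite subSn //; apply: sz eX.
    have -> : (mindeg.+1 - x = 0)%N by lia.
    rewrite size_poly_leq0 eX mulf_eq0 (negPf D0) orbF => /eqP ->.
    by rewrite size_poly0.
  have := low _ _ _ (sz' _ _ _ eA1 hA0) (sz' _ _ _ eB1 hB0) (sz' _ _ _ eC1 hC0).
  case/(_ _)/and3P.
    by apply: (mulIf D0); rewrite mul0r -e0 eA1 eB1 eC1; ring.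
  move=> /eqP A10 /eqP B10 /eqP C10; move: nz.
  by rewrite eA1 eB1 eC1 A10 B10 C10 !mul0r eqxx.
have eAC : A0 * C = A * C0.
  apply: (mulfI (ellX_neq0 c)); apply: subr0_eq.
  have -> : ell ^+ c * (A0 * C) - ell ^+ c * (A * C0) =
     A0 * ('X^a * A + B + ell ^+ c * C) - A * ('X^a * A0 + B0 + ell ^+ c * C0)
     - (A0 * B - A * B0) by ring.
  by rewrite e e0 eAB subrr !mulr0 !subr0.
have eBC : B0 * C = B * C0.
  apply: subr0_eq.
  have -> : B0 * C - B * C0 =
     C * ('X^a * A0 + B0 + ell ^+ c * C0) - C0 * ('X^a * A + B + ell ^+ c * C)
     - 'X^a * (A0 * C - A * C0) by ring.
  by rewrite e e0 eAC subrr !mulr0 !subr0.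
have /Bezout_eq1_coprimepP [[x y] /= exy] := cop.
have [[u v] /= /eqpP [[c1 c2] /= /andP[c10 c20] euv]] := Bezoutp A0 B0.
pose w := c2^-1 * c1.
have eG : gcdp A0 B0 = (w%:P * u) * A0 + (w%:P * v) * B0.
  have -> : gcdp A0 B0 = c2^-1 *: (c2 *: gcdp A0 B0) by rewrite scalerA mulVf ?scale1r.
  rewrite -euv -!mul_polyC /w polyCM; ring.
set p1 := _ * u in eG; set p2 := _ * v in eG.
have bez : x * p1 * A0 + x * p2 * B0 + y * C0 = 1.
  by rewrite -exy eG; ring.
pose h := x * p1 * A + x * p2 * B + y * C.
have hAe : A = A0 * h.
  rewrite -[LHS]mulr1 -bez /h.
  rewrite !mulrDr ![A * (_ * _)]mulrCA ![A0 * (_ * _)]mulrCA eAB eAC.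
  by rewrite ![A * _]mulrC.
have hBe : B = B0 * h.
  rewrite -[LHS]mulr1 -bez /h.
  rewrite !mulrDr ![B * (_ * _)]mulrCA ![B0 * (_ * _)]mulrCA eBC.
  by rewrite [B0 * A]mulrC -eAB [A0 * B]mulrC [B0 * B]mulrC.
have hCe : C = C0 * h.
  rewrite -[LHS]mulr1 -bez /h.
  rewrite !mulrDr ![C * (_ * _)]mulrCA ![C0 * (_ * _)]mulrCA.
  by rewrite [C0 * A]mulrC -eAC [C0 * B]mulrC -eBC ![_ * C]mulrC.
exists h => //.
have [->|h0] := eqVneq h 0; first by rewrite size_poly0.
have sat X X0 i : X = X0 * h -> (size X <= n.+1 - i)%N ->
    (size X0 <= mindeg.+1 - i)%N -> ~~ (size X0 <= mindeg - i)%N ->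
    (size h <= n.+1 - mindeg)%N.
  have [->|X00] := eqVneq X0 0; first by rewrite size_poly0.
  move=> ->; rewrite fsize_mul // => h1 h2 h3.
  by move: X00 h0; rewrite -!size_poly_gt0; lia.
have [lA|] := boolP (size A0 <= mindeg - a)%N; last exact: sat hAe hA hA0.
have [lB|] := boolP (size B0 <= mindeg - b)%N; last exact: sat hBe hB hB0.
have [lC|] := boolP (size C0 <= mindeg - c)%N; last exact: sat hCe hC hC0.
by move: nz; rewrite (low _ _ _ lA lB lC).
Qed.

Lemma mindeg_half : (mindeg <= (a + b + c)./2)%N.
Proof. exact: mindeg_min has_syz_half. Qed.

Lemma mul_rVsyz n A B C d gA gB gC :
  (size A <= n.+1 - a)%N -> (size B <= n.+1 - b)%N -> (size C <= n.+1 - c)%N ->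
  rVsyz n A B C *m
    col_mx (col_mx (mulmxp gA _ d) (mulmxp gB _ d)) (mulmxp gC _ d) =
  poly_rV (gA * A + gB * B + gC * C).
Proof.
by move=> hA hB hC; rewrite !mul_row_col !mul_mulmxp !poly_rV_K // -!linearD.
Qed.

Lemma size_syz_mul n m d d' A A' : (size A <= m.+1 - d)%N -> (size A' <= n.+1 - d')%N ->
  (size (A * A')%R <= (m + n).+1 - (d + d'))%N.
Proof.
have [->|A0] := eqVneq A 0; first by rewrite mul0r size_poly0.
have [->|A'0] := eqVneq A' 0; first by rewrite mulr0 size_poly0.
by move: (A0) (A'0); rewrite -!size_poly_gt0 fsize_mul //; lia.
Qed.

(** The multiples of a syzygy of least degree account for n + 1 - m of the
    syzygies of degree n. *)
Lemma syzmx_ker_ge n : (n.+1 - mindeg <= \rank (kermx (syzmx n)))%N.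
Proof.
have [A0 [B0 [C0 [s0 nz]]]] := min_syz; have [hA0 hB0 hC0 e0] := s0.
have [lt|le] := ltnP n mindeg; first by rewrite (_ : n.+1 - mindeg = 0)%N; lia.
pose H : 'M[k]_(n.+1 - mindeg, _) := row_mx (row_mx (mulmxp A0 _ (n.+1 - a))
  (mulmxp B0 _ (n.+1 - b))) (mulmxp C0 _ (n.+1 - c)).
have szs i (X : {poly k}) h : (size X <= mindeg.+1 - i)%N -> (size h <= n.+1 - mindeg)%N ->
    (size (X * h)%R <= n.+1 - i)%N.
  by move=> hX hh; have := size_syz_mul hX hh; lia.
have HE u : u *m H = rVsyz n (A0 * rVpoly u) (B0 * rVpoly u) (C0 * rVpoly u).
  by rewrite /H !mul_mx_row !mul_mulmxp.
have freeH : row_free H.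
  apply: inj_row_free => u; rewrite HE => /eqP.
  rewrite rVsyz_eq0 ?szs ?size_poly // !mulf_eq0.
  have [u0 _|_] := eqVneq (rVpoly u) 0; first by rewrite -[u]rVpolyK u0 linear0.
  by rewrite !orbF (negPf nz).
move/eqP: freeH => <-; apply: mxrankS; apply/row_subP => i; apply/sub_kermxP.
rewrite rowE HE; apply/rVsyz_mul; rewrite ?szs ?size_poly //.
split; rewrite ?szs ?size_poly //.
by rewrite !mulrA -!mulrDl e0 mul0r.
Qed.

(** A syzygy (A, B, C) has with a syzygy (A0, B0, C0) of least degree m a cross
    product which is a multiple of (x^a, y^b, (x + y)^c), by a form of degree
    n - (a + b + c - m); it is zero for the multiples of (A0, B0, C0) only. *)
Lemma syzmx_ker_le n : (\rank (kermx (syzmx n)) <=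
  (n.+1 - mindeg) + (n.+1 - (a + b + c - mindeg)))%N.
Proof.
have [A0 [B0 [C0 [s0 nz]]]] := min_syz; have [hA0 hB0 hC0 e0] := s0.
pose d := (mindeg + n).+1.
(* The coordinate A0 B - A B0 of the cross product, as a linear map. *)
pose X : 'M[k]_(_, d) := col_mx (col_mx (mulmxp (- B0) (n.+1 - a) d)
  (mulmxp A0 (n.+1 - b) d)) (mulmxp 0 (n.+1 - c) d).
have sX A B : (size A <= n.+1 - a)%N -> (size B <= n.+1 - b)%N ->
    (size (- B0 * A + A0 * B)%R <= d - (a + b))%N.
  move=> hA hB; rewrite (leq_trans (size_polyD _ _)) // geq_max mulNr size_polyN.
  by rewrite {1}(addnC a) !size_syz_mul.
rewrite -(mxrank_mul_ker _ X) addnC leq_add //.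
  apply: leq_trans (rank_leq_row (row_mx (row_mx (mulmxp A0 (n.+1 - mindeg) (n.+1 - a))
    (mulmxp B0 _ (n.+1 - b))) (mulmxp C0 _ (n.+1 - c)))).
  apply: mxrankS; apply/row_subP => i; set u := row i _.
  have : (u <= kermx (syzmx n) :&: kermx X)%MS by apply: row_sub.
  rewrite sub_capmx => /andP[/sub_kermxP]; move: u.
  move=> u; have [A [B [C [-> hA hB hC]]]] := rVsyzP u.
  move=> /(rVsyz_mul hA hB hC) s /sub_kermxP; rewrite mul_rVsyz // mul0r addr0.
  move/poly_rV_eq0 => /(_ _) h0.
  have eAB : A0 * B = A * B0.
    apply: subr0_eq; rewrite -h0; first by rewrite mulNr addrC [A * _]mulrC.
    by rewrite (leq_trans (sX _ _ hA hB)) ?leq_subr.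
  have [h sh [-> -> ->]] := min_syz_dvd s0 nz s eAB.
  have -> : rVsyz n (A0 * h) (B0 * h) (C0 * h) =
     poly_rV h *m row_mx (row_mx (mulmxp A0 (n.+1 - mindeg) (n.+1 - a))
    (mulmxp B0 _ (n.+1 - b))) (mulmxp C0 _ (n.+1 - c)).
    by rewrite !mul_mx_row !mul_mulmxp poly_rV_K.
  exact: submxMl.
apply: leq_trans (rank_leq_row (mulmxp (ell ^+ c) (n.+1 - (a + b + c - mindeg)) d)).
apply: mxrankS; apply/row_subP => i; rewrite row_mul.
have : row i (kermx (syzmx n)) *m syzmx n = 0 by rewrite -row_mul mulmx_ker row0.
have [A [B [C [-> hA hB hC]]]] := rVsyzP (row i (kermx (syzmx n))).
move=> /(rVsyz_mul hA hB hC) [_ _ _ e].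
rewrite mul_rVsyz // mul0r addr0.
have eg : - B0 * A + A0 * B = ell ^+ c * (A * C0 - A0 * C).
  apply: subr0_eq.
  have -> : - B0 * A + A0 * B - ell ^+ c * (A * C0 - A0 * C) =
   A0 * ('X^a * A + B + ell ^+ c * C) - A * ('X^a * A0 + B0 + ell ^+ c * C0) by ring.
  by rewrite e e0 !mulr0 subr0.
rewrite eg; apply: sub_mulmxp.
have := sX _ _ hA hB; rewrite eg.
have [->|g0] := eqVneq (A * C0 - A0 * C) 0; first by rewrite size_poly0.
rewrite fsize_mul ?ellX_neq0 // size_ellX.
have := mindeg_half.
by move: g0; rewrite -size_poly_gt0 /d; lia.
Qed.

(** Syzygies form a graded free module with generators in degrees m and a + b + c - m
    (Hilbert-Burch). Below the second degree the two bounds on the kernel agree; from there on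
    the rank of the matrix is bounded by its number of columns, which is what remains. *)
Lemma syzmx_rank n :
  (n.+1 - \rank (syzmx n) + ((n.+1 - a) + (n.+1 - b) + (n.+1 - c)) =
   n.+1 + (n.+1 - mindeg) + (n.+1 - (a + b + c - mindeg)))%N.
Proof.
have := syzmx_ker_ge n; have := syzmx_ker_le n.
have := rank_leq_col (syzmx n); have := rank_leq_row (syzmx n).
rewrite mxrank_ker => h1 h2.
have := mindeg_half; have := mindeg_min has_syz_ab.
have := mindeg_min has_syz_ac; have := mindeg_min has_syz_bc.
have [lt|le] := ltnP n (a + b + c - mindeg)%N; lia.
Qed.

End Fixed.

(** Multiplication by (x + y)^N on k[x, y] / (x^a, y^b), in the basis of monomials. *)
Definition binmx a b N (s t : 'I_a * 'I_b) : k :=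
  if [&& (s.1 <= t.1)%N, (s.2 <= t.2)%N & (t.1 - s.1 + (t.2 - s.2) == N)%N]
  then 'C(N, t.1 - s.1)%:R else 0.

(** The graded piece of this multiplication from degree n - c to degree n, with its rows and
    columns completed by monomials which are zero in the quotient. *)
Definition bandmx a b c n : 'M[k]_(n.+1 - c, n.+1) :=
  \matrix_(i, j) if (j < a)%N && (n - j < b)%N then (ell ^+ c * 'X^i)`_j else 0.

Lemma coef_ellX c i : (ell ^+ c)`_i = 'C(c, i)%:R.
Proof.
rewrite /ell exprDn coef_sum.
have [lt|le] := ltnP i c.+1; last first.
  rewrite bin_small // big1 // => j _.
  rewrite expr1n mulr1 coefMn coefXn; case: eqP => [e|_]; rewrite ?mul0rn //.
  by move: (ltn_ord j) le; rewrite e; lia.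
have lt' : (c - i < c.+1)%N by lia.
rewrite (bigD1 (Ordinal lt')) //= big1 ?addr0 => [|j nj].
  by rewrite expr1n mulr1 coefMn coefXn subKn // eqxx mulr1n bin_sub.
rewrite expr1n mulr1 coefMn coefXn; case: eqP => [e|_]; rewrite ?mul0rn //.
case/eqP: nj; apply: val_inj => /=; move: (ltn_ord j); rewrite e; lia.
Qed.

Lemma coef_ellMX c i j : (ell ^+ c * 'X^i)`_j = if (i <= j)%N then 'C(c, j - i)%:R else 0.
Proof. by rewrite coefMXn coef_ellX ltnNge; case: leqP. Qed.

(** The multiples of x^a and of y^b span the monomials outside of the band, and modulo these only
    the rows of (x + y)^c remain, restricted to the band. *)
Lemma rank_syzmx_band a b c n :
  (n.+1 - \rank (syzmx a b c n) + \rank (bandmx a b c n) =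
   #|[pred j : 'I_n.+1 | (j < a) && (n - j < b)]|)%N.
Proof.
pose P := [pred j : 'I_n.+1 | (j < a)%N && (n - j < b)%N].
pose D (Q : pred 'I_n.+1) : 'M[k]_n.+1 := \matrix_(i, j) ((i == j) && Q j)%:R.
have DE m (A : 'M[k]_(m, n.+1)) Q : A *m D Q = \matrix_(i, j) (A i j * (Q j)%:R).
  apply/matrixP=> i j; rewrite !mxE (bigD1 j) //= !mxE eqxx big1 ?addr0 // => l nl.
  by rewrite !mxE (negPf nl) mulr0.
have DC : D P + D [predC P] = 1%:M.
  apply/matrixP=> i j; rewrite !mxE /in_mem /=.
  case: (i == j) => /=; last by rewrite addr0.
  by case: (_ && _); rewrite /= ?addr0 ?add0r.
have DD : D [predC P] *m D P = 0.
  apply/matrixP=> i j; rewrite DE !mxE /in_mem /=.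
  by case: (i == j); rewrite /= ?mul0r //; case: (_ && _); rewrite /= ?mul0r ?mulr0.
have DI : D P *m D P = D P.
  apply/matrixP=> i j; rewrite DE !mxE /=.
  by case: (i == j); rewrite /= ?mul0r //; case: (_ && _); rewrite /= ?mul0r ?mulr1.
have rkD Q : \rank (D Q) = #|Q|.
  rewrite -(frank_diag k) -frank_mx; apply: eq_frank => s t.
  by rewrite !mxE.
have band : bandmx a b c n = mulmxp (ell ^+ c) _ _ *m D P.
  by apply/matrixP=> i j; rewrite DE !mxE /=; case: (_ && _); rewrite ?mulr0 ?mulr1.
have e : (syzmx a b c n :=: D [predC P] + bandmx a b c n)%MS.
  apply: eqmx_trans (eqmx_sym (addsmxE _ _)) _.
  have e1 : (col_mx (mulmxp 'X^a (n.+1 - a) n.+1) (mulmxp 1 (n.+1 - b) n.+1) :=: D [predC P])%MS.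
    apply/eqmxP/andP; split.
      have sub g d : mulmxp g d n.+1 *m D P = 0 -> (mulmxp g d n.+1 <= D [predC P])%MS.
        by rewrite -[X in (X <= _)%MS]mulmx1 -DC mulmxDr => ->; rewrite add0r submxMl.
      rewrite col_mx_sub !sub //; apply/matrixP=> i j; rewrite DE !mxE /in_mem /=.
        rewrite mul1r coefXn; case: eqP => [e|_]; rewrite ?mul0r //= mul1r.
        by case: andP => // -[h1 h2]; move: (ltn_ord i); lia.
      rewrite -exprD coefXn; case: eqP => [e|_]; rewrite ?mul0r //= mul1r.
      by case: andP => // -[h1 h2]; move: (ltn_ord i); lia.
    apply/row_subP => j; rewrite -addsmxE.
    have rE : row j (D [predC P]) = ([predC P] j)%:R *: delta_mx 0 j.
      apply/rowP=> l; rewrite !mxE eqxx /= [l == j]eq_sym.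
      by case: eqP => [->|]; rewrite ?mulr1 ?mulr0.
    rewrite rE /in_mem /=; case: (ltnP j a) => [ja|aj] /=; last first.
      have lt : (j - a < n.+1 - a)%N by move: (ltn_ord j); lia.
      rewrite scale1r.
      apply: submx_trans (addsmxSl _ _).
      have -> : delta_mx 0 j = row (Ordinal lt) (mulmxp 'X^a (n.+1 - a) n.+1).
        by apply/rowP=> l; rewrite !mxE /= -exprD coefXn subnKC.
      exact: row_sub.
    case: (ltnP (n - j) b) => [jb|bj] /=; first by rewrite scale0r sub0mx.
    have lt : (j < n.+1 - b)%N by move: (ltn_ord j); lia.
    rewrite scale1r.
    apply: submx_trans (addsmxSr _ _).
    have -> : delta_mx 0 j = row (Ordinal lt) (mulmxp 1 (n.+1 - b) n.+1).
      by apply/rowP=> l; rewrite !mxE /= mul1r coefXn.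
    exact: row_sub.
  apply: eqmx_trans (adds_eqmx e1 (eqmx_refl _)) _.
  set C := mulmxp _ _ _.
  have eC : C = C *m D [predC P] + C *m D P by rewrite -mulmxDr addrC DC mulmx1.
  apply/eqmxP/andP; split; rewrite addsmx_sub addsmxSl /=.
    rewrite {1}eC addmx_sub //; first exact: submx_trans (submxMl _ _) (addsmxSl _ _).
    by rewrite -band addsmxSr.
  rewrite band; have -> : C *m D P = C - C *m D [predC P] by rewrite {2}eC addrC addKr.
  rewrite addmx_sub ?addsmxSr // eqmx_opp.
  exact: submx_trans (submxMl _ _) (addsmxSl _ _).
have disj : (D [predC P] :&: bandmx a b c n)%MS = 0.
  apply/eqP; rewrite -submx0; apply/row_subP => i.
  have : (row i (D [predC P] :&: bandmx a b c n) <= D [predC P] :&: bandmx a b c n)%MS.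
    exact: row_sub.
  move: (row i _) => v.
  rewrite sub_capmx => /andP[/submxP[w1 e1]]; rewrite band => /submxP[w2 e2].
  have vD : v *m D P = v by rewrite e2 -!mulmxA DI.
  by rewrite -vD e1 -mulmxA DD mulmx0 sub0mx.
rewrite e mxrank_disjoint_sum //.
rewrite rkD; have := cardC P; rewrite card_ord.
have := rank_leq_col (col_mx (D [predC P]) (bandmx a b c n)).
rewrite -addsmxE mxrank_disjoint_sum //.
rewrite rkD; move: (\rank _) => rk.
move: #|P| #|[predC P]|; lia.
Qed.

Lemma frank_binmx_block a b c n :
  frank (fun s t : 'I_a * 'I_b => if (s.1 + s.2 + c == n)%N && (t.1 + t.2 == n)%N
    then binmx c s t else 0) = \rank (bandmx a b c n).
Proof.
rewrite -frank_mx; apply/eqP; rewrite eqn_leq; apply/andP; split.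
  pose f (s : 'I_a * 'I_b) : option 'I_(n.+1 - c) :=
    if (s.1 + s.2 + c == n)%N then insub (nat_of_ord s.1) else None.
  pose g (t : 'I_a * 'I_b) : option 'I_(n.+1) :=
    if (t.1 + t.2 == n)%N then insub (nat_of_ord t.1) else None.
  apply: (frank_select (f := f) (g := g)) => -[s1 s2] [t1 t2]; rewrite /f /g /binmx /=.
  case: eqP => //= es; rewrite insubT; first lia.
  move=> h1; case: eqP => //= et; rewrite insubT; first lia.
  move=> h2; rewrite mxE /= coef_ellMX ltn_ord /=.
  have -> : (n - t1 < b)%N by move: (ltn_ord t2); lia.
  case: (leqP s1 t1) => //= h.
  case: (leqP s2 t2) => //= h'.
    by have -> : (t1 - s1 + (t2 - s2) == c)%N by lia.
  by rewrite bin_small //; lia.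
pose f (i : 'I_(n.+1 - c)) : option ('I_a * 'I_b) :=
  match insub (nat_of_ord i), insub (n - c - i)%N with
  | Some u, Some v => Some (u, v) | _, _ => None end.
pose g (i : 'I_(n.+1)) : option ('I_a * 'I_b) :=
  match insub (nat_of_ord i), insub (n - i)%N with
  | Some u, Some v => Some (u, v) | _, _ => None end.
apply: (frank_select (f := f) (g := g)) => i j; rewrite /f /g mxE coef_ellMX.
have hi := ltn_ord i; have hj := ltn_ord j.
case: insubP => [s1 h1 e1|h1]; last first.
  case: andP => // -[ja jb]; case: leqP => // ij; exfalso; lia.
case: insubP => [s2 h2 e2|h2]; last first.
  case: andP => // -[ja jb]; case: leqP => // ij; rewrite bin_small //; lia.
case: insubP => [t1 h3 e3|h3]; last by rewrite ifN //; lia.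
case: insubP => [t2 h4 e4|h4]; last by rewrite ifN //; lia.
rewrite /binmx /= h3 h4 /=.
move: e1 e2 e3 e4 => /= e1 e2 e3 e4.
have -> : (s1 + s2 + c == n)%N by lia.
have -> : (t1 + t2 == n)%N by lia.
rewrite /= e1 e3; case: leqP => //= ij.
rewrite e2 e4; case: ifP => // h; rewrite bin_small //.
by move: h; rewrite -[LHS]/(_ && _); lia.
Qed.

(** The dimension of k[x, y] / (x^a, y^b, (x + y)^c). *)
Definition tlen a b c : nat := (a * b - frank (@binmx a b c))%N.

Lemma frank_binmx_le a b c : (frank (@binmx a b c) <= a * b)%N.
Proof. by apply: leq_trans (frank_le_card _) _; rewrite card_prod !card_ord. Qed.

Lemma card_antidiag a b n :
  #|[pred j : 'I_n.+1 | (j < a)%N && (n - j < b)%N]| =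
  #|[pred t : 'I_a * 'I_b | (t.1 + t.2 == n)%N]|.
Proof.
apply/eqP; rewrite eqn_leq; apply/andP; split.
  pose f (i : 'I_(n.+1)) : option ('I_a * 'I_b) :=
    match insub (nat_of_ord i), insub (n - i)%N with
    | Some u, Some v => Some (u, v) | _, _ => None end.
  apply: (card_partial_inj (f := f)) => [i /= /andP[h1 h2]|i j /= /andP[h1 h2] /andP[h3 h4]].
    rewrite /f !insubT; eexists; first by [].
    by move=> /=; move: (ltn_ord i); lia.
  by rewrite /f !insubT => -[e _]; apply: val_inj.
pose f (t : 'I_a * 'I_b) : option 'I_(n.+1) := insub (nat_of_ord t.1).
apply: (card_partial_inj (f := f)) => [[t1 t2] /= /eqP e|[t1 t2] [u1 u2] /= /eqP e /eqP e'].
  rewrite /f insubT /=; first lia.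
  move=> h; exists (Ordinal h) => //=; rewrite ltn_ord /=.
  by move: (ltn_ord t2); lia.
rewrite /f /= insubT; first lia.
move=> h; rewrite insubT; first lia.
move=> h' [e1]; congr (_, _); apply: val_inj => //=; lia.
Qed.

Lemma tlen_sum a b c : tlen a b c =
  (\sum_(n < (a + b + c).+1) (n.+1 - \rank (syzmx a b c n)))%N.
Proof.
have eS : (frank (@binmx a b c) + \sum_(n < (a + b + c).+1) (n.+1 - \rank (syzmx a b c n)) =
    a * b)%N.
  have -> : (a * b = \sum_(n < (a + b + c).+1)
      #|[pred t : 'I_a * 'I_b | (t.1 + t.2 == n)%N]|)%N.
    rewrite -[a in LHS]card_ord -[b in LHS]card_ord -card_prod -sum1_card.
    rewrite (partition_big (fun t : 'I_a * 'I_b => inord (t.1 + t.2) : 'I_(a + b + c).+1)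
       predT) //=.
    apply: eq_bigr => n _; rewrite -sum1_card; apply: eq_bigl => -[t1 t2] /=.
    rewrite -[_ == n]/(inord (t1 + t2) == n) -(inj_eq val_inj) /= inordK //.
    by move: (ltn_ord t1) (ltn_ord t2); lia.
  rewrite (frank_blocks (K := 'I_(a + b + c).+1)
      (f := fun s : 'I_a * 'I_b => inord (s.1 + s.2 + c))
      (g := fun t : 'I_a * 'I_b => inord (t.1 + t.2))); last first.
    move=> [s1 s2] [t1 t2] /=; apply: contraNeq; rewrite /binmx /=.
    case: and3P => [[h1 h2 /eqP h3]|]; last by rewrite eqxx.
    move=> _; apply/eqP; congr inord; lia.
  rewrite -big_split; apply: eq_bigr => n _ /=.
  rewrite -card_antidiag -(rank_syzmx_band _ _ c) addnC; congr addn.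
  rewrite -frank_binmx_block; apply: eq_frank => -[s1 s2] [t1 t2] /=.
  rewrite -!(inj_eq val_inj) /= !inordK //; move: (ltn_ord t1) (ltn_ord t2) (ltn_ord s1) (ltn_ord s2); lia.
by rewrite /tlen -eS addKn.
Qed.

Lemma sum_ramp N x : (x <= N)%N ->
  (2 * \sum_(n < N) (n.+1 - x) = (N - x) * (N - x).+1)%N.
Proof.
move=> /subnK <-; elim: (N - x)%N => [|i IH].
  rewrite add0n subnn big1 // => n _; move: (ltn_ord n); lia.
rewrite addSn big_ord_recr /= mulnDr IH; nia.
Qed.

(** The Hilbert function of k[x, y] / (x^a, y^b, (x + y)^c) is determined by the degrees of
    generators and syzygies; this is its sum. *)
Lemma tlenE a b c (m := mindeg a b c) :
  (2 * tlen a b c + a * a + b * b + c * c =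
   m * m + (a + b + c - m) * (a + b + c - m))%N.
Proof.
rewrite tlen_sum; set N := (a + b + c).+1.
have hm := mindeg_half a b c; rewrite -/m in hm.
have : (\sum_(n < N) ((n.+1 - \rank (syzmx a b c n)) + ((n.+1 - a) + (n.+1 - b) + (n.+1 - c)))
  = \sum_(n < N) (n.+1 + (n.+1 - m) + (n.+1 - (a + b + c - m))))%N.
  by apply: eq_bigr => n _; rewrite syzmx_rank.
rewrite !big_split /= => e.
have hT := @sum_ramp N 0 isT.
have ha : (a <= N)%N by rewrite /N; lia.
have hb : (b <= N)%N by rewrite /N; lia.
have hc : (c <= N)%N by rewrite /N; lia.
have h1 : (m <= N)%N by rewrite /N; lia.
have h2 : (a + b + c - m <= N)%N by rewrite /N; lia.
move/sum_ramp in ha; move/sum_ramp in hb; move/sum_ramp in hc.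
move/sum_ramp in h1; move/sum_ramp in h2.
have hT' : (\sum_(n < N) n.+1 = \sum_(n < N) (n.+1 - 0))%N.
  by apply: eq_bigr => n _; rewrite subn0.
rewrite hT' in e.
move: e hT ha hb hc h1 h2.
move: (\sum_(n < N) (n.+1 - \rank _))%N (\sum_(n < N) (n.+1 - 0))%N
  (\sum_(n < N) (n.+1 - a))%N (\sum_(n < N) (n.+1 - b))%N (\sum_(n < N) (n.+1 - c))%N
  (\sum_(n < N) (n.+1 - m))%N (\sum_(n < N) (n.+1 - (a + b + c - m)))%N.
move=> l T ta tb tc tm tm'.
have : (m + m <= a + b + c)%N by lia.
rewrite /N; clearbody m; clear.
move=> hm e hT ha hb hc h1 h2.
have [M eM] : exists M, (a + b + c = m + M)%N by exists (a + b + c - m)%N; lia.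
rewrite eM addKn in h2 *; rewrite eM in ha hb hc h1 hT.
rewrite -addnS addKn in h1.
have [xa ea] : exists x, ((m + M).+1 = a + x)%N by exists ((m + M).+1 - a)%N; lia.
have [xb eb] : exists x, ((m + M).+1 = b + x)%N by exists ((m + M).+1 - b)%N; lia.
have [xc ec] : exists x, ((m + M).+1 = c + x)%N by exists ((m + M).+1 - c)%N; lia.
rewrite ea addKn in ha; rewrite eb addKn in hb; rewrite ec addKn in hc.
rewrite -addSn addnK in h2.
rewrite subn0 in hT.
have [eA eB eC] : [/\ xa = b + c + 1, xb = a + c + 1 & xc = a + b + 1]%N by split; lia.
rewrite {}eA in ha; rewrite {}eB in hb; rewrite {}eC in hc.
have sq : ((a + b + c) * (a + b + c) = (m + M) * (m + M))%N by rewrite eM.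
nia.
Qed.

End Syzygies.

(** * The least degree of a syzygy in characteristic p *)

Section Shift.
Variable k : fieldType.
Implicit Types (A B C : {poly k}) (a b c i j l n : nat).

Lemma size_mul_bound A B m n n' : (size A <= m)%N -> (size B <= n.+1)%N -> (m + n <= n')%N ->
  (size (A * B)%R <= n')%N.
Proof.
have [->|A0] := eqVneq A 0; first by rewrite mul0r size_poly0.
have [->|B0] := eqVneq B 0; first by rewrite mulr0 size_poly0.
by move: (A0) (B0); rewrite -!size_poly_gt0 fsize_mul //; lia.
Qed.

(** A syzygy of the larger powers is one of the smaller powers, with the extra factors moved into
    its entries. *)
Lemma mindeg_le_shift a b c i j l :
  (mindeg k a b c <= mindeg k (a + i) (b + j) (c + l))%N.
Proof.
have [A [B [C [[hA hB hC e] nz]]]] := min_syz k (a + i) (b + j) (c + l).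
set n := mindeg _ _ _ _ in hA hB hC *; apply: mindeg_min.
apply/has_syzP; exists ('X^i * A), B, (ell k ^+ l * C); split; last first.
  by rewrite !mulf_eq0 (negPf (ellX_neq0 _ _)) expf_eq0 polyX_eq0 andbF.
split; last by rewrite !mulrA -!exprD.
- have [->|A0] := eqVneq A 0; first by rewrite mulr0 size_poly0.
  rewrite mulrC size_mulXn //.
  by move: A0 hA; rewrite -size_poly_gt0; lia.
- lia.
- have [->|C0] := eqVneq C 0; first by rewrite mulr0 size_poly0.
  rewrite fsize_mul ?ellX_neq0 // size_ellX.
  by move: C0 hC; rewrite -size_poly_gt0; lia.
Qed.

(** A syzygy of the smaller powers, multiplied by all the extra factors. *)
Lemma mindeg_shift_le a b c i j l :
  (mindeg k (a + i) (b + j) (c + l) <= mindeg k a b c + i + j + l)%N.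
Proof.
have [A [B [C [[hA hB hC e] nz]]]] := min_syz k a b c.
set n := mindeg _ _ _ _ in hA hB hC *; apply: mindeg_min.
apply/has_syzP; exists (A * ell k ^+ l), (B * ('X^i * ell k ^+ l)), (C * 'X^i).
split; last first.
  by rewrite !mulf_eq0 (negPf (ellX_neq0 _ _)) expf_eq0 polyX_eq0 andbF !orbF.
have hXl : (size ('X^i * ell k ^+ l)%R <= (i + l).+1)%N.
  by apply: (@size_mul_bound _ _ i.+1 l); rewrite ?size_polyXn ?size_ellX //; lia.
split.
- have [->|A0] := eqVneq A 0; first by rewrite mul0r size_poly0.
  move: (A0); rewrite -size_poly_gt0 => ?.
  by apply: (size_mul_bound hA (n := l)); rewrite ?size_ellX //; lia.
- have [->|A0] := eqVneq B 0; first by rewrite mul0r size_poly0.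
  move: (A0); rewrite -size_poly_gt0 => ?.
  by apply: (size_mul_bound hB (n := i + l)) => //; lia.
- have [->|A0] := eqVneq C 0; first by rewrite mul0r size_poly0.
  move: (A0); rewrite -size_poly_gt0 => ?.
  by apply: (size_mul_bound hC (n := i)); rewrite ?size_polyXn //; lia.
have -> : 'X^(a + i) * (A * ell k ^+ l) + B * ('X^i * ell k ^+ l) + ell k ^+ (c + l) * (C * 'X^i)
  = 'X^i * ell k ^+ l * ('X^a * A + B + ell k ^+ c * C) by rewrite !exprD; ring.
by rewrite e mulr0.
Qed.

(** The length is quadratic in a, b, c and the least degree of a syzygy, and the latter varies
    no faster than the exponents. *)
Lemma tlen_shift a b c i j l (n := (a + i + (b + j) + (c + l))%N) :
  (tlen k (a + i) (b + j) (c + l) <= tlen k a b c + 4 * (i + j + l) * n)%N /\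
  (tlen k a b c <= tlen k (a + i) (b + j) (c + l) + 4 * (i + j + l) * n)%N.
Proof.
have := tlenE k a b c; have := tlenE k (a + i) (b + j) (c + l).
have := mindeg_le_shift a b c i j l; have := mindeg_shift_le a b c i j l.
have := mindeg_half k a b c; have := mindeg_half k (a + i) (b + j) (c + l).
rewrite /n; move: (mindeg _ _ _ _) (mindeg _ _ _ _) (tlen _ _ _ _) (tlen _ _ _ _).
move=> m m' l0 l' h1 h2 h3 h4.
have [M' eM'] : exists M', (a + i + (b + j) + (c + l) = m' + M')%N.
  by exists (a + i + (b + j) + (c + l) - m')%N; lia.
have [M eM] : exists M, (a + b + c = m + M)%N.
  by exists (a + b + c - m)%N; lia.
rewrite eM' eM !addKn => e' e.
have hm : (m <= M)%N by lia.
have hm' : (m' <= M')%N by lia.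
have [D eD] : exists D, (i + j + l = D)%N by eexists.
have hMM : (M' <= M + D)%N by lia.
have hMM' : (M <= M' + D)%N by lia.
have hmm : (m' <= m + D)%N by lia.
rewrite eD.
have sq x y d s : (x <= y + d)%N -> (x <= s)%N -> (y <= s)%N ->
   (x * x <= y * y + 2 * d * s)%N by clear; nia.
have q1 := sq m' m D (m' + M')%N hmm ltac:(lia) ltac:(lia).
have q2 := sq M' M D (m' + M')%N hMM ltac:(lia) ltac:(lia).
have q3 := sq M M' D (m' + M')%N hMM' ltac:(lia) ltac:(lia).
have q4 : (m * m <= m' * m')%N by nia.
have q5 := sq (a + i)%N a i (m' + M')%N ltac:(lia) ltac:(lia) ltac:(lia).
have q6 := sq (b + j)%N b j (m' + M')%N ltac:(lia) ltac:(lia) ltac:(lia).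
have q7 := sq (c + l)%N c l (m' + M')%N ltac:(lia) ltac:(lia) ltac:(lia).
have q8 : (a * a <= (a + i) * (a + i))%N by nia.
have q9 : (b * b <= (b + j) * (b + j))%N by nia.
have q10 : (c * c <= (c + l) * (c + l))%N by nia.
have q11 : (2 * i * (m' + M') + 2 * j * (m' + M') + 2 * l * (m' + M') = 2 * D * (m' + M'))%N.
  by rewrite -eD; ring.
have q12 : (4 * D * (m' + M') = 2 * (2 * D * (m' + M')))%N by ring.
rewrite q12.
move: (2 * D * _)%N q1 q2 q3 q11 => T q1 q2 q3 q11.
move: (m' * m')%N (M' * M')%N (m * m)%N (M * M)%N ((a + i) * _)%N ((b + j) * _)%N ((c + l) * _)%N
  (a * a)%N (b * b)%N (c * c)%N (2 * i * _)%N (2 * j * _)%N (2 * l * _)%N q1 q2 q3 q4 q5 q6 q7 q8 q9 q10 q11 e e'.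
clear; lia.
Qed.

End Shift.

Lemma fdvdp_leq (k : fieldType) (g h : {poly k}) : h != 0 -> g %| h -> (size g <= size h)%N.
Proof. exact: dvdp_leq. Qed.

Lemma size_mul_ellX (k : fieldType) (g : {poly k}) c : g != 0 ->
  size (g * ell k ^+ c) = (size g + c)%N.
Proof.
move=> g0; rewrite fsize_mul ?ellX_neq0 // size_ellX.
by move: g0; rewrite -size_poly_gt0; lia.
Qed.

Lemma size_deriv_mul (k : fieldType) (g h : {poly k}) : g != 0 -> h != 0 ->
  (size (g^`() * h)%R <= (size g + size h).-2)%N.
Proof.
move=> g0 h0; have [->|dg0] := eqVneq g^`() 0; first by rewrite mul0r size_poly0.
rewrite fsize_mul //; have : (size g^`() < size g)%N by exact: lt_size_deriv.
by move: (size g^`()) (size g) (size h) => x y z; lia.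
Qed.

Lemma split_multiplicity (k : fieldType) (g : {poly k}) x : g != 0 ->
  exists m (h : {poly k}), ~~ root h x /\ g = h * ('X - x%:P) ^+ m.
Proof.
move=> g0; have [m [h /implyP/(_ g0) rh eh]] := multiplicity_XsubC g x.
by exists m, h.
Qed.

Lemma fsize_polyN (k : fieldType) (g : {poly k}) : size (- g) = size g.
Proof. exact: size_polyN. Qed.

Lemma split_gcdp (k : fieldType) (g h : {poly k}) : g != 0 ->
  exists d g1 h1 : {poly k}, [/\ d != 0, g = d * g1, h = d * h1 & coprimep g1 h1].
Proof.
move=> g0; pose d := gcdp g h.
have d0 : d != 0 by rewrite gcdp_eq0 negb_and g0.
have /dvdpP[g1] := dvdp_gcdl g h; rewrite mulrC => eg.
have /dvdpP[h1] := dvdp_gcdr g h; rewrite mulrC => eh.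
exists d, g1, h1; split=> //.
have : d * gcdp g1 h1 %= d by rewrite (eqp_trans (mulp_gcdr _ _ _)) // -eg -eh eqpxx.
rewrite -[X in _ %= X]mulr1 eqp_mul2l // => /eqp_size.
by rewrite /coprimep size_poly1 => ->.
Qed.

Section Frobenius.
Variables (k : fieldType) (p : nat).
Hypothesis pk : p \in [pchar k].
Implicit Types (A B C : {poly k}) (a b c n : nat).

Let p0 : (0 < p)%N. Proof. exact: prime_gt0 (pcharf_prime pk). Qed.

Lemma ell_comp_Xp c : (ell k ^+ c) \Po 'X^p = ell k ^+ (p * c).
Proof.
rewrite rmorphXn /= /ell rmorphD /= comp_polyX comp_polyC exprM; congr (_ ^+ _).
rewrite exprDn_pchar ?expr1n //.
rewrite pnatE ?(pcharf_prime pk) // inE /= (pcharf_prime pk) /=.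
by rewrite -polyC_natr (pcharf0 pk).
Qed.

Lemma size_comp_Xp A n : (size A <= n.+1)%N -> (size (A \Po 'X^p) <= (p * n).+1)%N.
Proof.
move=> h; apply: leq_trans (size_comp_poly_leq _ _) _.
by rewrite size_polyXn /= ltnS mulnC leq_mul2l -subn1 leq_subLR add1n h orbT.
Qed.

Lemma mindeg_mulp_le a b c : (mindeg k (p * a) (p * b) (p * c) <= p * mindeg k a b c)%N.
Proof.
have [A [B [C [[hA hB hC e] nz]]]] := min_syz k a b c.
set n := mindeg _ _ _ _ in hA hB hC *; apply: mindeg_min.
apply/has_syzP; exists (A \Po 'X^p), (B \Po 'X^p), (C \Po 'X^p); split; last first.
  by rewrite !comp_poly_eq0 // size_polyXn.
have sz (D : {poly k}) d : (size D <= n.+1 - d)%N -> (size (D \Po 'X^p) <= (p * n).+1 - p * d)%N.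
  have [->|D0] := eqVneq D 0; first by rewrite comp_poly0 size_poly0.
  move: (D0); rewrite -size_poly_gt0 => D1 hD.
  have dn : (d <= n)%N by lia.
  have /size_comp_Xp : (size D <= (n - d).+1)%N by lia.
  by rewrite mulnBr subSn // leq_mul2l dn orbT.
split; rewrite ?sz //.
have -> : 'X^(p * a) = 'X^a \Po 'X^p :> {poly k} by rewrite comp_Xn_poly exprM.
by rewrite -ell_comp_Xp -!rmorphM -!rmorphD /= e comp_poly0.
Qed.

(** Polynomials are a free module over those in X^p, with basis 1, X, ..., X^(p-1); this is the
    coordinate at X^r. *)
Definition part r A : {poly k} := \poly_(j < size A) A`_(p * j + r).

Lemma coef_part r A j : (part r A)`_j = A`_(p * j + r).
Proof.
rewrite coef_poly; case: ltnP => // h; rewrite nth_default //.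
by apply: leq_trans h _; rewrite (leq_trans (leq_pmull j p0)) ?leq_addr.
Qed.

Lemma part_compM r g A : (r < p)%N -> part r ((g \Po 'X^p) * A) = g * part r A.
Proof.
move=> rp; elim/poly_ind: g => [|g c IH].
  rewrite comp_poly0 !mul0r; apply/polyP=> i.
  by rewrite coef_part !coef0.
apply/polyP=> i; rewrite coef_part comp_polyD comp_polyM comp_polyX comp_polyC.
rewrite !mulrDl !coefD !coefCM coef_part; congr (_ + _).
rewrite [_ * 'X^p]mulrC [_ * 'X]mulrC -!mulrA coefXnM coefXM -IH.
case: i => [|i]; first by rewrite muln0 add0n rp.
rewrite coef_part ifN /=; last by rewrite -leqNgt mulnS -addnA leq_addr.
by congr (_`_ _); rewrite mulnS; lia.
Qed.

(** A syzygy of p-th powers splits into its coordinates over the polynomials in X^p, and each of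
    these comes from a syzygy by the substitution of X^p for X. *)
Lemma mindeg_mulp a b c : mindeg k (p * a) (p * b) (p * c) = (p * mindeg k a b c)%N.
Proof.
apply/eqP; rewrite eqn_leq mindeg_mulp_le /=.
have [A [B [C [[hA hB hC e] nz]]]] := min_syz k (p * a) (p * b) (p * c).
set n := mindeg _ _ _ _ in hA hB hC *.
have sz r (D : {poly k}) d : (size D <= n.+1 - p * d)%N -> (size (part r D) <= (n %/ p).+1 - d)%N.
  move=> hD; apply/leq_sizeP => j hj; rewrite coef_part nth_default //.
  apply: leq_trans hD _.
  have := ltn_ceil n p0; nia.
suff [r rp nzr] : exists2 r, (r < p)%N & ~~ [&& part r A == 0, part r B == 0 & part r C == 0].
  have : has_syz k a b c (n %/ p).
    apply/has_syzP; exists (part r A), (part r B), (part r C); split=> //.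
    split; rewrite ?sz //.
    have -> : 'X^a * part r A = part r ('X^(p * a) * A).
      by rewrite exprM -(comp_Xn_poly 'X^p a) part_compM.
    rewrite -part_compM // ell_comp_Xp.
    by apply/polyP=> j; rewrite !coefD !coef_part -!coefD e !coef0.
  rewrite has_syzE => h; apply: leq_trans (leq_trunc_div n p).
  by rewrite mulnC leq_mul2r h orbT.
have nzp (D : {poly k}) : D != 0 -> exists2 r, (r < p)%N & part r D != 0.
  move=> D0; exists ((size D).-1 %% p)%N; first by rewrite ltn_mod.
  apply: contraNneq D0 => /(congr1 (fun f : {poly k} => f`_((size D).-1 %/ p))).
  rewrite coef_part coef0 [(p * _)%N]mulnC -divn_eq => h.
  by rewrite -lead_coef_eq0 lead_coefE h.
have [A0|/nzp[r rp h]] := eqVneq A 0; last by exists r => //; rewrite (negPf h).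
have [B0|/nzp[r rp h]] := eqVneq B 0; last by exists r => //; rewrite (negPf h) andbF.
have [C0|/nzp[r rp h]] := eqVneq C 0; last by exists r => //; rewrite (negPf h) !andbF.
by move: nz; rewrite A0 B0 C0 eqxx.
Qed.

(** By flatness of Frobenius; numerically, all the quantities in the formula for the length are
    multiplied by p^2. *)
Lemma tlen_mulp a b c : tlen k (p * a) (p * b) (p * c) = (p * p * tlen k a b c)%N.
Proof.
have := tlenE k a b c; have := tlenE k (p * a) (p * b) (p * c).
rewrite mindeg_mulp; have := mindeg_half k a b c.
move: (mindeg _ _ _ _) (tlen _ _ _ _) (tlen _ _ _ _) => m l l' h.
have [M eM] : exists M, (a + b + c = m + M)%N.
  by exists (a + b + c - m)%N; lia.
cbv zeta; have -> : (p * a + p * b + p * c - p * m = p * M)%N by rewrite -!mulnDr eM mulnDr addKn.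
rewrite eM addKn => e1 e2.
have : (p * p * (2 * l + a * a + b * b + c * c) = p * p * (m * m + M * M))%N by rewrite e2.
lia.
Qed.

(** A syzygy for exponents i, j, l gives one for p i, p j, p l by the substitution of p-th powers of
    the variables, and it can then be multiplied by the missing powers. *)
Lemma mindeg_le_mulp a b c i j l :
  (mindeg k a b c <= p * mindeg k i j l + (a - p * i) + (b - p * j) + (c - p * l))%N.
Proof.
rewrite -mindeg_mulp.
apply: leq_trans (mindeg_shift_le k _ _ _ (a - p * i) (b - p * j) (c - p * l)).
have := mindeg_le_shift k a b c (p * i - a) (p * j - b) (p * l - c).
by rewrite -!maxnE ![maxn _ (p * _)]maxnC.
Qed.

(** Over a field that is not perfect such a polynomial need not be a p-th power. *)
Lemma deriv0_comp A : A^`() = 0 -> A = part 0 A \Po 'X^p.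
Proof.
move=> dA; apply/polyP=> i; rewrite coef_comp_poly_Xn // coef_part addn0.
case: ifP => [pi|npi]; first by rewrite mulnC divnK.
case: i npi => [|i] npi; first by rewrite dvdn0 in npi.
have : (A^`())`_i = 0 by rewrite dA coef0.
rewrite coef_deriv -mulr_natr => /eqP; rewrite mulf_eq0 => /orP[/eqP //|].
by rewrite -(dvdn_pcharf pk) npi.
Qed.

Lemma dvdp_XsubC_cofactor G U (x : k) m d : ~~ root U x ->
  ('X - x%:P) ^+ d %| G * (('X - x%:P) ^+ m * U) -> ('X - x%:P) ^+ (d - m) %| G.
Proof.
move=> rU; case: (leqP d m) => [/eqP -> _|/ltnW md]; first by rewrite expr0 dvd1p.
rewrite -{1}(subnK md) exprD mulrCA [_ * (G * U)]mulrC dvdp_mul2r; last first.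
  by rewrite expf_neq0 // polyXsubC_eq0.
by rewrite Gauss_dvdpl // coprimep_expl // coprimep_sym coprimep_XsubC.
Qed.

Lemma ellE : ell k = 'X - (-1)%:P. Proof. by rewrite /ell polyCN opprK. Qed.

Lemma coprime_X_ell a c : coprimep ('X^a) (ell k ^+ c).
Proof.
rewrite coprimep_expl // coprimep_expr // coprimep_sym ellE -[X in coprimep _ X]subr0.
by rewrite coprimep_XsubC root_XsubC eq_sym oppr_eq0 oner_eq0.
Qed.

(** Suppose that x^a A + y^b B + (x + y)^c C = 0 in degree n. The Wronskian of the first two terms
    is up to sign that of any two of the three, so that it is divisible by x^(a-1), y^(b-1),
    (x + y)^(c-1): either n is large, or the Wronskian is zero. In the second case the terms have,
    up to a common factor, derivative zero, and thus come from a syzygy by the substitution of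
    p-th powers of the variables. *)
Lemma mindeg_lower a b c (n := mindeg k a b c) :
  [\/ (a + b + c <= n.*2.+1)%N,
     [\/ (a + b <= n)%N, (a + c <= n)%N | (b + c <= n)%N] |
     exists i j l, [/\ (p * i <= n)%N, (p * j <= n)%N, (p * l <= n)%N &
       (p * mindeg k i j l + (a - p * i) + (b - p * j) + (c - p * l) <= n)%N]].
Proof.
have [A [B [C [[hA hB hC e] nz]]]] := min_syz k a b c.
rewrite -/n in hA hB hC.
have [A0|A0] := eqVneq A 0.
  have B0 : B != 0.
    apply: contraNneq nz => B0; move: e; rewrite A0 B0 mulr0 !add0r => /eqP.
    by rewrite mulf_eq0 (negPf (ellX_neq0 _ _)) /= !eqxx.
  have eB : B = - (ell k ^+ c * C).
    by have /eqP := e; rewrite A0 mulr0 add0r addr_eq0 => /eqP.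
  constructor 2; constructor 3.
  have C0 : C != 0 by apply: contraNneq B0 => C0; rewrite eB C0 mulr0 oppr0.
  have : (size (ell k ^+ c * C)%R <= n.+1 - b)%N by rewrite -size_polyN -eB.
  rewrite fsize_mul ?ellX_neq0 // size_ellX.
  by move: C0; rewrite -size_poly_gt0; lia.
have [B0|B0] := eqVneq B 0.
  constructor 2; constructor 2.
  have : ell k ^+ c %| 'X^a * A.
    have /eqP := e; rewrite B0 addr0 addr_eq0 => /eqP ->.
    by rewrite -mulrN dvdp_mulr.
  rewrite Gauss_dvdpr; last by rewrite coprimep_sym coprime_X_ell.
  move/(fdvdp_leq A0); rewrite size_ellX; lia.
have [C0|C0] := eqVneq C 0.
  constructor 2; constructor 1.
  have eB : B = - ('X^a * A).
    by have /eqP := e; rewrite C0 mulr0 addr0 addrC addr_eq0 => /eqP.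
  have : (size ('X^a * A)%R <= n.+1 - b)%N by rewrite -size_polyN -eB.
  by rewrite mulrC size_mulXn //; move: A0; rewrite -size_poly_gt0; lia.
set P := 'X^a * A in e; set Rr := ell k ^+ c * (- C).
have eR : Rr = P + B.
  by apply/eqP; rewrite /Rr mulrN eq_sym -addr_eq0 e.
have P0 : P != 0 by rewrite mulf_neq0 // expf_neq0 // polyX_eq0.
have R0 : Rr != 0 by rewrite mulf_neq0 ?ellX_neq0 // oppr_eq0.
have sP : (size P <= n.+1)%N.
  by rewrite /P mulrC size_mulXn //; move: A0 hA; rewrite -size_poly_gt0; lia.
pose W := P^`() * B - P * B^`().
have eW : W = P^`() * Rr - P * Rr^`().
  by rewrite /W eR derivD; ring.
have dX (x : {poly k}) (d : nat) (y : {poly k}) : x ^+ d.-1 %| (x ^+ d * y)^`().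
  case: d => [|d]; first by rewrite dvd1p.
  rewrite derivM deriv_exp /= dvdp_add //.
    by apply: dvdp_mulr; rewrite -mulr_natl; do 2!apply: dvdp_mull.
  by rewrite exprS; apply: dvdp_mulr; apply: dvdp_mull.
have dX' (x : {poly k}) (d : nat) (y : {poly k}) : x ^+ d.-1 %| (x ^+ d * y).
  case: d => [|d]; first by rewrite dvd1p.
  by rewrite exprS; apply: dvdp_mulr; apply: dvdp_mull.
have dW : 'X^(a.-1) * ell k ^+ c.-1 %| W.
  rewrite Gauss_dvdp ?coprime_X_ell //; apply/andP; split.
    by rewrite /W dvdp_sub // dvdp_mulr // ?dX ?dX'.
  by rewrite eW dvdp_sub // dvdp_mull // ?dX ?dX'.
(* A nonzero Wronskian has degree at least a + c - 2 and at most 2 n - b - 1. *)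
have [W0|W0] := eqVneq W 0; last first.
  constructor 1.
  have := fdvdp_leq W0 dW; rewrite mulrC size_mulXn ?ellX_neq0 // size_ellX.
  have : (size W <= (size P + size B).-2)%N.
    rewrite /W (leq_trans (size_polyD _ _)) // geq_max size_polyN size_deriv_mul //=.
    by rewrite [P * _]mulrC addnC size_deriv_mul.
  move: A0 B0; rewrite -!size_poly_gt0; move: sP hB; clear.
  by move: (size A) (size B) (size W) (size P); clear; lia.
(* The Wronskian of the coprime parts P1, B1 vanishes as well, so that P1 divides its own
   derivative, which is therefore zero. *)
constructor 3.
have [G [P1 [B1 [G0 eP eB cop]]]] := split_gcdp B P0.
have P10 : P1 != 0 by apply: contraNneq P0 => h; rewrite eP h mulr0.
have B10 : B1 != 0 by apply: contraNneq B0 => h; rewrite eB h mulr0.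
have eW1 : P1^`() * B1 = P1 * B1^`().
  apply: (mulfI (mulf_neq0 G0 G0)); apply: subr0_eq; rewrite -W0 /W eP eB !derivM; ring.
have dP1 : P1^`() = 0.
  have : P1 %| P1^`() * B1 by rewrite eW1 dvdp_mulr.
  rewrite Gauss_dvdpl // => d1; apply: contraTeq (lt_size_deriv P10) => h.
  by rewrite -leqNgt dvdp_leq.
have dB1 : B1^`() = 0.
  by have /eqP := eW1; rewrite dP1 mul0r eq_sym mulf_eq0 (negPf P10) => /eqP.
have eP1 := deriv0_comp dP1; have eB1 := deriv0_comp dB1.
set P2 := part 0 P1 in eP1; set B2 := part 0 B1 in eB1.
pose R2 := P2 + B2.
have eR1 : Rr = G * (R2 \Po 'X^p).
  by rewrite comp_polyD -eP1 -eB1 mulrDr -eP -eB eR.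
have P20 : P2 != 0 by apply: contraNneq P10 => h; rewrite eP1 h comp_poly0.
have B20 : B2 != 0 by apply: contraNneq B10 => h; rewrite eB1 h comp_poly0.
have R20 : R2 != 0 by apply: contraNneq R0 => h; rewrite eR1 h comp_poly0 mulr0.
have [i [A2 [rA2]]] := split_multiplicity 0 P20.
rewrite subr0 => eA2.
have [l [C2 [rC2]]] := split_multiplicity (-1) R20.
rewrite -ellE => eC2.
have A20 : A2 != 0 by apply: contraNneq P20 => h; rewrite eA2 h mul0r.
have C20 : C2 != 0 by apply: contraNneq R20 => h; rewrite eC2 h mul0r.
pose d := (maxn (size P2) (size B2)).-1.
pose j := (d.+1 - size B2)%N.
have szP2 : (0 < size P2)%N by rewrite size_poly_gt0.
have szB2 : (0 < size B2)%N by rewrite size_poly_gt0.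
have eSP2 : size P2 = (size A2 + i)%N by rewrite eA2 size_mulXn // addnC.
have eSR2 : size R2 = (size C2 + l)%N.
  by rewrite eC2 size_mul_ellX.
have sR2 : (size R2 <= maxn (size P2) (size B2))%N by apply: size_polyD.
have szC2 : (0 < size C2)%N by rewrite size_poly_gt0.
have szA2 : (0 < size A2)%N by rewrite size_poly_gt0.
have ed : (d.+1 = maxn (size P2) (size B2))%N by rewrite /d prednK // leq_max szP2.
have mxP := leq_maxl (size P2) (size B2); have mxB := leq_maxr (size P2) (size B2).
have md : (mindeg k i j l <= d)%N.
  apply: mindeg_min; apply/has_syzP; exists A2, B2, (- C2); split; last by rewrite (negPf A20).
  split; rewrite ?fsize_polyN.
  - by clear -eSP2 mxP ed; lia.
  - by clear -mxB ed; rewrite /j; lia.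
  - by clear -eSR2 sR2 ed; lia.
  by rewrite mulrN [ell k ^+ l * _]mulrC -eC2 ['X^i * _]mulrC -eA2 /R2 subrr.
have dG : 'X^(a - p * i) * ell k ^+ (c - p * l) %| G.
  rewrite Gauss_dvdp ?coprime_X_ell //; apply/andP; split.
    have eX : 'X = 'X - 0%:P :> {poly k} by rewrite subr0.
    rewrite eX; apply: (@dvdp_XsubC_cofactor G (A2 \Po 'X^p)).
      rewrite /root horner_comp hornerXn expr0n eqn0Ngt p0.
      exact: rA2.
    rewrite -eX.
    have <- : P = G * ('X^(p * i) * (A2 \Po 'X^p)).
      rewrite [P in LHS]eP eP1 eA2 comp_polyM comp_Xn_poly exprM; congr (_ * _).
      by rewrite mulrC.
    by rewrite /P dvdp_mulr.
  rewrite ellE; apply: (@dvdp_XsubC_cofactor G (C2 \Po 'X^p)).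
    rewrite /root horner_comp hornerXn.
    have -> : (-1) ^+ p = -1 :> k.
      by rewrite -(pFrobenius_autE pk) pFrobenius_autN pFrobenius_aut1.
    exact: rC2.
  rewrite -ellE.
  have <- : Rr = G * (ell k ^+ (p * l) * (C2 \Po 'X^p)).
    by rewrite eR1 eC2 comp_polyM ell_comp_Xp [X in _ * X]mulrC.
  by rewrite /Rr dvdp_mulr.
have sG : (a - p * i + (c - p * l) < size G)%N.
  have := fdvdp_leq G0 dG; rewrite mulrC size_mulXn ?ellX_neq0 // size_ellX.
  by rewrite addnS.
have sX (D D1 : {poly k}) : D != 0 -> D = D1 \Po 'X^p -> (size D).-1 = (p * (size D1).-1)%N.
  by move=> _ ->; rewrite size_comp_poly size_polyXn mulnC.
have sP1 := sX _ _ P10 eP1; have sB1 := sX _ _ B10 eB1.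
have szP1 : (0 < size P1)%N by rewrite size_poly_gt0.
have szB1 : (0 < size B1)%N by rewrite size_poly_gt0.
have szG : (0 < size G)%N by rewrite size_poly_gt0.
have hP : (size G + size P1 <= n.+2)%N.
  by move: sP; rewrite eP fsize_mul //; clear; lia.
have szB : (0 < size B)%N by rewrite size_poly_gt0.
have hBb : (b <= n)%N by move: hB szB; clear; lia.
have hB' : (size G + size B1 <= (n.+1 - b).+1)%N.
  by move: hB; rewrite eB fsize_mul //; clear; lia.
have pBj : (p * (size B2).-1 + p * j = p * d)%N.
  by rewrite -mulnDr; congr muln; clear -mxB ed szB2; rewrite /j; lia.
have pd : (size G + p * d <= n.+1)%N.
  have [ePd|eBd] : d = (size P2).-1 \/ d = (size B2).-1.
    by clear -ed szP2 szB2; lia.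
    by rewrite ePd -sP1; clear -hP szP1; lia.
  by rewrite eBd -sB1; clear -hB' szB1; lia.
have pi : (p * i <= p * d)%N.
  by rewrite leq_mul2l; apply/orP; right; clear -eSP2 szA2 mxP ed; lia.
have pj : (p * j <= p * d)%N.
  by rewrite leq_mul2l; apply/orP; right; clear -szB2; rewrite /j; lia.
have pl : (p * l <= p * d)%N.
  by rewrite leq_mul2l; apply/orP; right; clear -eSR2 szC2 sR2 ed; lia.
have pm : (p * mindeg k i j l <= p * d)%N by rewrite leq_mul2l md orbT.
exists i, j, l.
move: (p * i)%N (p * j)%N (p * l)%N (p * d)%N (p * (size B2).-1)%N (p * mindeg k i j l)%N
  pi pj pl pm pd sG hB' hBb pBj sB1 szB1 szP1.
move: (size G) (size P1) (size B1); clear; move=> ????????? *; split; lia.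
Qed.

(** The least degree of a syzygy in characteristic zero: the bound by counting dimensions, unless
    one of the three trivial syzygies does better. *)
Definition mindeg0 i j l : nat := minn (minn (i + j + l)./2 (i + j)) (minn (i + l) (j + l)).

Lemma mindeg_le0 i j l : (mindeg k i j l <= mindeg0 i j l)%N.
Proof.
by rewrite /mindeg0 !leq_min mindeg_half !mindeg_min ?has_syz_ab ?has_syz_ac ?has_syz_bc.
Qed.

(** For small exponents the Frobenius pullbacks have too large a degree to matter. *)
Lemma mindeg_small i j l : (i + j + l < p)%N -> mindeg k i j l = mindeg0 i j l.
Proof.
move=> lp; apply/eqP; rewrite eqn_leq mindeg_le0 /=.
have h := mindeg_half k i j l.
rewrite /mindeg0; set n := mindeg _ _ _ _ in h *.
have [h1|h1|[i' [j' [l' [hi hj hl hn]]]]] := mindeg_lower i j l.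
- by move: h1; rewrite -/n; clear -h; lia.
- by case: h1; rewrite -/n; clear -h; lia.
have z x : (p * x <= n)%N -> x = 0%N.
  by case: x => // x; rewrite mulnS; clear -h lp; lia.
have hi' : i' = 0%N by apply: z.
have hj' : j' = 0%N by apply: z.
have hl' : l' = 0%N by apply: z.
by move: hn; rewrite -/n hi' hj' hl' !muln0 !subn0; clear; lia.
Qed.

Definition mindeg_cands E a b c : seq nat :=
  [seq (p * mindeg0 t.1.1 t.1.2 t.2 + (a - p * t.1.1) + (b - p * t.1.2) + (c - p * t.2))%N
  | t : 'I_E.+1 * 'I_E.+1 * 'I_E.+1 ].

(** When p is large and a, b, c are at most a fixed multiple of p, only boundedly many exponents
    can be pulled back by Frobenius, and all of these are small: the least degree does not
    depend on the field. *)
Lemma mindegE E a b c : (a + b + c <= p * E)%N -> (3 * E < p)%N ->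
  mindeg k a b c = foldr minn (mindeg0 a b c) (mindeg_cands E a b c).
Proof.
move=> hE Ep.
(* A lower bound which is attained up to inequality is the minimum. *)
have foldP (x m : nat) s : (forall y, y \in x :: s -> (m <= y)%N) -> (exists2 y, y \in x :: s & (y <= m)%N) ->
    m = foldr minn x s.
  elim: s => [|z s IH] le [y yin ym] /=.
    have /eqP ex : y == x by move: yin; rewrite inE.
    by apply/eqP; rewrite eqn_leq -{2}ex ym le ?mem_head.
  have [ys|ys] := boolP (y \in x :: s).
    rewrite -IH; last by exists y.
      by apply/esym/minn_idPr/le; rewrite inE mem_head orbT.
    by move=> w; rewrite inE => /orP[/eqP->|ws]; apply: le; rewrite !inE ?eqxx ?ws ?orbT.
  have ez : y = z.
    by apply/eqP; move: yin ys; rewrite !inE; case: (y == x); case: (y == z); case: (y \in s).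
  have mz : m = z by apply/eqP; rewrite eqn_leq -{2}ez ym le ?inE ?eqxx ?orbT.
  rewrite -mz; apply/esym/minn_idPl.
  have {}le w : w \in x :: s -> (m <= w)%N.
    by rewrite inE => /orP[/eqP->|ws]; apply: le; rewrite !inE ?eqxx ?ws ?orbT.
  elim: s le {IH yin ys} => [|w s IH] le /=; first by apply: le; rewrite mem_head.
  rewrite leq_min le ?inE ?eqxx ?orbT //= IH // => u.
  by rewrite inE => /orP[/eqP->|ws]; apply: le; rewrite !inE ?eqxx ?ws ?orbT.
have small (i j l : nat) : (i <= E)%N -> (j <= E)%N -> (l <= E)%N ->
    mindeg k i j l = mindeg0 i j l.
  by move=> *; apply: mindeg_small; lia.
apply: foldP => [y|].
  rewrite inE => /orP[/eqP ->|/mapP[[[i j] l] _ ->]]; first exact: mindeg_le0.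
  rewrite /= -small ?mindeg_le_mulp // -ltnS; exact: ltn_ord.
have h := mindeg_half k a b c.
have [h1|h1|[i [j [l [hi hj hl hn]]]]] := mindeg_lower a b c.
- exists (mindeg0 a b c); first exact: mem_head.
  by rewrite /mindeg0; lia.
- exists (mindeg0 a b c); first exact: mem_head.
  by rewrite /mindeg0; case: h1; lia.
have z x : (p * x <= mindeg k a b c)%N -> (x <= E)%N.
  move=> h1; rewrite -(leq_pmul2l p0); apply: leq_trans hE.
  by clear -h1 h; lia.
have hi' := z _ hi; have hj' := z _ hj; have hl' := z _ hl.
exists (p * mindeg k i j l + (a - p * i) + (b - p * j) + (c - p * l))%N => //.
rewrite inE; apply/orP; right.
apply/mapP; exists (Ordinal (hi' : (i < E.+1)%N), Ordinal (hj' : (j < E.+1)%N), Ordinal (hl' : (l < E.+1)%N)).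
  by rewrite mem_enum.
by rewrite /= small.
Qed.

End Frobenius.

(** * Krull dimension of polynomial rings *)

Section Ideals.
Variable A : comNzRingType.
Implicit Types (I J S : set A).

Lemma ideal0 I : is_ideal I -> I 0. Proof. by case. Qed.
Lemma idealD I x y : is_ideal I -> I x -> I y -> I (x + y).
Proof. by case=> _ h _; apply: h. Qed.
Lemma idealM I a x : is_ideal I -> I x -> I (a * x).
Proof. by case=> _ _; apply. Qed.
Lemma idealMr I a x : is_ideal I -> I x -> I (x * a).
Proof. by rewrite mulrC; apply: idealM. Qed.
Lemma idealN I x : is_ideal I -> I x -> I (- x).
Proof. by move=> iI; rewrite -mulN1r; apply: idealM. Qed.
Lemma idealB I x y : is_ideal I -> I x -> I y -> I (x - y).
Proof. by move=> iI Ix Iy; apply: idealD => //; apply: idealN. Qed.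
Lemma ideal_sum I (T : Type) (s : seq T) (P : pred T) (F : T -> A) : is_ideal I ->
  (forall t, P t -> I (F t)) -> I (\sum_(t <- s | P t) F t).
Proof.
move=> iI h; elim/big_rec: _ => [|t x Pt Ix]; first exact: ideal0.
by apply: idealD => //; apply: h.
Qed.
Lemma ideal_gen_ideal S : is_ideal (ideal_gen S).
Proof.
split=> [I [iI _]|x y hx hy I hI|a x hx I hI].
- exact: ideal0.
- by apply: idealD; [case: hI|apply: hx|apply: hy].
- by apply: idealM; [case: hI|apply: hx].
Qed.

Lemma ideal_gen_sub S : S `<=` ideal_gen S.
Proof. by move=> x Sx I [_]; apply. Qed.

Lemma ideal_gen_min S I : is_ideal I -> S `<=` I -> ideal_gen S `<=` I.
Proof. by move=> iI SI x; apply. Qed.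

(** In a relation between f_0, ..., f_{d-1} with unit coefficients, the terms of least
    degree in f_0 give, modulo f_0, a relation between f_1, ..., f_{d-1}; it holds in
    the prime P_1, which contains f_0. *)
Lemma prime_chain_independent d (P : nat -> set A) (f : nat -> A) (T : eqType)
    (s : seq T) (e : T -> nat -> nat) (c : T -> A) :
  (forall i, (i <= d)%N -> is_prime_ideal (P i)) ->
  (forall i, (i < d)%N -> P i `<=` P i.+1) ->
  (forall i, (i < d)%N -> P i.+1 (f i) /\ ~ P i (f i)) ->
  s != [::] -> uniq s ->
  {in s &, forall t u, (forall i, (i < d)%N -> e t i = e u i) -> t = u} ->
  {in s, forall t, exists v, v * c t = 1} ->
  ~ P 0%N (\sum_(t <- s) c t * \prod_(i < d) f i ^+ e t i).
Proof.
elim: d P f s e c => [|d IH] P f s e c pP sP fP s0 us inj cU.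
  case: s s0 us inj cU => // t s _ us inj cU.
  have -> : s = [::].
    case: s us inj {cU} => // u s /= /andP[]; rewrite inE negb_or => /andP[/eqP tu _] _ inj.
    by case: tu; apply: inj; rewrite ?mem_head // inE mem_head orbT.
  rewrite big_seq1 big_ord0 mulr1 => Pc.
  have [iP nP1 _] := pP 0%N isT.
  have [v ev] := cU t (mem_head _ _).
  by apply: nP1; rewrite -ev; apply: idealM.
move=> hsum.
(* m is the least exponent of f_0 in the relation. *)
have [m [t0 t0s em] minm] : exists2 m, (exists2 t, t \in s & e t 0%N = m) &
    (forall t, t \in s -> (m <= e t 0%N)%N).
  have ex : exists m, has (fun t => e t 0%N == m) s.
    by case: s s0 {us inj cU hsum} => // t s _; exists (e t 0%N); rewrite /= eqxx.
  case: (ex_minnP ex) => m /hasP[t ts /eqP em] mn; exists m; first by exists t.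
  by move=> u us'; apply: mn; apply/hasP; exists u.
pose g t := c t * \prod_(i < d) f i.+1 ^+ e t i.+1.
have eS : \sum_(t <- s) c t * \prod_(i < d.+1) f i ^+ e t i =
    f 0%N ^+ m * \sum_(t <- s) f 0%N ^+ (e t 0%N - m) * g t.
  rewrite mulr_sumr [LHS]big_seq [RHS]big_seq; apply: eq_bigr => t ts.
  by rewrite big_ord_recl /= [RHS]mulrA -exprD subnKC ?minm // mulrCA.
have [iP0 nP0 mP0] := pP 0%N isT.
have [iP1 _ _] := pP 1%N isT.
have [P1f P0f] := fP 0%N isT.
have P0sum : P 0%N (\sum_(t <- s) f 0%N ^+ (e t 0%N - m) * g t).
  have nf : ~ P 0%N (f 0%N ^+ m).
    elim: (m) => [|i IHi]; first by rewrite expr0.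
    by rewrite exprS => /mP0[].
  by move: hsum; rewrite eS => /mP0[].
have := sP 0%N isT _ P0sum.
rewrite (bigID (fun t => e t 0%N == m)) /= => hP1.
have rest : P 1%N (\sum_(t <- s | e t 0%N != m) f 0%N ^+ (e t 0%N - m) * g t).
  rewrite big_seq_cond; apply: ideal_sum => // t /andP[ts ne].
  have : (0 < e t 0%N - m)%N by rewrite subn_gt0 ltn_neqAle eq_sym ne minm.
  case: (e t 0%N - m)%N => // i _; rewrite exprS -mulrA.
  exact: idealMr.
have := idealB iP1 hP1 rest; rewrite addrK.
have -> : \sum_(t <- s | e t 0%N == m) f 0%N ^+ (e t 0%N - m) * g t =
    \sum_(t <- [seq t <- s | e t 0%N == m]) g t.
  rewrite big_filter; apply: eq_bigr => t /eqP ->.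
  by rewrite subnn expr0 mul1r.
apply: (IH (fun i => P i.+1) (fun i => f i.+1) _ (fun t i => e t i.+1) c) => //.
- by move=> i id; apply: pP.
- by move=> i id; apply: sP.
- by move=> i id; apply: fP.
- by rewrite -has_filter; apply/hasP; exists t0 => //; apply/eqP.
- exact: filter_uniq.
- move=> t u; rewrite !mem_filter => /andP[/eqP et ts] /andP[/eqP eu us'] h.
  by apply: inj => // -[|i] id; [rewrite et eu|apply: h].
- by move=> t; rewrite mem_filter => /andP[_]; apply: cU.
Qed.

End Ideals.

Section KrullDimension.
Variables (k : fieldType) (n : nat).
Local Notation A := (mpoly.mpoly n k).
Local Notation msize p := (@mpoly.mmeasure _ _ (mpoly.mpoly_mdeg__canonical__mpoly_Measure _) p).

Lemma mdeg_coord (m : mpoly.multinom n) i : (mpoly.fun_of_multinom m i <= mpoly.mdeg m)%N.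
Proof. by rewrite mpoly.mdegE (bigD1 i) //= leq_addr. Qed.

Lemma msizeX_le (f : A) d e : (msize f <= d)%N -> (msize (f ^+ e) <= (e * d.+1).+1)%N.
Proof.
move=> hf; elim: e => [|e IH]; first by rewrite expr0 mpoly.msize1.
rewrite exprS mulSn; apply: leq_trans (mpoly.msizeM_le _ _) _.
by move: hf IH; move: (msize _) (msize _) (e * _)%N; lia.
Qed.

Lemma msize_prod_le N (f : 'I_N -> A) (e : 'I_N -> nat) d D :
  (forall i, msize (f i) <= d)%N -> (forall i, e i <= D)%N ->
  (msize (\prod_i f i ^+ e i)%R <= N * (D * d.+1).+2 + 1)%N.
Proof.
move=> hf he; elim: N f e hf he => [|N IH] f e hf he; first by rewrite big_ord0 mpoly.msize1.
rewrite big_ord_recl; apply: leq_trans (mpoly.msizeM_le _ _) _.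
have := IH _ _ (fun i => hf (lift ord0 i)) (fun i => he (lift ord0 i)).
have := msizeX_le (e ord0) (hf ord0).
have : (e ord0 * d.+1 <= D * d.+1)%N by rewrite leq_mul2r he orbT.
rewrite mulSn; move: (e _ * _)%N (D * _)%N => x y.
by move: (N * _)%N (msize _) (msize _); lia.
Qed.

(** There are D^(n+1) products of powers less than D of n + 1 polynomials, and they
    lie in a space of dimension at most (const D)^n. *)
Lemma mpoly_dependent (f : 'I_n.+1 -> A) : exists D (v : {ffun 'I_n.+1 -> 'I_D} -> k),
  (exists t, v t != 0) /\ \sum_t v t *: \prod_i f i ^+ t i = 0.
Proof.
pose d := (\max_i msize (f i))%N.
have hf i : (msize (f i) <= d)%N by apply: leq_bigmax.
(* All the products have degree less than D E, so that they involve at most (D E)^n monomials,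
   and D > E^n makes this less than D^(n+1). *)
pose E := (n.+1 * d.+1 + n.+1 * 2 + 1)%N.
pose D := (E ^ n).+1.
pose K := (D * E)%N.
pose T := {ffun 'I_n.+1 -> 'I_D}; pose U := {ffun 'I_n -> 'I_K}.
pose mon (u : U) : mpoly.multinom n := mpoly.Multinom [tuple (u i : nat) | i < n].
pose M : 'M[k]_(#|T|, #|U|) :=
  fmx (fun (t : T) (u : U) => mpoly.mcoeff (mon u) (\prod_i f i ^+ t i)).
have lt : (#|U| < #|T|)%N.
  rewrite !card_ffun !card_ord /K expnMn expnS mulnC ltn_mul2r /D ltnSn andbT.
  by rewrite expn_gt0.
have : kermx M != 0.
  rewrite kermx_eq0; apply/negP => /eqP rk.
  by have := rank_leq_col M; rewrite rk leqNgt lt.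
case/rowV0Pn => v /sub_kermxP vM v0.
exists D, (fun t => v 0 (enum_rank t)); split.
  have /rV0Pn [i vi] := v0; exists (enum_val i); by rewrite enum_valK.
apply/mpoly.mpolyP => m; rewrite mpoly.mcoeff0 raddf_sum /=.
have [bm|/forallPn[i]] := boolP [forall i, (mpoly.fun_of_multinom m i < K)%N].
  pose u : U := [ffun i => Ordinal (forallP bm i)].
  have -> : m = mon u by apply/mpoly.mnmP => i; rewrite mpoly.mnmE ffunE.
  have := congr1 (fun w : 'rV_#|U| => w 0 (enum_rank u)) vM.
  rewrite !mxE => e0; apply: etrans e0.
  rewrite [RHS](reindex (@enum_rank T)) /=; last first.
    by apply: onW_bij; apply: enum_rank_bij.
  by apply: eq_bigr => t _; rewrite mpoly.mcoeffZ mxE !enum_rankK.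
rewrite -leqNgt => hi; rewrite big1 // => t _.
rewrite mpoly.mcoeffZ mpoly.memN_msupp_eq0 ?mulr0 //.
apply: mpoly.msize_mdeg_ge; apply: leq_trans (leq_trans hi (mdeg_coord _ _)).
have := @msize_prod_le n.+1 f (fun i => t i) d D hf (fun i => ltnW (ltn_ord (t i))).
move/leq_trans; apply; rewrite /K /E.
have : (0 < D)%N by [].
by move: (D) => D' h; nia.
Qed.

(** Elements witnessing the strictness of n + 1 inclusions would be algebraically independent. *)
Lemma prime_chain_le (M : set A) d : prime_chain M d -> (d <= n)%N.
Proof.
case=> P [hP sP]; rewrite leqNgt; apply/negP => nd.
have /choice[f fP] : forall i, exists x, (i < d)%N -> P i.+1 x /\ ~ P i x.
  move=> i; have [id|_] := ltnP i d; last by exists 0.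
  have [_ /existsNP[x /not_implyP[h1 h2]]] := sP i id.
  by exists x.
have [D [v [[t0 v0] ev]]] := mpoly_dependent (fun i => f i).
pose e (t : {ffun 'I_n.+1 -> 'I_D}) (i : nat) : nat :=
  if insub i is Some j then t j else 0%N.
have eE t (i : 'I_n.+1) : e t i = t i by rewrite /e valK.
apply: (@prime_chain_independent A n.+1 P f _ [seq t <- enum {ffun 'I_n.+1 -> 'I_D} | v t != 0]
   e (fun t => (v t)%:A)).
- by move=> i id; case: (hP i (leq_trans id nd)).
- by move=> i id; case: (sP i (leq_trans id nd)).
- by move=> i id; apply: fP; apply: leq_trans id nd.
- by rewrite -has_filter; apply/hasP; exists t0 => //; rewrite mem_enum.
- by rewrite filter_uniq ?enum_uniq.
- move=> t u _ _ h; apply/ffunP => i; apply: val_inj.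
  by have := h i (ltn_ord i); rewrite !eE.
- move=> t; rewrite mem_filter => /andP[vt _]; exists ((v t)^-1)%:A.
  by rewrite -scalerAl mul1r scalerA mulVf ?scale1r.
have -> : \sum_(t <- [seq t <- enum {ffun 'I_n.+1 -> 'I_D} | v t != 0])
    (v t)%:A * \prod_(i < n.+1) f i ^+ e t i = \sum_t v t *: \prod_(i < n.+1) f i ^+ t i.
  rewrite big_filter big_enum_cond /= [RHS](bigID (fun t => v t != 0)) /=.
  rewrite [X in _ = _ + X]big1 ?addr0; last by move=> t /negPn /eqP ->; rewrite scale0r.
  apply: eq_bigr => t _; rewrite -scalerAl mul1r; congr (_ *: _).
  by apply: eq_bigr => i _; rewrite eE.
rewrite ev; apply: ideal0; by case: (hP 0%N isT) => -[].
Qed.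

Lemma mpoly_ideal_vars (I : set A) : is_ideal I -> (forall i, I (Xvar k i)) ->
  forall f, mpoly.mcoeff (mpoly.mnm0) f = 0 -> I f.
Proof.
move=> iI Ix f f0; rewrite (mpoly.mpolyE f); apply: ideal_sum => // m _.
have [->|m0] := eqVneq m mpoly.mnm0; first by rewrite f0 scale0r; apply: ideal0.
have [i mi] : exists i, mpoly.fun_of_multinom m i != 0%N.
  apply/existsP; apply: contraNT m0 => /existsPn h; apply/eqP/mpoly.mnmP => i.
  by rewrite mpoly.mnm0E; apply/eqP; have := h i; rewrite negbK.
rewrite -mpoly.mul_mpolyC; apply: idealM => //.
have <- : mpoly.mnm_add (mpoly.mnm_sub m (mpoly.mnm1 i)) (mpoly.mnm1 i) = m.
  apply/mpoly.mnmP => j; rewrite mpoly.mnmDE mpoly.mnmBE mpoly.mnm1E.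
  by case: eqP => [<-|_]; rewrite ?subn0 ?addn0 //= subnK // lt0n.
by rewrite mpoly.mpolyXD; apply: idealM => //; exact: (Ix i).
Qed.

(** The kernel of this substitution is the prime generated by the first i variables. *)
Definition kill_vars (i : nat) : A -> A :=
  mpoly.comp_mpoly [tuple if (j < i)%N then 0 else Xvar k j | j < n].

Lemma kill_varsE i f :
  kill_vars i f = \sum_(m <- mpoly.msupp f) mpoly.mcoeff m f *: kill_vars i (mpoly.mpolyX k m).
Proof. exact: mpoly.comp_mpolyEX. Qed.

Lemma kill_vars_sumZ i (T : Type) (s : seq T) (c : T -> k) (g : T -> A) :
  kill_vars i (\sum_(t <- s) c t *: g t) = \sum_(t <- s) c t *: kill_vars i (g t).
Proof.
by rewrite /kill_vars raddf_sum; apply: eq_bigr => t _; rewrite /= mpoly.comp_mpolyZ.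
Qed.

Lemma kill_vars_X i (j : 'I_n) : kill_vars i (Xvar k j) = if (j < i)%N then 0 else Xvar k j.
Proof.
rewrite /kill_vars /Xvar mpoly.comp_mpolyXU -tnth_nth.
by rewrite tnth_mktuple.
Qed.

Lemma kill_vars_mcoeff0 i f : mpoly.mcoeff mpoly.mnm0 (kill_vars i f) = mpoly.mcoeff mpoly.mnm0 f.
Proof.
rewrite /kill_vars mpoly.comp_mpolyEX [in RHS](mpoly.mpolyE f) !raddf_sum; apply: eq_bigr => m _ /=.
rewrite !mpoly.mcoeffZ; congr (_ * _).
rewrite mpoly.comp_mpolyX mpoly.mcoeffX rmorph_prod /=.
have [->|m0] := eqVneq m mpoly.mnm0.
  by rewrite big1 // => j _; rewrite mpoly.mnm0E expr0 rmorph1.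
have [j mj] : exists i, mpoly.fun_of_multinom m i != 0%N.
  apply/existsP; apply: contraNT m0 => /existsPn h; apply/eqP/mpoly.mnmP => l.
  by rewrite mpoly.mnm0E; apply/eqP; have := h l; rewrite negbK.
rewrite (bigD1 j) //= tnth_mktuple rmorphXn /=.
have -> : mpoly.mcoeff mpoly.mnm0 (if (j < i)%N then 0 else Xvar k j) = 0.
  by case: ifP; rewrite ?mpoly.mcoeff0 // mpoly.mcoeffX mpoly.mnm1_eq0.
by rewrite expr0n (negPf mj) mul0r.
Qed.

Lemma kill_vars_prime_chain (M : set A) : is_ideal M -> (forall i, M (Xvar k i)) ->
  prime_chain M n.
Proof.
move=> iM Mx; exists (fun i => [set f | kill_vars i f = 0]); split=> i iln.
  split; last first.
    move=> f /= fi; apply: mpoly_ideal_vars => //.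
    by rewrite -(kill_vars_mcoeff0 i) fi mpoly.mcoeff0.
  split.
  - split=> [|x y /= hx hy|a x /= hx]; first by rewrite /kill_vars /= raddf0.
      by rewrite /kill_vars raddfD /= -/(kill_vars i x) -/(kill_vars i y) hx hy addr0.
    by rewrite /kill_vars rmorphM /= -/(kill_vars i x) hx mulr0.
  - by rewrite /= /kill_vars rmorph1 => /eqP; rewrite oner_eq0.
  - move=> x y /=; rewrite /kill_vars rmorphM => /eqP; rewrite mulf_eq0.
    by case/orP => /eqP; [left|right].
split=> [f /= fi|].
  have e : kill_vars i.+1 f = kill_vars i.+1 (kill_vars i f).
    rewrite !(kill_varsE _ f) kill_vars_sumZ; apply: eq_bigr => m _; congr (_ *: _).
    rewrite /kill_vars !mpoly.comp_mpolyX rmorph_prod.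
    apply: eq_bigr => j _; rewrite rmorphXn; congr (_ ^+ _).
    rewrite !tnth_mktuple; case: (ltnP j i) => ji.
      by rewrite (leq_trans ji (leqnSn i)) raddf0.
    by rewrite -[RHS]/(kill_vars i.+1 (Xvar k j)) kill_vars_X.
  by rewrite e fi /kill_vars raddf0.
move=> /(_ (Xvar k (Ordinal iln))) /=; rewrite !kill_vars_X /= ltnn ltnSn => /(_ erefl) /eqP.
by rewrite -mpoly.msupp_eq0 mpoly.msuppX.
Qed.

Lemma local_dim_mpoly (S : set A) : (forall i, ideal_gen S (Xvar k i)) ->
  local_dim (radical (ideal_gen S)) = n.
Proof.
move=> hS; rewrite /local_dim; apply: xget_unique.
  split; last by move=> n' /prime_chain_le.
  have [P [hP sP]] := kill_vars_prime_chain (ideal_gen_ideal S) hS.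
  exists P; split=> // i /hP[pP PS]; split=> // f Pf; exists 1%N; rewrite expr1; exact: PS.
move=> m [/prime_chain_le mn h].
apply/eqP; rewrite eqn_leq mn h //.
have [P [hP sP]] := kill_vars_prime_chain (ideal_gen_ideal S) hS.
exists P; split=> // i /hP[pP PS]; split=> // f Pf; exists 1%N; rewrite expr1; exact: PS.
Qed.

End KrullDimension.

(** * Lengths of quotients of polynomial rings *)

Section Length.
Variables (k : fieldType) (n : nat).
Local Notation A := (mpoly.mpoly n k).
Local Notation "p @_[ m ]" := (mpoly.mcoeff m p) (at level 3, format "p @_[ m ]").
Local Notation "m1 +m m2" := (mpoly.mnm_add m1 m2) (at level 50, left associativity).

Lemma mcoeff_MX (f : A) m l : (f * mpoly.mpolyX k m)@_[l] =
  if mpoly.lem m l then f@_[mpoly.mnm_sub l m] else 0.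
Proof.
case: ifP => [ml|ml]; first by rewrite -{1}(mpoly.submK ml) mpoly.addmC mpoly.mcoeffMX.
rewrite (mpoly.mpolyE f) mulr_suml raddf_sum big1 //= => m' _.
rewrite -scalerAl -mpoly.mpolyXD mpoly.mcoeffZ mpoly.mcoeffX.
case: eqP => [e|]; rewrite ?mulr0 //.
by move: ml; rewrite -e mpoly.lem_addl.
Qed.

Section Coordinates.
Variables (T : finType) (iota : T -> mpoly.multinom n).

(** Coordinates on a finite set of monomials. *)
Definition crd (f : A) : 'rV[k]_#|T| := \row_i f@_[iota (enum_val i)].

Lemma crdE f t : crd f 0 (enum_rank t) = f@_[iota t].
Proof. by rewrite mxE enum_rankK. Qed.

Lemma crdD f g : crd (f + g) = crd f + crd g.
Proof. by apply/rowP => i; rewrite !mxE mpoly.mcoeffD. Qed.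

Lemma crdZ c f : crd (c *: f) = c *: crd f.
Proof. by apply/rowP => i; rewrite !mxE mpoly.mcoeffZ. Qed.

Lemma crdB f g : crd (f - g) = crd f - crd g.
Proof. by apply/rowP => i; rewrite !mxE mpoly.mcoeffB. Qed.

Lemma crd0 : crd 0 = 0.
Proof. by apply/rowP => i; rewrite !mxE mpoly.mcoeff0. Qed.

Lemma crd_sum (U : Type) (s : seq U) (P : pred U) (F : U -> A) :
  crd (\sum_(x <- s | P x) F x) = \sum_(x <- s | P x) crd (F x).
Proof. by elim/big_rec2: _ => [|x y z _ <-]; rewrite ?crd0 ?crdD. Qed.

Lemma crd_eq0 f : (crd f = 0) <-> (forall t, f@_[iota t] = 0).
Proof.
split=> [e t|h]; first by rewrite -crdE e mxE.
by apply/rowP=> i; rewrite !mxE h.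
Qed.

Lemma sub_adds_row (B : 'M[k]_#|T|) (f g : A) :
  (crd g <= B + crd f)%MS -> exists a : k, (crd (g - a *: f) <= B)%MS.
Proof.
move=> /sub_addsmxP [[u v] /= e]; exists (v 0 0).
rewrite crdB crdZ e [v]mx11_scalar mul_scalar_mx !mxE eqxx mulr1n addrK.
exact: submxMl.
Qed.

Variables (w : nat) (W : 'M[k]_(w, #|T|)) (J : set A).
Hypothesis iota_inj : injective iota.
Hypothesis iJ : is_ideal J.
Hypothesis JE : forall f, J f <-> (crd f <= W)%MS.

(** Each strict inclusion of ideals raises the rank of a space of coordinates which is known to
    describe elements of the ideal. *)
Lemma chain_length_le m : quotient_chain J m -> (m + \rank W <= #|T|)%N.
Proof.
case=> N [hN sN].
suff h j : (j <= m)%N -> exists2 B : 'M[k]_#|T|, (j + \rank W <= \rank B)%N &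
    forall g, (crd g <= B)%MS -> N j g.
  have [B hB _] := h m (leqnn m).
  exact: leq_trans hB (rank_leq_row B).
elim: j => [|j IH] jm.
  exists <<W>>%MS; first by rewrite mxrank_gen.
  move=> g; rewrite genmxE => /JE Jg.
  by case: (hN 0%N isT) => _; apply.
have [B hB BN] := IH (ltnW jm).
have [iN JN] := hN _ jm.
have [sub /existsNP[v /not_implyP[Nv nNv]]] := sN j jm.
exists (B + crd v)%MS; last first.
  move=> g /sub_adds_row [a h].
  rewrite -[g](subrK (a *: v)) -mpoly.mul_mpolyC; apply: idealD => //.
    by apply: sub; apply: BN; rewrite mpoly.mul_mpolyC.
  exact: idealM.
rewrite addSn; apply: leq_ltn_trans hB _.
by apply: rank_ltmx; rewrite ltmxE addsmxSl addsmx_sub submx_refl /=; apply/negP => /BN.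
Qed.

Hypothesis nilp : exists Q, forall i, J (Xvar k i ^+ Q).

(** An element outside of an ideal containing a power of (x_1, ..., x_n) has a multiple
    which is annihilated by x_1, ..., x_n modulo the ideal: a multiple by a monomial
    of the largest possible degree. *)
Lemma socle_element (N : set A) f : is_ideal N -> J `<=` N -> ~ N f ->
  exists2 g, ~ N g & forall i, N (Xvar k i * g).
Proof.
move=> iN JN Nf; have [Q hQ] := nilp.
pose P e := `[< exists m, mpoly.mdeg m = e /\ ~ N (mpoly.mpolyX k m * f) >].
have exP : exists e, P e.
  by exists 0%N; apply/asboolP; exists mpoly.mnm0; rewrite mpoly.mdeg0 mpoly.mpolyX0 mul1r.
have ubP e : P e -> (e <= n * Q)%N.
  move=> /asboolP [m [<- h]]; rewrite leqNgt; apply/negP => lt; apply: h.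
  have [i mi] : exists i, (Q <= mpoly.fun_of_multinom m i)%N.
    apply/existsP; apply: contraTT lt => /existsPn h.
    rewrite -leqNgt mpoly.mdegE -[n in (n * Q)%N]card_ord -sum_nat_const.
    by apply: leq_sum => i _; apply: ltnW; rewrite ltnNge h.
  apply: idealMr => //; apply: JN.
  have <- : mpoly.mnm_sub m (mpoly.mnm_muln (mpoly.mnm1 i) Q) +m mpoly.mnm_muln (mpoly.mnm1 i) Q = m.
    apply: mpoly.submK; apply/mpoly.mnm_lepP => j.
    rewrite mpoly.mulmnE mpoly.mnm1E; case: eqP => [<-|_]; last by rewrite mul0n.
    by rewrite mul1n.
  rewrite mpoly.mpolyXD -mpoly.mpolyXn; apply: idealM => //; exact: hQ.
case: (ex_maxnP exP ubP) => e /asboolP[m [em Nm]] maxe.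
exists (mpoly.mpolyX k m * f) => // i.
apply: contrapT => h.
have /maxe : P e.+1.
  apply/asboolP; exists (mpoly.mnm1 i +m m); split; last by rewrite mpoly.mpolyXD -mulrA.
  by rewrite mpoly.mdegD mpoly.mdeg1 em.
by rewrite ltnn.
Qed.

(** Adding a socle element enlarges an ideal by one dimension, and this can be repeated until
    the whole ring is reached. *)
Lemma chain_from (B : 'M[k]_#|T|) d : (\rank B + d = #|T|)%N ->
  is_ideal [set g | (crd g <= B)%MS] -> J `<=` [set g | (crd g <= B)%MS] ->
  exists N : nat -> set A, [/\ N 0%N = [set g | (crd g <= B)%MS],
    (forall i, (i <= d)%N -> is_ideal (N i) /\ J `<=` N i) &
    (forall i, (i < d)%N -> N i `<` N i.+1)].
Proof.
elim: d B => [|d IH] B rB iB JB.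
  by exists (fun _ => [set g | (crd g <= B)%MS]); split.
have [f nf] : exists f : A, ~ (crd f <= B)%MS.
  apply: contrapT => /forallNP h.
  have : (1%:M <= B)%MS.
    apply/row_subP => i.
    have -> : row i 1%:M = crd (mpoly.mpolyX k (iota (enum_val i))).
      apply/rowP => j; rewrite !mxE mpoly.mcoeffX.
      by rewrite (inj_eq iota_inj) (inj_eq enum_val_inj).
    by apply: contrapT; apply: h.
  by move/mxrankS; rewrite mxrank1; lia.
have [g ng xg] := socle_element iB JB nf.
have hg (h : A) : (crd ((h - (h@_[mpoly.mnm0])%:A) * g)%R <= B)%MS.
  apply: (@mpoly_ideal_vars k n [set y | (crd (y * g)%R <= B)%MS]) => //.
    split=> [|x y /= hx hy|a x /= hx]; rewrite /= ?mul0r ?mulrDl -?mulrA.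
    - exact: (ideal0 iB).
    - by apply: (idealD iB).
    - exact: (idealM a iB).
  rewrite mpoly.mcoeffB mpoly.alg_mpolyC mpoly.mcoeffC eqxx mulr1 subrr //.
pose B' := (B + crd g)%MS.
have rB' : (\rank B' + d = #|T|)%N.
  have h1 : (\rank (crd g) <= 1)%N by apply: rank_leq_row.
  have h2 : (\rank B < \rank B')%N.
    by apply: rank_ltmx; rewrite ltmxE addsmxSl addsmx_sub submx_refl /=; apply/negP.
  have h3 : (\rank B' <= \rank B + \rank (crd g))%N.
    by have [] := mxrank_adds_leqif B (crd g).
  lia.
have subB : [set g | (crd g <= B)%MS] `<=` [set g | (crd g <= B')%MS].
  by move=> y /= hy; apply: submx_trans hy (addsmxSl _ _).
have iB' : is_ideal [set g | (crd g <= B')%MS].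
  split=> [|x y /= hx hy|h x /= /sub_adds_row [a hx]].
  - by apply: subB; apply: (ideal0 iB).
  - by rewrite crdD addmx_sub.
  rewrite -[x](subrK (a *: g)) mulrDr crdD addmx_sub //.
    by apply: subB; apply: (idealM h iB).
  rewrite -scalerAr crdZ scalemx_sub //.
  rewrite -[h](subrK ((h@_[mpoly.mnm0])%:A)) mulrDl crdD addmx_sub //.
    by apply: subB; apply: hg.
  by rewrite -scalerAl mul1r crdZ scalemx_sub // addsmxSr.
have [N [N0 hN sN]] := IH B' rB' iB' (subset_trans JB subB).
exists (fun i => if i is j.+1 then N j else [set g | (crd g <= B)%MS]); split=> //.
  by case=> [|i] id //; apply: hN.
case=> [|i] id; last exact: sN.
rewrite N0; split=> // /(_ g) /= h; apply: ng; apply: h.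
exact: addsmxSr.
Qed.

(** When membership in J is a linear condition W on finitely many coordinates, the length of the
    quotient is its dimension: all the simple quotients are copies of k. *)
Lemma quotient_length_crd (R : realType) :
  quotient_length R J = ((#|T| - \rank W)%:R)%:E.
Proof.
apply/eqP; rewrite eq_le; apply/andP; split.
  apply: ge_ereal_sup => _ [m /chain_length_le h <-].
  by rewrite lee_fin ler_nat; lia.
apply: ereal_sup_ubound; exists (#|T| - \rank W)%N => //.
have eJ : J = [set g | (crd g <= <<W>>)%MS].
  by apply/seteqP; split=> g /=; rewrite genmxE => /JE.
have [] := @chain_from <<W>>%MS (#|T| - \rank W)%N.
- by rewrite mxrank_gen subnKC // rank_leq_col.
- by rewrite -eJ.
- by rewrite -eJ.
by move=> N [_ hN sN]; exists N.
Qed.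

End Coordinates.

Section Boxes.
Variable u : 'I_n -> nat.

(** The exponents of the monomials outside of (x_1^{u_1}, ..., x_n^{u_n}). *)
Definition box := {dffun forall i : 'I_n, 'I_(u i)}.

Definition box_mnm (t : box) : mpoly.multinom n := mpoly.Multinom [tuple (t i : nat) | i < n].

Lemma box_mnmE t i : mpoly.fun_of_multinom (box_mnm t) i = t i.
Proof. exact: mpoly.mnmE. Qed.

Lemma box_mnm_inj : injective box_mnm.
Proof.
move=> s t e; apply/ffunP => i; apply: val_inj.
by have := congr1 (fun m => mpoly.fun_of_multinom m i) e; rewrite !box_mnmE.
Qed.

Lemma card_box : #|{: box}| = (\prod_i u i)%N.
Proof.
rewrite card_dep_ffun foldrE big_map big_enum /=.
by apply: eq_bigr => i _; rewrite card_ord.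
Qed.

Definition in_box (m : mpoly.multinom n) := [forall i, mpoly.fun_of_multinom m i < u i]%N.

Lemma in_boxP m : reflect (exists t, m = box_mnm t) (in_box m).
Proof.
apply: (iffP forallP) => [h|[t ->] i]; last by rewrite box_mnmE.
exists [ffun i => Ordinal (h i)]; apply/mpoly.mnmP => i.
by rewrite box_mnmE ffunE.
Qed.

Lemma in_box_sub m l : in_box m -> in_box (mpoly.mnm_sub m l).
Proof.
move/forallP=> h; apply/forallP=> i; rewrite mpoly.mnmBE.
exact: leq_ltn_trans (leq_subr _ _) (h i).
Qed.

Notation bcrd := (crd box_mnm).

Lemma bcrd_eq0 f : (bcrd f = 0) <-> (forall m, in_box m -> f@_[m] = 0).
Proof.
split=> [/crd_eq0 h m /in_boxP [t ->] //|h]; apply/crd_eq0 => t.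
by apply: h; apply/in_boxP; exists t.
Qed.

Lemma bcrdM_eq0 f h : bcrd f = 0 -> bcrd (h * f) = 0.
Proof.
move/bcrd_eq0 => f0; apply/bcrd_eq0 => m bm.
rewrite (mpoly.mpolyE h) mulr_suml raddf_sum big1 //= => l _.
rewrite -scalerAl mpoly.mcoeffZ [mpoly.mpolyX k l * f]mulrC mcoeff_MX.
by case: ifP => _; rewrite ?f0 ?in_box_sub ?mulr0.
Qed.

Lemma bcrdX_eq0 m : ~~ in_box m -> bcrd (mpoly.mpolyX k m) = 0.
Proof.
move=> nm; apply/bcrd_eq0 => l bl; rewrite mpoly.mcoeffX; case: eqP => // e.
by rewrite e bl in nm.
Qed.

Variable g : A.

Definition box_ideal : set A :=
  ideal_gen (range (fun i => Xvar k i ^+ u i) `|` [set g]).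

(** The matrix of the multiplication by g modulo (x_1^{u_1}, ..., x_n^{u_n}). *)
Definition mult_coef (s t : box) : k := (g * mpoly.mpolyX k (box_mnm s))@_[box_mnm t].

Lemma Xvar_exp (i : 'I_n) d : Xvar k i ^+ d = mpoly.mpolyX k (mpoly.mnm_muln (mpoly.mnm1 i) d).
Proof. by rewrite /Xvar mpoly.mpolyXn. Qed.

Lemma bcrd_gX m : (bcrd (g * mpoly.mpolyX k m)%R <= fmx mult_coef)%MS.
Proof.
have [/in_boxP[t ->]|nm] := boolP (in_box m); last by rewrite bcrdM_eq0 ?sub0mx // bcrdX_eq0.
have -> : bcrd (g * mpoly.mpolyX k (box_mnm t)) = row (enum_rank t) (fmx mult_coef).
  by apply/rowP=> j; rewrite !mxE enum_rankK.
exact: row_sub.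
Qed.

Lemma bcrd_gM h : (bcrd (h * g)%R <= fmx mult_coef)%MS.
Proof.
rewrite mulrC (mpoly.mpolyE h) mulr_sumr crd_sum summx_sub // => m _.
by rewrite -scalerAr crdZ scalemx_sub // bcrd_gX.
Qed.

Lemma box_ideal_ideal : is_ideal box_ideal.
Proof. exact: ideal_gen_ideal. Qed.

Lemma box_ideal0 f : bcrd f = 0 -> box_ideal f.
Proof.
move=> /bcrd_eq0 f0; rewrite (mpoly.mpolyE f); refine (@ideal_sum _ box_ideal _ (mpoly.msupp f) xpredT _ box_ideal_ideal _) => m _.
have [bm|/forallPn[i]] := boolP (in_box m).
  rewrite f0 // scale0r; exact: (ideal0 box_ideal_ideal).
rewrite -leqNgt => ui; rewrite -mpoly.mul_mpolyC; apply: (idealM _ box_ideal_ideal).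
have <- : mpoly.mnm_sub m (mpoly.mnm_muln (mpoly.mnm1 i) (u i)) +m
   mpoly.mnm_muln (mpoly.mnm1 i) (u i) = m.
  apply: mpoly.submK; apply/mpoly.mnm_lepP => j.
  rewrite mpoly.mulmnE mpoly.mnm1E; case: eqP => [<-|_]; last by rewrite mul0n.
  by rewrite mul1n.
rewrite mpoly.mpolyXD -Xvar_exp; apply: (idealM _ box_ideal_ideal).
by apply: ideal_gen_sub; left; exists i.
Qed.

Lemma bcrd_sub f : (bcrd f <= fmx mult_coef)%MS -> exists h : A, bcrd (f - h * g) = 0.
Proof.
case/submxP => w ew.
exists (\sum_s w 0 (enum_rank s) *: mpoly.mpolyX k (box_mnm s)).
rewrite crdB ew mulr_suml crd_sum mulmx_sum_row.
rewrite [X in X - _](reindex (@enum_rank {: box})) /=; last first.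
  by apply: onW_bij; apply: enum_rank_bij.
apply/eqP; rewrite subr_eq0; apply/eqP; apply: eq_bigr => s _.
rewrite -scalerAl crdZ; congr (_ *: _).
by apply/rowP=> j; rewrite !mxE enum_rankK /mult_coef mulrC.
Qed.

Lemma box_idealE f : box_ideal f <-> (bcrd f <= fmx mult_coef)%MS.
Proof.
split=> [|/bcrd_sub [h e]]; last first.
  rewrite -[f](subrK (h * g)); apply: (idealD box_ideal_ideal).
    exact: box_ideal0.
  apply: (idealM _ box_ideal_ideal).
  by apply: ideal_gen_sub; right.
apply: (@ideal_gen_min _ _ [set f | (bcrd f <= fmx mult_coef)%MS]).
  split=> [|x y /= hx hy|a x /= /bcrd_sub [h e]]; first by rewrite /= crd0 sub0mx.
    by rewrite crdD addmx_sub.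
  rewrite -[x](subrK (h * g)) mulrDr crdD bcrdM_eq0 // add0r mulrA; exact: bcrd_gM.
move=> _ [[i _ <-]|->] /=; last by rewrite -[g]mul1r bcrd_gM.
rewrite Xvar_exp bcrdX_eq0 ?sub0mx //; apply/forallPn; exists i.
by rewrite mpoly.mulmnE mpoly.mnm1E eqxx mul1n ltnn.
Qed.

(** The length is the dimension of the cokernel of the multiplication by g on
    k[x] / (x_1^{u_1}, ..., x_n^{u_n}). *)
Lemma quotient_length_box (R : realType) :
  quotient_length R box_ideal = ((\prod_i u i - frank mult_coef)%:R)%:E.
Proof.
rewrite -card_box; apply: (quotient_length_crd (iota := box_mnm)).
- exact: box_mnm_inj.
- exact: box_ideal_ideal.
- exact: box_idealE.
exists (\max_i u i)%N => i.
rewrite -(subnK (leq_bigmax (F := u) i)) exprD; apply: (idealM _ box_ideal_ideal).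
by apply: ideal_gen_sub; left; exists i.
Qed.

End Boxes.

Lemma eq_ideal_gen (S S' : set A) : S `<=` ideal_gen S' -> S' `<=` ideal_gen S ->
  ideal_gen S = ideal_gen S'.
Proof.
by move=> h h'; apply/seteqP; split; apply: ideal_gen_min => //; apply: ideal_gen_ideal.
Qed.

End Length.

(** * Chains of monomials *)

Lemma insub_ord n x (h : (x < n)%N) : insub x = Some (Ordinal h) :> option 'I_n.
Proof. exact: insubT. Qed.

Lemma addn_ltn_box t v u c e : (v <= u)%N -> (t < v - (c + e))%N -> (t + c < u)%N.
Proof. lia. Qed.
Lemma addn_ltn_subn t v c e : (t < v - (c + e))%N -> (t + c < v - e)%N.
Proof. lia. Qed.
Lemma subn_ltn_subn t v c e : (t < v - e)%N -> (c <= t)%N -> (t - c < v - (c + e))%N.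
Proof. lia. Qed.

Section ChainPosition.
Variables (s : nat) (c : 'I_s -> nat).
Hypothesis hc : exists i, c i <> 0%N.
Implicit Types (m : 'I_s -> nat).

(** Monomials are arranged in chains r, r + c, r + 2 c, ... whose first element r does not
    dominate c; this is the position of m in its chain. *)
Definition pos m : nat := \max_(j < (\sum_i m i).+1 | [forall i, (j * c i <= m i)%N]) j.

Lemma pos_spec m j : [forall i, (j * c i <= m i)%N] = (j <= pos m)%N.
Proof.
apply/idP/idP => [h|h].
  have [i ci] := hc.
  have jm : (j < (\sum_i m i).+1)%N.
    rewrite ltnS; apply: leq_trans (_ : (m i <= _)%N); last by rewrite (bigD1 i) //= leq_addr.
    apply: leq_trans (elimT forallP h i); move: ci; case: (c i) => // x _; exact: leq_pmulr.
  exact: (leq_bigmax_cond (Ordinal jm) h).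
apply/forallP => i; apply: (@leq_trans (pos m * c i)); first by rewrite leq_mul2r h orbT.
apply: (big_ind (fun x => (x * c i <= m i)%N)) => [|x y hx hy|l hl]; first by rewrite mul0n.
  by rewrite /maxn; case: ifP.
exact: (elimT forallP hl i).
Qed.

Lemma pos_mul_le m i : (pos m * c i <= m i)%N.
Proof. by have := leqnn (pos m); rewrite -pos_spec => /forallP/(_ i). Qed.

Lemma eq_pos m m' : m =1 m' -> pos m = pos m'.
Proof.
move=> e; apply/eqP; rewrite eqn_leq -!pos_spec.
by apply/andP; split; apply/forallP => i; rewrite -?e ?pos_mul_le // e pos_mul_le.
Qed.

Lemma pos_addM m j : pos (fun i => m i + j * c i)%N = (pos m + j)%N.
Proof.
apply/eqP; rewrite eqn_leq -pos_spec; apply/andP; split; last first.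
  by apply/forallP => i; rewrite mulnDl leq_add2r pos_mul_le.
set p := pos _; rewrite addnC -leq_subLR -pos_spec; apply/forallP => i.
rewrite mulnBl leq_subLR addnC; exact: pos_mul_le.
Qed.

Lemma pos_root m : pos (fun i => m i - pos m * c i)%N = 0%N.
Proof.
have := pos_addM (fun i => m i - pos m * c i)%N (pos m).
rewrite (@eq_pos _ m) => [/eqP|i]; first by rewrite -{1}[pos m]add0n eqn_add2r => /eqP.
by rewrite subnK ?pos_mul_le.
Qed.

(** The length of the chain of m in a box, counted at the first element of the chain only, so
    that a sum over a box of monomials is a sum over its chains. *)
Definition mlen (v : 'I_s -> nat) m : nat :=
  if pos m == 0%N then #|[pred j : 'I_(\sum_i v i) | [forall i, (m i + j * c i < v i)%N]]| else 0%N.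

Lemma mlen_spec v m j :
  (j < mlen v m)%N = (pos m == 0%N) && [forall i, (m i + j * c i < v i)%N].
Proof.
rewrite /mlen; case: (pos m == 0%N) => //=.
set P := [pred j : 'I__ | _].
have [i ci] := hc.
have bd x : [forall i, (m i + x * c i < v i)%N] -> (x < \sum_i v i)%N.
  move/forallP=> h; apply: leq_trans (_ : (v i <= _)%N); last by rewrite (bigD1 i) //= leq_addr.
  apply: leq_ltn_trans (h i); apply: leq_trans (leq_addl _ _).
  move: ci; case: (c i) => // y _; exact: leq_pmulr.
have down x y : (x <= y)%N -> [forall i, (m i + y * c i < v i)%N] -> [forall i, (m i + x * c i < v i)%N].
  move=> xy /forallP h; apply/forallP => l; apply: leq_ltn_trans (h l).
  by rewrite leq_add2l leq_mul2r xy orbT.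
apply/idP/idP => [|h].
  apply: contraLR => nj; rewrite -leqNgt.
  rewrite -[X in (_ <= X)%N](card_ord j).
  have lt x : [forall i, (m i + x * c i < v i)%N] -> (x < j)%N.
    by move=> hx; rewrite ltnNge; apply: contra nj => /down; apply.
  apply: (card_partial_inj (f := fun x : 'I_(\sum_i v i) => insub (x : nat))) => [x|x y] /= hx.
    by rewrite (insub_ord (lt _ hx)); eexists.
  by move=> hy; rewrite (insub_ord (lt _ hx)) (insub_ord (lt _ hy)) => -[e]; apply: val_inj.
rewrite -[X in (X <= _)%N](card_ord j.+1).
have lt (x : 'I_j.+1) : (x < \sum_i v i)%N by apply: bd; apply: down h; rewrite -ltnS.
apply: (card_partial_inj (f := fun x : 'I_j.+1 => insub (x : nat))) => [x _|x y _ _] /=.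
  rewrite (insub_ord (lt x)); exists (Ordinal (lt x)) => //=.
  by apply: down h; rewrite -ltnS.
by rewrite (insub_ord (lt x)) (insub_ord (lt y)) => -[e]; apply: val_inj.
Qed.

Section Counting.
Variables (u v : 'I_s -> nat).
Hypothesis vu : forall i, (v i <= u i)%N.

Definition nat_of_box n (w : 'I_n -> nat) (t : box w) (i : 'I_n) : nat := t i.

Lemma card_subbox w : (forall i, w i <= u i)%N ->
  #|[pred t : box u | [forall i, (t i < w i)%N]]| = (\prod_i w i)%N.
Proof.
move=> wu; pose F i : pred 'I_(u i) := fun x => (x < w i)%N.
have -> : #|[pred t : box u | [forall i, (t i < w i)%N]]| = #|(family F : pred (box u))|.
  by apply: eq_card => t; apply/forallP/familyP.
rewrite card_family foldrE big_map big_enum /=; apply: eq_bigr => i _.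
rewrite -[RHS]card_ord; apply/eqP; rewrite eqn_leq; apply/andP; split.
  apply: (card_partial_inj (f := fun x : 'I_(u i) => insub (x : nat))) => [x|x y]; rewrite /F /in_mem /=.
    by move=> hx; rewrite (insub_ord hx); eexists.
  by move=> hx hy; rewrite (insub_ord hx) (insub_ord hy) => -[e]; apply: val_inj.
apply: (card_partial_inj (f := fun x : 'I_(w i) => insub (x : nat))) => [x _|x y _ _].
  have h : (x < u i)%N by apply: leq_trans (ltn_ord x) (wu i).
  by rewrite insubT; eexists; rewrite // /F /in_mem /=.
have h z : (z < w i)%N -> (z < u i)%N by move/leq_trans; apply.
by rewrite (insub_ord (h _ (ltn_ord x))) (insub_ord (h _ (ltn_ord y))) => -[e]; apply: val_inj.
Qed.

(** A first element r starts a chain of length greater than y when r + y c is still in the box;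
    the elements which are not first are the translates by c. *)
Lemma count_mlen y :
  #|[pred t : box u | (y < mlen v (nat_of_box t))%N]| =
  (\prod_i (v i - y * c i) - \prod_i (v i - y.+1 * c i))%N.
Proof.
have wu z i : (v i - z * c i <= u i)%N by apply: leq_trans (leq_subr _ _) (vu i).
rewrite -(card_subbox (wu y)) -(card_subbox (wu y.+1)).
set P := [pred t : box u | [forall i, (t i < v i - y * c i)%N]].
have -> : #|[pred t : box u | [forall i, (t i < v i - y.+1 * c i)%N]]| =
   #|[pred t : box u | P t & [forall i, (1 * c i <= t i)%N]]|.
  apply/eqP; rewrite eqn_leq; apply/andP; split.
    pose f (t : box u) : option (box u) := [pick t' : box u | [forall i, t' i == (t i + c i)%N :> nat]].
    apply: (card_partial_inj (f := f)) => [t /= /forallP ht|t t' /= /forallP ht /forallP ht'].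
      have lt i : (t i + c i < u i)%N.
        by have := ht i; rewrite mulSn; apply: addn_ltn_box.
      rewrite /f; case: pickP => [t' /forallP ht'|/(_ [ffun i => Ordinal (lt i)])]; last first.
        by move=> /negP[]; apply/forallP => i; rewrite ffunE.
      exists t' => //; rewrite /P /in_mem /=.
      apply/andP; split; apply/forallP => i; rewrite (eqP (ht' i)).
        by have := ht i; rewrite mulSn; apply: addn_ltn_subn.
      by rewrite mul1n leq_addl.
    have lt i : (t i + c i < u i)%N.
      by have := ht i; rewrite mulSn; apply: addn_ltn_box.
    have lt' i : (t' i + c i < u i)%N.
      by have := ht' i; rewrite mulSn; apply: addn_ltn_box.
    rewrite /f; case: pickP => [w /forallP hw|/(_ [ffun i => Ordinal (lt i)])]; last first.
      by move=> /negP[]; apply/forallP => i; rewrite ffunE.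
    case: pickP => [w' /forallP hw'|/(_ [ffun i => Ordinal (lt' i)])]; last first.
      by move=> /negP[]; apply/forallP => i; rewrite ffunE.
    move=> [e]; apply/ffunP => i; apply: val_inj; apply/eqP.
    by rewrite -(eqn_add2r (c i)) -(eqP (hw i)) -(eqP (hw' i)) e.
  pose f (t : box u) : option (box u) := [pick t' : box u | [forall i, t' i == (t i - c i)%N :> nat]].
  have lt (t : box u) i : (t i - c i < u i)%N by apply: leq_ltn_trans (leq_subr _ _) (ltn_ord _).
  apply: (card_partial_inj (f := f)) => [t /= /andP[/forallP h1 /forallP h2]|t t' /=].
    rewrite /f; case: pickP => [t' /forallP ht'|/(_ [ffun i => Ordinal (lt t i)])]; last first.
      by move=> /negP[]; apply/forallP => i; rewrite ffunE.
    exists t' => //; apply/forallP => i; rewrite (eqP (ht' i)).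
    by rewrite mulSn; apply: subn_ltn_subn (h1 i) _; rewrite -[c i]mul1n; apply: h2.
  move=> /andP[_ /forallP h2] /andP[_ /forallP h2'].
  rewrite /f; case: pickP => [w /forallP hw|/(_ [ffun i => Ordinal (lt t i)])]; last first.
    by move=> /negP[]; apply/forallP => i; rewrite ffunE.
  case: pickP => [w' /forallP hw'|/(_ [ffun i => Ordinal (lt t' i)])]; last first.
    by move=> /negP[]; apply/forallP => i; rewrite ffunE.
  move=> [e]; apply/ffunP => i; apply: val_inj => /=.
  have := eqP (hw i); have := eqP (hw' i); rewrite e => ->.
  move=> e2; apply: (@addIn (c i)); rewrite -(subnK (_ : c i <= t i)%N) -?e2 ?subnK //.
  - by rewrite -[c i]mul1n; apply: h2'.
  - by rewrite -[c i]mul1n; apply: h2.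
rewrite -(cardID [pred t : box u | [forall i, (1 * c i <= t i)%N]] P) addKn.
apply: eq_card => t; rewrite !inE mlen_spec; apply/andP/andP => -[h1 h2]; split.
- by rewrite pos_spec -ltnNge -(eqP h1).
- by apply/forallP => i; have := elimT forallP h2 i; rewrite /nat_of_box addnC ltn_subRL.
- by move: h1; rewrite pos_spec -ltnNge ltnS leqn0.
- by apply/forallP => i; have := elimT forallP h2 i; rewrite /nat_of_box addnC ltn_subRL.
Qed.

(** The chains partition the box. *)
Lemma sum_mlen : (\sum_(t : box u) mlen v (nat_of_box t) = \prod_i v i)%N.
Proof.
pose Q := (\sum_i v i)%N.
have mQ t : (mlen v (nat_of_box t) <= Q)%N.
  by rewrite /mlen; case: ifP => // _; apply: leq_trans (max_card _) _; rewrite card_ord.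
have -> : (\sum_(t : box u) mlen v (nat_of_box t) =
   \sum_(y < Q) #|[pred t : box u | (y < mlen v (nat_of_box t))%N]|)%N.
  under [RHS]eq_bigr => y _ do rewrite -sum1_card.
  rewrite (exchange_big_dep xpredT) //=; apply: eq_bigr => t _.
  rewrite sum1_card -[LHS]card_ord; apply/eqP; rewrite eqn_leq; apply/andP; split.
    have lt z : (z < mlen v (nat_of_box t))%N -> (z < Q)%N by move/leq_trans; apply.
    apply: (card_partial_inj (f := fun x : 'I_(mlen v (nat_of_box t)) => insub (x : nat))) => [x _|x y _ _].
      by rewrite (insub_ord (lt _ (ltn_ord x))); eexists; [by []|exact: (ltn_ord x)].
    by rewrite (insub_ord (lt _ (ltn_ord x))) (insub_ord (lt _ (ltn_ord y))) => -[e]; apply: val_inj.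
  apply: (card_partial_inj (f := fun x : 'I_Q => insub (x : nat))) => [x|x y]; rewrite /in_mem /=.
    by move=> hx; rewrite (insub_ord hx); eexists.
  by move=> hx hy; rewrite (insub_ord hx) (insub_ord hy) => -[e]; apply: val_inj.
have dec y : (\prod_i (v i - y.+1 * c i) <= \prod_i (v i - y * c i))%N.
  by apply: leq_prod => i _; rewrite leq_sub2l // leq_mul2r leqnSn orbT.
have tele z : (\sum_(y < z) #|[pred t : box u | (y < mlen v (nat_of_box t))%N]| +
    \prod_i (v i - z * c i) = \prod_i v i)%N.
  elim: z => [|z IH].
    by rewrite big_ord0 add0n; apply: eq_bigr => i _; rewrite mul0n subn0.
  by rewrite big_ord_recr /= count_mlen -addnA subnK ?dec.
rewrite -(tele Q).
have [i ci] := hc.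
rewrite [X in (_ + X)%N](bigD1 i) //= (_ : (v i - Q * c i = 0)%N) ?mul0n ?addn0 //.
apply/eqP; rewrite subn_eq0; apply: (@leq_trans Q); first by rewrite /Q (bigD1 i) //= leq_addr.
by move: ci; case: (c i) => // x _; apply: leq_pmulr.
Qed.

End Counting.
End ChainPosition.

(** * Multiplication by a power of a sum of two monomials *)

Section Blocks.
Variables (k : fieldType) (s1 s2 : nat).
Variables (c : 'I_s1 -> nat) (d : 'I_s2 -> nat).
Hypothesis hc : exists i, c i <> 0%N.
Hypothesis hd : exists j, d j <> 0%N.
Variables (U gam : 'I_(s1 + s2) -> nat) (N : nat).

Definition mnm_of n (m : 'I_n -> nat) : mpoly.multinom n := mpoly.Multinom [tuple m i | i < n].

Definition joinf (m1 : 'I_s1 -> nat) (m2 : 'I_s2 -> nat) (i : 'I_(s1 + s2)) : nat :=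
  match fintype.split i with inl i1 => m1 i1 | inr i2 => m2 i2 end.

Lemma joinfl m1 m2 i : joinf m1 m2 (lshift s2 i) = m1 i.
Proof. by rewrite /joinf (unsplitK (inl i)). Qed.

Lemma joinfr m1 m2 i : joinf m1 m2 (rshift s1 i) = m2 i.
Proof. by rewrite /joinf (unsplitK (inr i)). Qed.

Lemma forall_split (P : 'I_(s1 + s2) -> Prop) :
  (forall i, P (lshift s2 i)) -> (forall j, P (rshift s1 j)) -> forall i, P i.
Proof.
move=> h1 h2 i; case: (splitP i) => j e.
  by rewrite (_ : i = lshift s2 j) //; apply: val_inj.
by rewrite (_ : i = rshift s1 j) //; apply: val_inj.
Qed.

(** The polynomial x^gam (x^c + y^d)^N. *)
Definition two_term : mpoly.mpoly (s1 + s2) k :=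
  mpoly.mpolyX k (mnm_of gam) *
  (mpoly.mpolyX k (mnm_of (joinf c (fun=> 0%N))) +
   mpoly.mpolyX k (mnm_of (joinf (fun=> 0%N) d))) ^+ N.

(** The exponent of the i-th term in the expansion of (x^c + y^d)^N. *)
Definition cxy (i : nat) (l : 'I_(s1 + s2)) : nat :=
  (joinf c (fun=> 0%N) l * i + joinf (fun=> 0%N) d l * (N - i))%N.

Lemma mult_coef_two_term (s t : box U) :
  mult_coef two_term s t = \sum_(i < N.+1)
    'C(N, i)%:R * ([forall l, t l == gam l + s l + cxy i l :> nat]%N)%:R.
Proof.
rewrite /mult_coef /two_term addrC exprDn mulr_sumr mulr_suml raddf_sum /=.
apply: eq_bigr => i _.
rewrite [in LHS]mulrnAr [in LHS]mulrnAl !mpoly.mpolyXn -!mpoly.mpolyXD mpoly.mcoeffMn mpoly.mcoeffX mulr_natl.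
congr (_%:R *+ _); congr nat_of_bool; apply/eqP/forallP => [/mpoly.mnmP e l|e].
  apply/eqP; have := e l; rewrite !mpoly.mnmDE !mpoly.mulmnE !mpoly.mnmE /cxy; lia.
apply/mpoly.mnmP => l; have := eqP (e l).
by rewrite !mpoly.mnmDE !mpoly.mulmnE !mpoly.mnmE /cxy; lia.
Qed.

Lemma cxyl i l : cxy i (lshift s2 l) = (i * c l)%N.
Proof. by rewrite /cxy !joinfl mul0n addn0 mulnC. Qed.

Lemma cxyr i l : cxy i (rshift s1 l) = ((N - i) * d l)%N.
Proof. by rewrite /cxy !joinfr mul0n add0n mulnC. Qed.

Lemma mult_coef_eq (s t : box U) i : (i <= N)%N ->
  (forall l, t l = (gam l + s l + cxy i l)%N :> nat) ->
  mult_coef two_term s t = 'C(N, i)%:R.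
Proof.
move=> iN e; rewrite mult_coef_two_term -ltnS in iN *.
rewrite (bigD1 (Ordinal iN)) //= big1 ?addr0.
  by rewrite (introT forallP) ?mulr1 // => l; apply/eqP.
move=> j ji; case: forallP => [h|]; last by rewrite mulr0.
have [l cl] := hc; case/eqP: ji; apply: val_inj => /=.
have := eqP (h (lshift s2 l)); rewrite e !cxyl => /eqP.
by rewrite eqn_add2l eqn_mul2r => /orP[/eqP //|/eqP].
Qed.

Lemma mult_coef_neq0 (s t : box U) : mult_coef two_term s t != 0 ->
  exists2 i, (i <= N)%N & forall l, t l = (gam l + s l + cxy i l)%N :> nat.
Proof.
move=> nz; apply: contrapT => h; case/eqP: nz.
rewrite mult_coef_two_term big1 // => i _; case: forallP => [e|]; last by rewrite mulr0.
by case: h; exists i; [rewrite -ltnS|move=> l; apply/eqP].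
Qed.

Definition boxl := box (fun i => U (lshift s2 i)).
Definition boxr := box (fun j => U (rshift s1 j)).
Definition ul (i : 'I_s1) := (U (lshift s2 i) - gam (lshift s2 i))%N.
Definition ur (j : 'I_s2) := (U (rshift s1 j) - gam (rshift s1 j))%N.

Definition cut n (u : 'I_n -> nat) (t : box u) (p : 'I_n -> nat) : box u :=
  [ffun i => Ordinal (leq_ltn_trans (leq_subr (p i) (t i)) (ltn_ord (t i)))].

Definition tl (t : box U) : boxl := [ffun i => t (lshift s2 i)].
Definition tr (t : box U) : boxr := [ffun j => t (rshift s1 j)].

(** The first element of the chain of t. *)
Definition rootbox n (e u : 'I_n -> nat) (t : box u) : box u :=
  cut t (fun i => pos e (nat_of_box t) * e i)%N.

Lemma cutE n (u : 'I_n -> nat) (t : box u) p i :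
  nat_of_box (cut t p) i = (nat_of_box t i - p i)%N.
Proof. by rewrite /nat_of_box ffunE. Qed.

Lemma rootbox_shift n (e u : 'I_n -> nat) (he : exists i, e i <> 0%N) (s t : box u) p :
  nat_of_box t =1 (fun l => nat_of_box s l + p * e l)%N -> rootbox e t = rootbox e s.
Proof.
move=> h; apply/ffunP => l; apply: val_inj.
rewrite -[LHS]/(nat_of_box (rootbox e t) l) -[RHS]/(nat_of_box (rootbox e s) l) !cutE.
by rewrite h (eq_pos he h) pos_addM // mulnDl subnDr.
Qed.

Definition gl (i : 'I_s1) := gam (lshift s2 i).
Definition gr (j : 'I_s2) := gam (rshift s1 j).

Definition posl (t : box U) := pos c (nat_of_box (cut (tl t) gl)).
Definition posr (t : box U) := pos d (nat_of_box (cut (tr t) gr)).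

(** A chain in each group of variables; the blocks of the multiplication by two_term are labelled
    by such pairs. *)
Definition source_label (s : box U) : boxl * boxr := (rootbox c (tl s), rootbox d (tr s)).
Definition target_label (t : box U) : boxl * boxr :=
  (rootbox c (cut (tl t) gl), rootbox d (cut (tr t) gr)).

(** After division by x^gam, the target of a nonzero coefficient lies in the chains of the source,
    i steps further in the first one and N - i in the second one. *)
Lemma target_pos (s t : box U) i :
  (forall l, t l = (gam l + s l + cxy i l)%N :> nat) ->
  [/\ posl t = (pos c (nat_of_box (tl s)) + i)%N,
      posr t = (pos d (nat_of_box (tr s)) + (N - i))%N &
      target_label t = source_label s].
Proof.
move=> e.
have el : nat_of_box (cut (tl t) gl) =1 (fun l => nat_of_box (tl s) l + i * c l)%N.
  by move=> l; rewrite cutE /nat_of_box !ffunE e cxyl /gl -addnA addKn.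
have er : nat_of_box (cut (tr t) gr) =1 (fun l => nat_of_box (tr s) l + (N - i) * d l)%N.
  by move=> l; rewrite cutE /nat_of_box !ffunE e cxyr /gr -addnA addKn.
have pl : posl t = (pos c (nat_of_box (tl s)) + i)%N by rewrite /posl (eq_pos hc el) pos_addM.
have pr : posr t = (pos d (nat_of_box (tr s)) + (N - i))%N by rewrite /posr (eq_pos hd er) pos_addM.
by split=> //; congr (_, _); [exact: rootbox_shift el|exact: rootbox_shift er].
Qed.

Lemma rootboxE n (e u : 'I_n -> nat) (he : exists i, e i <> 0%N) (t : box u) (r : box u) i :
  rootbox e t = r -> nat_of_box t i = (nat_of_box r i + pos e (nat_of_box t) * e i)%N.
Proof. by move=> <-; rewrite cutE subnK ?pos_mul_le. Qed.

Lemma rootbox_pos n (e u : 'I_n -> nat) (he : exists i, e i <> 0%N) (t : box u) (r : box u) :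
  rootbox e t = r -> pos e (nat_of_box r) = 0%N.
Proof.
move=> <-; rewrite -[RHS](pos_root he (nat_of_box t)); apply: eq_pos => // i.
by rewrite cutE.
Qed.

Lemma box_of (f : 'I_(s1 + s2) -> nat) : (forall i, (f i < U i)%N) ->
  exists t : box U, forall i, t i = f i :> nat.
Proof. by move=> h; exists [ffun i => Ordinal (h i)] => i; rewrite ffunE. Qed.

(** The positions in the two chains identify the block with the multiplication by (x + y)^N on
    k[x, y] / (x^m1, y^m2). *)
Lemma two_term_block (r1 : boxl) (r2 : boxr) :
  frank (fun s t : box U => if (source_label s == (r1, r2)) && (target_label t == (r1, r2))
     then mult_coef two_term s t else 0) =
  frank (@binmx k (mlen c ul (nat_of_box r1)) (mlen d ur (nat_of_box r2)) N).
Proof.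
set m1 := mlen c ul _; set m2 := mlen d ur _.
apply/eqP; rewrite eqn_leq; apply/andP; split.
  pose f (s : box U) : option ('I_m1 * 'I_m2) :=
    if source_label s == (r1, r2) then
      match insub (pos c (nat_of_box (tl s))), insub (pos d (nat_of_box (tr s))) with
      | Some i, Some j => Some (i, j) | _, _ => None end else None.
  pose g (t : box U) : option ('I_m1 * 'I_m2) :=
    if (target_label t == (r1, r2)) && [forall l, (gam l <= t l)%N] then
      match insub (posl t), insub (posr t) with
      | Some i, Some j => Some (i, j) | _, _ => None end else None.
  apply: (frank_select (f := f) (g := g)) => s t; rewrite /f /g.
  case: eqP => //= -[ls1 ls2].
  case: eqP => [[lt1 lt2]|] /=; last by case: (insub _) => // i; case: (insub _).
  have p1 := rootbox_pos hc ls1; have p2 := rootbox_pos hd ls2.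
  have ex_s1 i : nat_of_box (tl s) i = _ := rootboxE hc i ls1.
  have ex_s2 i : nat_of_box (tr s) i = _ := rootboxE hd i ls2.
  have [gt|ngt] := boolP [forall l, (gam l <= t l)%N]; last first.
    have -> : mult_coef two_term s t = 0.
      apply: contraNeq ngt => /mult_coef_neq0 [i iN e]; apply/forallP => l.
      by rewrite e -addnA leq_addr.
    by case: (insub _) => // i; case: (insub _).
  have ex_t1 i : (t (lshift s2 i) - gl i)%N = (nat_of_box r1 i + posl t * c i)%N.
    by have := rootboxE hc i lt1; rewrite {1}cutE {1}/nat_of_box ffunE => ->.
  have ex_t2 i : (t (rshift s1 i) - gr i)%N = (nat_of_box r2 i + posr t * d i)%N.
    by have := rootboxE hd i lt2; rewrite {1}cutE {1}/nat_of_box ffunE => ->.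
  have lt_t1 : (posl t < m1)%N.
    rewrite mlen_spec // p1; apply/forallP => i.
    rewrite -ex_t1 /ul /gl ltn_sub2r // (leq_ltn_trans (elimT forallP gt (lshift s2 i))) //.
  have lt_t2 : (posr t < m2)%N.
    rewrite mlen_spec // p2; apply/forallP => i.
    rewrite -ex_t2 /ur /gr ltn_sub2r // (leq_ltn_trans (elimT forallP gt (rshift s1 i))) //.
  rewrite (insub_ord lt_t1) (insub_ord lt_t2).
  have nz0 : mult_coef two_term s t != 0 -> exists i, [/\ (i <= N)%N,
      posl t = (pos c (nat_of_box (tl s)) + i)%N &
      posr t = (pos d (nat_of_box (tr s)) + (N - i))%N].
    move=> /mult_coef_neq0 [i iN e]; exists i.
    by have [-> -> _] := target_pos e.
  case: insubP => [i hi ei|ni]; last first.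
    apply/eqP; apply: contraNT ni => /nz0 [i [_ e1 _]].
    by apply: leq_ltn_trans lt_t1; rewrite e1 leq_addr.
  case: insubP => [j hj ej|nj]; last first.
    apply/eqP; apply: contraNT nj => /nz0 [j [_ _ e2]].
    by apply: leq_ltn_trans lt_t2; rewrite e2 leq_addr.
  rewrite /binmx /= ei ej; case: and3P => [[h1 h2 /eqP h3]|nh].
    apply: mult_coef_eq; first by rewrite -h3 leq_addr.
    apply: forall_split => l.
      rewrite cxyl; have := ex_t1 l; have := ex_s1 l; rewrite {1}/nat_of_box ffunE => ->.
      have := elimT forallP gt (lshift s2 l); rewrite /gl => ht ht'.
      rewrite -(subnKC ht) ht' -addnA -addnA -mulnDl; congr (_ + (_ + _ * _))%N.
      by rewrite subnKC.
    rewrite cxyr; have := ex_t2 l; have := ex_s2 l; rewrite {1}/nat_of_box ffunE => ->.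
    have := elimT forallP gt (rshift s1 l); rewrite /gr => ht ht'.
    rewrite -(subnKC ht) ht' -addnA -addnA -mulnDl; congr (_ + (_ + _ * _))%N.
    by rewrite -h3 addKn subnKC.
  apply/eqP; apply: contra_notT nh => /nz0 [i' [iN e1 e2]].
  by rewrite e1 e2 !leq_addr !addKn subnKC.
pose f (p : 'I_m1 * 'I_m2) : option (box U) :=
  [pick s : box U | [forall l, (s l : nat) ==
     joinf (fun i => nat_of_box r1 i + p.1 * c i)%N (fun j => nat_of_box r2 j + p.2 * d j)%N l]].
pose g (p : 'I_m1 * 'I_m2) : option (box U) :=
  [pick s : box U | [forall l, (s l : nat) ==
     (gam l + joinf (fun i => nat_of_box r1 i + p.1 * c i) (fun j => nat_of_box r2 j + p.2 * d j) l)%N]].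
have bd (p : 'I_m1 * 'I_m2) l :
   (gam l + joinf (fun i => nat_of_box r1 i + p.1 * c i) (fun j => nat_of_box r2 j + p.2 * d j) l < U l)%N.
  have := ltn_ord p.1; have := ltn_ord p.2; rewrite !mlen_spec // => /andP[_ /forallP h2] /andP[_ /forallP h1].
  move: l; apply: forall_split => l.
    by rewrite joinfl; have := h1 l; rewrite /ul ltn_subRL.
  by rewrite joinfr; have := h2 l; rewrite /ur ltn_subRL.
apply: (frank_select (f := f) (g := g)) => p p'; rewrite /f /g.
have p10 : pos c (nat_of_box r1) = 0%N.
  by have := ltn_ord p.1; rewrite mlen_spec // => /andP[/eqP].
have p20 : pos d (nat_of_box r2) = 0%N.
  by have := ltn_ord p.2; rewrite mlen_spec // => /andP[/eqP].
case: pickP => [s /forallP hs|h]; last first.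
  have [s es] := @box_of _ (fun l => leq_ltn_trans (leq_addl _ _) (bd p l)).
  by have /negP[] := h s; apply/forallP => l; rewrite es.
case: pickP => [t /forallP ht|h]; last first.
  have [t et] := @box_of _ (bd p').
  by have /negP[] := h t; apply/forallP => l; rewrite et.
have hs1 i : nat_of_box (tl s) i = (nat_of_box r1 i + p.1 * c i)%N.
  by rewrite /nat_of_box ffunE (eqP (hs (lshift s2 i))) joinfl.
have hs2 i : nat_of_box (tr s) i = (nat_of_box r2 i + p.2 * d i)%N.
  by rewrite /nat_of_box ffunE (eqP (hs (rshift s1 i))) joinfr.
have ps1 : pos c (nat_of_box (tl s)) = p.1 by rewrite (eq_pos hc hs1) pos_addM // p10.
have ps2 : pos d (nat_of_box (tr s)) = p.2 by rewrite (eq_pos hd hs2) pos_addM // p20.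
have ht1 i : nat_of_box (cut (tl t) gl) i = (nat_of_box r1 i + p'.1 * c i)%N.
  by rewrite cutE /nat_of_box ffunE (eqP (ht (lshift s2 i))) joinfl /gl addKn.
have ht2 i : nat_of_box (cut (tr t) gr) i = (nat_of_box r2 i + p'.2 * d i)%N.
  by rewrite cutE /nat_of_box ffunE (eqP (ht (rshift s1 i))) joinfr /gr addKn.
have pt1 : posl t = p'.1 by rewrite /posl (eq_pos hc ht1) pos_addM // p10.
have pt2 : posr t = p'.2 by rewrite /posr (eq_pos hd ht2) pos_addM // p20.
have rb n (e u : 'I_n -> nat) (t' r : box u) p0 : pos e (nat_of_box t') = p0 ->
    (forall i, nat_of_box t' i = (nat_of_box r i + p0 * e i)%N) -> rootbox e t' = r.
  move=> ep er; apply/ffunP => l; apply: val_inj.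
  by rewrite -[LHS]/(nat_of_box (rootbox e t') l) cutE ep er addnK.
have -> : source_label s == (r1, r2).
  by apply/eqP; congr (_, _); [exact: rb ps1 hs1|exact: rb ps2 hs2].
have -> : target_label t == (r1, r2).
  by apply/eqP; congr (_, _); [exact: rb pt1 ht1|exact: rb pt2 ht2].
rewrite /= /binmx; case: and3P => [[h1 h2 /eqP h3]|nh].
  apply/esym/mult_coef_eq; first by rewrite -h3 leq_addr.
  apply: forall_split => l; rewrite (eqP (ht _)) (eqP (hs _)) ?joinfl ?joinfr -addnA ?cxyl ?cxyr.
    by rewrite -addnA -mulnDl subnKC.
  by rewrite -addnA -mulnDl -h3 addKn subnKC.
apply/esym/eqP; apply: contra_notT nh => /mult_coef_neq0 [i iN e].
have := target_pos e; rewrite ps1 ps2 pt1 pt2 => -[e1 e2 _].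
by rewrite e1 e2 !leq_addr !addKn subnKC.
Qed.

(** Let T_1, T_2 act on k[x] / (x^u) and k[y] / (y^v) by x^c and y^d: these modules are
    direct sums of cyclic ones, spanned by the chains of monomials. *)
Lemma frank_two_term :
  frank (mult_coef (u := U) two_term) = (\sum_(r1 : boxl) \sum_(r2 : boxr)
    frank (@binmx k (mlen c ul (nat_of_box r1)) (mlen d ur (nat_of_box r2)) N))%N.
Proof.
rewrite (frank_blocks (f := source_label) (g := target_label)); last first.
  move=> s t; apply: contraNeq => /mult_coef_neq0 [i iN e].
  by have [_ _ ->] := target_pos e.
rewrite pair_bigA /=; apply: eq_bigr => -[r1 r2] _; exact: two_term_block.
Qed.

End Blocks.

(** * Lengths of the quotients by monomials and by powers of f *)

(** The exponent which trunc_pow effectively takes. *)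
Definition cnat (R : realType) (x : R) : nat := if Num.ceil x <= 0 then 0%N else `|Num.ceil x|%N.

Lemma trunc_powE (A : comNzRingType) (R : realType) (x : A) (y : R) :
  trunc_pow x (Num.ceil y) = x ^+ cnat y.
Proof. by rewrite /trunc_pow /cnat; case: ifP. Qed.

Section MonomialLength.
Variables (k : fieldType) (n : nat) (u c : 'I_n -> nat) (w : nat).

Lemma monomial_mpolyX : monomial (@Xvar k n) c = mpoly.mpolyX k (mnm_of c).
Proof.
rewrite mpoly.mpolyXE_id; apply: eq_bigr => i _.
by rewrite mpoly.mnmE.
Qed.

Lemma frank_mult_monomial : frank (mult_coef (u := u) (monomial (@Xvar k n) c ^+ w)) =
  (\prod_i (u i - w * c i))%N.
Proof.
have wu i : (u i - w * c i <= u i)%N by apply: leq_subr.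
rewrite -(card_subbox wu) -(frank_diag k).
have ME (s t : box u) : mult_coef (monomial (@Xvar k n) c ^+ w) s t =
    ([forall i, (t i : nat) == (s i + w * c i)%N])%:R.
  rewrite /mult_coef monomial_mpolyX mpoly.mpolyXn -mpoly.mpolyXD mpoly.mcoeffX.
  congr (nat_of_bool _)%:R; apply/eqP/forallP => [/mpoly.mnmP e i|e].
    by have := e i; rewrite mpoly.mnmDE mpoly.mulmnE !mpoly.mnmE => <-; rewrite addnC mulnC.
  apply/mpoly.mnmP => i; rewrite mpoly.mnmDE mpoly.mulmnE !mpoly.mnmE (eqP (e i)).
  by rewrite addnC mulnC.
pose down (t : box u) : box u := cut t (fun i => w * c i)%N.
have downE t i : down t i = (t i - w * c i)%N :> nat by rewrite -[LHS]/(nat_of_box (down t) i) cutE.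
apply/eqP; rewrite eqn_leq; apply/andP; split.
  apply: (@frank_select k _ _ _ _ _ _ (fun s : box u => Some s)
     (fun t : box u => if [forall i, (w * c i <= t i)%N] then Some (down t) else None)) => s t.
  rewrite ME; case: forallP => [e|ne]; case: forallP => [h|h].
  - have -> : down t = s.
      by apply/ffunP => i; apply: val_inj; rewrite /= downE (eqP (e i)) addnK.
    rewrite eqxx /= (introT forallP) // => i.
    by rewrite ltn_subRL addnC -(eqP (e i)).
  - by case: h => i; rewrite (eqP (e i)) leq_addl.
  - case: eqP => // es; case: ne => i.
    by rewrite es downE subnK.
  - by [].
pose up (s : box u) : option (box u) := [pick t : box u | [forall i, (t i : nat) == (s i + w * c i)%N]].
apply: (frank_select (f := Some) (g := up)) => s t; rewrite /up.
case: pickP => [t' /forallP ht'|nt].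
  rewrite ME; congr (nat_of_bool _)%:R; apply/andP/forallP => [[/eqP -> _] i|h].
    exact: ht'.
  have e i : s i = t i :> nat.
    by apply/eqP; rewrite -(eqn_add2r (w * c i)) -(eqP (h i)) (eqP (ht' i)).
  split; first by apply/eqP/ffunP => i; apply: val_inj; rewrite /= e.
  by apply/forallP => i; rewrite ltn_subRL addnC -(eqP (ht' i)).
case: andP => // -[_ /forallP h].
have lt i : (t i + w * c i < u i)%N by have := h i; rewrite ltn_subRL addnC.
have /negP[] := nt [ffun i => Ordinal (lt i)].
by apply/forallP => i; rewrite ffunE.
Qed.

End MonomialLength.

Section HIdeals.
Variables (R : realType) (k : fieldType).

Lemma frobenius_power0 (A : comNzRingType) q : (0 < q)%N ->
  frobenius_power q [set (0 : A)] `<=` [set 0].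
Proof.
move=> q0; apply: ideal_gen_min => [|_ [x -> <-]]; last by rewrite /= expr0n eqn0Ngt q0.
split=> [|x y -> ->|a x ->] //=; by rewrite ?addr0 ?mulr0.
Qed.

Lemma h_monomial_length n (c : 'I_n -> nat) (t : 'I_n -> R) (x : R) q : (0 < q)%N ->
  quotient_length R (h_ideal [set (0 : mpoly.mpoly n k)]
    [tuple of rcons [tuple Xvar k i | i < n] (monomial (@Xvar k n) c)]
    [tuple of rcons [tuple t i | i < n] x] q) =
  ((\prod_i cnat (q%:R * t i) - \prod_i (cnat (q%:R * t i) - cnat (q%:R * x) * c i))%:R)%:E.
Proof.
move=> q0; rewrite -(frank_mult_monomial k) -quotient_length_box; congr quotient_length.
have tn (T : Type) (f : 'I_n -> T) y i : tnth [tuple of rcons [tuple f j | j < n] y] (widen_ord (leqnSn n) i) = f i.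
  rewrite (tnth_nth y) /= nth_rcons size_map size_enum_ord ltn_ord.
  by rewrite -[nth _ _ _]/(nth y [tuple f j | j < n] i) -tnth_nth tnth_mktuple.
have tm (T : Type) (f : 'I_n -> T) y : tnth [tuple of rcons [tuple f j | j < n] y] ord_max = y.
  by rewrite (tnth_nth y) /= nth_rcons size_map size_enum_ord ltnn eqxx.
apply: eq_ideal_gen => [g [/(frobenius_power0 q0) ->|[i _ <-]]|g [[i _ <-]|->]].
- by apply: ideal0; apply: ideal_gen_ideal.
- rewrite trunc_powE; case: (unliftP ord_max i) => [j|] ->.
    have -> : lift ord_max j = widen_ord (leqnSn n) j by apply: val_inj; rewrite /= /bump leqNgt ltn_ord.
    by rewrite !tn; apply: ideal_gen_sub; left; exists j.
  by rewrite !tm; apply: ideal_gen_sub; right.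
- apply: ideal_gen_sub; right; exists (widen_ord (leqnSn n) i) => //.
  by rewrite !tn trunc_powE.
apply: ideal_gen_sub; right; exists ord_max => //.
by rewrite !tm trunc_powE.
Qed.

(** In one variable and for c = 1 there is only one chain. *)
Lemma sum_box1 (U v : 'I_1 -> nat) (F : nat -> nat) : F 0%N = 0%N -> v ord0 = U ord0 ->
  (\sum_(r : box U) F (mlen (fun=> 1%N) v (nat_of_box r)) = F (v ord0))%N.
Proof.
move=> F0 vU.
have h1 : exists i : 'I_1, 1%N <> 0%N by exists ord0.
have pE (m : 'I_1 -> nat) : pos (fun=> 1%N) m = m ord0.
  apply/eqP; rewrite eqn_leq; have := pos_mul_le h1 m ord0; rewrite muln1 => -> /=.
  by rewrite -(pos_spec h1); apply/forallP => i; rewrite (ord1 i) muln1.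
have mE (r : box U) : mlen (fun=> 1%N) v (nat_of_box r) = if nat_of_box r ord0 == 0%N then v ord0 else 0%N.
  apply/eqP; rewrite eqn_leq; apply/andP; split.
    rewrite leqNgt mlen_spec // pE; case: eqP => [e|] //=.
    by apply/negP => /forallP/(_ ord0); rewrite e muln1 ltnn.
  case: ifP => // /eqP e; rewrite leqNgt; apply/negP => h.
  have : ~~ (mlen (fun=> 1%N) v (nat_of_box r) < mlen (fun=> 1%N) v (nat_of_box r))%N by rewrite ltnn.
  rewrite mlen_spec // pE e eqxx /= => /negP[].
  by apply/forallP => i; rewrite (ord1 i) e muln1.
have [U0|Up] := posnP (U ord0).
  rewrite big1 ?vU ?U0 // => r _; by case: (r ord0) => x0 lt0; exfalso; rewrite U0 in lt0.
have lt (i : 'I_1) : (0 < U i)%N by rewrite (ord1 i).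
pose r0 : box U := [ffun i => Ordinal (lt i)].
rewrite (bigD1 r0) //= big1 ?addn0.
  by rewrite mE /nat_of_box ffunE /=.
move=> r rr; rewrite mE ifN //; apply: contraNneq rr => e.
by apply/eqP/ffunP => i; apply: val_inj; rewrite (ord1 i) ffunE.
Qed.

(** The case of one variable x and one variable y. *)
Lemma D_sum_length (r1 r2 r : R) q : (0 < q)%N ->
  quotient_length R (h_ideal [set (0 : mpoly.mpoly 2 k)]
     [tuple Xvar k ord0; Xvar k ord_max; Xvar k ord0 + Xvar k ord_max] [tuple r1; r2; r] q) =
  ((tlen k (cnat (q%:R * r1)) (cnat (q%:R * r2)) (cnat (q%:R * r)))%:R)%:E.
Proof.
move=> q0.
set a := cnat (q%:R * r1); set b := cnat (q%:R * r2); set N := cnat (q%:R * r).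
pose U : 'I_(1 + 1) -> nat := joinf (fun=> a) (fun=> b).
have h1 : exists i : 'I_1, 1%N <> 0%N by exists ord0.
have e0 : lshift 1 (ord0 : 'I_1) = ord0 :> 'I_2 by apply: val_inj.
have e1 : rshift 1 (ord0 : 'I_1) = ord_max :> 'I_2 by apply: val_inj.
pose g : mpoly.mpoly 2 k := @two_term k 1 1 (fun=> 1%N) (fun=> 1%N) (fun=> 0%N) N.
have gE : g = (Xvar k ord0 + Xvar k ord_max) ^+ N.
  rewrite /g /two_term.
  have -> : mnm_of (fun=> 0%N) = mpoly.mnm0 :> mpoly.multinom 2.
    by apply/mpoly.mnmP => i; rewrite [LHS]mpoly.mnmE [RHS]mpoly.mnm0E.
  rewrite mpoly.mpolyX0 mul1r; congr ((_ + _) ^+ _); congr mpoly.mpolyX.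
    apply/mpoly.mnmP; apply: (@forall_split 1 1) => i; rewrite mpoly.mnmE mpoly.mnm1E (ord1 i).
      by rewrite joinfl e0 eqxx.
    by rewrite joinfr e1.
  apply/mpoly.mnmP; apply: (@forall_split 1 1) => i; rewrite mpoly.mnmE mpoly.mnm1E (ord1 i).
    by rewrite joinfl e0.
  by rewrite joinfr e1 eqxx.
have -> : tlen k a b N = (\prod_i U i - frank (mult_coef (u := U) g))%N.
  rewrite /tlen big_split_ord /= !big_ord1 /U joinfl joinfr; congr subn.
  rewrite /g frank_two_term //.
  under [RHS]eq_bigr => r0 _.
    rewrite (sum_box1 (F := fun m => frank (@binmx k _ m N))).
    - over.
    - by apply/eqP; rewrite -leqn0; apply: leq_trans (frank_binmx_le _ _ _ _) _; rewrite muln0.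
    - by rewrite /ur subn0.
  rewrite (sum_box1 (F := fun m => frank (@binmx k m _ N))).
  - by rewrite /ul /ur !subn0 joinfl joinfr.
  - by apply/eqP; rewrite -leqn0; apply: leq_trans (frank_binmx_le _ _ _ _) _; rewrite mul0n.
  - by rewrite /ul subn0.
rewrite -quotient_length_box; congr quotient_length.
apply: eq_ideal_gen => [h [/(frobenius_power0 q0) ->|[i _ <-]]|h [[i _ <-]|->]].
- by apply: ideal0; apply: ideal_gen_ideal.
- rewrite trunc_powE; case: i => -[|[|[|i]]] hi //; rewrite !(tnth_nth 0) /=.
  + apply: ideal_gen_sub; left; exists ord0 => //.
    by rewrite /U -e0 joinfl.
  + apply: ideal_gen_sub; left; exists ord_max => //.
    by rewrite /U -e1 joinfr.
  + by apply: ideal_gen_sub; right; rewrite /= gE.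
- move: i; apply: (@forall_split 1 1) => i; rewrite (ord1 i); apply: ideal_gen_sub; right.
    exists ord0 => //; rewrite trunc_powE !(tnth_nth 0) /= /U joinfl.
    by rewrite e0.
  exists (Ordinal (isT : (1 < 3)%N)) => //; rewrite trunc_powE !(tnth_nth 0) /= /U joinfr.
  by rewrite e1.
apply: ideal_gen_sub; right; exists ord_max => //.
by rewrite trunc_powE !(tnth_nth 0) /= gE.
Qed.

Section TwoTerm.
Variables (p s1 s2 : nat) (a c : 'I_s1 -> nat) (b d : 'I_s2 -> nat).
Hypothesis pk : p \in [pchar k].
Hypothesis hc : exists i, c i <> 0%N.
Hypothesis hd : exists j, d j <> 0%N.
Local Notation A := (mpoly.mpoly (s1 + s2) k).
Let x (i : 'I_s1) : A := Xvar k (lshift s2 i).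
Let y (j : 'I_s2) : A := Xvar k (rshift s1 j).

Lemma monomial_l (m : 'I_s1 -> nat) : monomial x m = mpoly.mpolyX k (mnm_of (joinf m (fun=> 0%N))).
Proof.
rewrite mpoly.mpolyXE_id big_split_ord /= [X in _ = _ * X]big1 ?mulr1.
  by apply: eq_bigr => i _; rewrite mpoly.mnmE joinfl.
by move=> j _; rewrite mpoly.mnmE joinfr expr0.
Qed.

Lemma monomial_r (m : 'I_s2 -> nat) : monomial y m = mpoly.mpolyX k (mnm_of (joinf (fun=> 0%N) m)).
Proof.
rewrite mpoly.mpolyXE_id big_split_ord /= [X in _ = X * _]big1 ?mul1r.
  by apply: eq_bigr => i _; rewrite mpoly.mnmE joinfr.
by move=> j _; rewrite mpoly.mnmE joinfl expr0.
Qed.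

Let f : A := monomial x a * monomial y b * (monomial x c + monomial y d).

Lemma two_termE N : f ^+ N = two_term k c d (joinf (fun i => N * a i)%N (fun j => N * b j)%N) N.
Proof.
rewrite /f /two_term !exprMn !monomial_l !monomial_r; congr (_ * _).
rewrite !mpoly.mpolyXn -mpoly.mpolyXD; congr mpoly.mpolyX; apply/mpoly.mnmP; apply: forall_split => i.
  by rewrite mpoly.mnmDE !mpoly.mulmnE !mpoly.mnmE !joinfl mul0n addn0 mulnC.
by rewrite mpoly.mnmDE !mpoly.mulmnE !mpoly.mnmE !joinfr mul0n add0n mulnC.
Qed.

(** Frobenius powers of (x, y) are generated by the powers of the variables. *)
Lemma h_f_ideal e (r : R) (q := (p ^ e)%N) :
  h_ideal (ideal_gen (range x `|` range y)) [tuple f] [tuple r] q =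
  box_ideal (fun=> q) (f ^+ cnat (q%:R * r)).
Proof.
have frobD (g h : A) : (g + h) ^+ q = g ^+ q + h ^+ q.
  rewrite exprDn_pchar // pnatX pnatE ?(pcharf_prime pk) // inE (pcharf_prime pk) /=.
  by rewrite -mpoly.mpolyC_nat (pcharf0 pk) mpoly.mpolyC0 eqxx.
have iB := box_ideal_ideal (fun=> q) (f ^+ cnat (q%:R * r)).
apply: eq_ideal_gen => [h [hF|[i _ <-]]|h [[i _ <-]|->]].
- move: h hF; apply: ideal_gen_min => // _ [g gI <-].
  move: g gI; apply: ideal_gen_min.
    split=> [|g h /= hg hh|g h /= hh].
    - by rewrite /= expr0n expn_eq0 (gtn_eqF (prime_gt0 (pcharf_prime pk))); exact: (ideal0 iB).
    - by rewrite frobD; exact: (idealD iB hg hh).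
    - by rewrite [(g * h) ^+ q]exprMn; exact: (idealM (g ^+ q) iB hh).
  by move=> _ [[i _ <-]|[j _ <-]] /=; apply: ideal_gen_sub; left;
     [exists (lshift s2 i)|exists (rshift s1 j)].
- rewrite trunc_powE (ord1 i) !(tnth_nth 0) /=; apply: ideal_gen_sub; by right.
- apply: ideal_gen_sub; left; apply: ideal_gen_sub; exists (Xvar k i) => //.
  move: i; apply: forall_split => i; apply: ideal_gen_sub; [left|right]; by exists i.
apply: ideal_gen_sub; right; exists ord0 => //.
by rewrite trunc_powE !(tnth_nth 0).
Qed.

(** The pairs of chains contribute the lengths of k[x, y] / (x^m1, y^m2, (x + y)^N), and the
    monomials which x^(N a) y^(N b) does not divide contribute one each. *)
Lemma h_f_length e (r : R) (q := (p ^ e)%N) (N := cnat (q%:R * r))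
    (m1 := fun t : box (fun=> q) => mlen c (fun i => q - N * a i)%N (nat_of_box t))
    (m2 := fun t : box (fun=> q) => mlen d (fun j => q - N * b j)%N (nat_of_box t)) :
  fine (quotient_length R (h_ideal (ideal_gen (range x `|` range y)) [tuple f] [tuple r] q)) =
  q%:R ^+ (s1 + s2) - (\prod_i (q - N * a i)%N)%:R * (\prod_j (q - N * b j)%N)%:R
  + (\sum_t1 \sum_t2 tlen k (m1 t1) (m2 t2) N)%:R.
Proof.
rewrite h_f_ideal quotient_length_box /= two_termE prod_nat_const card_ord.
rewrite frank_two_term //.
set F := (\sum_(r1 : boxl _) _)%N.
have -> : F = (\sum_t1 \sum_t2 frank (@binmx k (m1 t1) (m2 t2) N))%N.
  have e1 : ul (fun=> q) (joinf (fun i => N * a i)%N (fun j => N * b j)%N) = (fun i => q - N * a i)%N.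
    by apply/funext => i; rewrite /ul joinfl.
  have e2 : ur (fun=> q) (joinf (fun i => N * a i)%N (fun j => N * b j)%N) = (fun i => q - N * b i)%N.
    by apply/funext => i; rewrite /ur joinfr.
  by rewrite /F e1 e2.
have hS : (\sum_t1 \sum_t2 frank (@binmx k (m1 t1) (m2 t2) N) +
   \sum_t1 \sum_t2 tlen k (m1 t1) (m2 t2) N =
   \prod_i (q - N * a i) * \prod_j (q - N * b j))%N.
  rewrite -(@sum_mlen _ c hc (fun=> q)) ?leq_subr //; last by move=> i; apply: leq_subr.
  rewrite -(@sum_mlen _ d hd (fun=> q)) ?leq_subr //; last by move=> i; apply: leq_subr.
  rewrite big_distrl /= -big_split; apply: eq_bigr => t1 _ /=.
  rewrite big_distrr /= -big_split; apply: eq_bigr => t2 _ /=.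
  by rewrite /tlen subnKC // frank_binmx_le.
have hle : (\sum_t1 \sum_t2 frank (@binmx k (m1 t1) (m2 t2) N) <= q ^ (s1 + s2))%N.
  apply: leq_trans (leq_addr (\sum_t1 \sum_t2 tlen k (m1 t1) (m2 t2) N) _) _.
  rewrite hS.
  have hl n (g : 'I_n -> nat) : (\prod_(i < n) (q - g i) <= q ^ n)%N.
    have : (\prod_(i < n) (q - g i) <= \prod_(i < n) q)%N.
      by apply: leq_prod => i _; apply: leq_subr.
    by rewrite prod_nat_const card_ord.
  by rewrite expnD leq_mul ?hl.
rewrite natrB // natrX -natrM -hS natrD.
by rewrite -addrA opprD addrNK.
Qed.

End TwoTerm.
End HIdeals.

(** * The function D in a fixed characteristic *)

Section Cnat.
Variable R : realType.
Implicit Types (x y : R).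

Lemma cnat_le x n : (cnat x <= n)%N = (x <= n%:R).
Proof.
have -> : (x <= n%:R) = (Num.ceil x <= n%:Z) by rewrite ceil_le_int.
rewrite /cnat; case: ifP => [h|/negbT]; first by apply/esym; apply: le_trans h _.
by rewrite -ltNge; case: (Num.ceil x) => // m _.
Qed.

Lemma cnat_ge x : x <= (cnat x)%:R.
Proof. by rewrite -cnat_le. Qed.

Lemma lt_cnat x n : (n < cnat x)%N = (n%:R < x).
Proof. by rewrite ltnNge cnat_le -ltNge. Qed.

Lemma cnat_lt x : 0 <= x -> (cnat x)%:R < x + 1.
Proof.
move=> x0; case e : (cnat x) => [|n]; first by lra.
have : (n < cnat x)%N by rewrite e.
by rewrite lt_cnat -[n.+1]addn1 natrD; lra.
Qed.

Lemma cnat_homo x y : x <= y -> (cnat x <= cnat y)%N.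
Proof. by move=> xy; rewrite cnat_le (le_trans xy) ?cnat_ge. Qed.

Lemma cnat0 x : x <= 0 -> cnat x = 0%N.
Proof. by move=> x0; apply/eqP; rewrite -leqn0 cnat_le. Qed.

Lemma cnat_nat n : cnat (n%:R : R) = n.
Proof.
by apply/eqP; rewrite eqn_leq cnat_le lexx /= -(ler_nat R) cnat_ge.
Qed.

Lemma cnat_mul_le p x : (cnat (p%:R * x) <= p * cnat x)%N.
Proof. by rewrite cnat_le natrM ler_wpM2l ?cnat_ge. Qed.

Lemma cnat_mul_ge p x : (p * cnat x <= cnat (p%:R * x) + p)%N.
Proof.
case e : (cnat x) => [|n]; first by rewrite muln0.
have : (n < cnat x)%N by rewrite e.
rewrite lt_cnat mulnS addnC leq_add2r => h.
by rewrite -(ler_nat R) natrM; apply: le_trans (cnat_ge _); rewrite ler_wpM2l // ltW.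
Qed.

End Cnat.

Section GeometricCauchy.
Variable R : realType.

Lemma cvg_pow_inv p : (1 < p)%N -> ((p ^ e)%:R^-1 : R) @[e --> \oo] --> 0.
Proof.
move=> p1.
have -> : (fun e => (p ^ e)%:R^-1 : R) = GRing.exp (p%:R^-1 : R).
  by apply/funext => e; rewrite natrX exprVn.
apply: cvg_expr; rewrite normfV ger0_norm // invf_lt1 ?ltr1n // ltr0n; exact: ltnW.
Qed.

(** Passage to the limit in an inequality with an error of order p^(-e). *)
Lemma le_pow_inv p (x y C : R) : (1 < p)%N -> (forall e, x <= y + C / (p ^ e)%:R) -> x <= y.
Proof.
move=> p1 h.
have hc : y + C / (p ^ e)%:R @[e --> \oo] --> y.
  rewrite -[X in _ --> X]addr0; apply: cvgD; first exact: cvg_cst.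
  by rewrite -[X in _ --> X](mulr0 C); apply: cvgM; [exact: cvg_cst|exact: cvg_pow_inv].
by apply: (cvgr_to_ge hc); apply: nearW.
Qed.

(** Consecutive differences bounded by K / p^e have tails bounded by
    K (1 + 1/p + 1/p^2 + ...) / p^e. *)
Lemma geometric_cauchy p (K : R) (u : nat -> R) : (1 < p)%N -> 0 <= K ->
  (forall e, `|u e.+1 - u e| <= K / (p ^ e)%:R) ->
  cvgn u /\ forall e, `|limn u - u e| <= 2 * K / (p ^ e)%:R.
Proof.
move=> p1 K0 hu.
have P0 e : 0 < ((p ^ e)%:R : R) by rewrite ltr0n expn_gt0 ltnW.
have step e : 2 * (2 * K / (p ^ e.+1)%:R) <= 2 * K / (p ^ e)%:R.
  have p2 : (2 : R) <= p%:R by rewrite ler_nat.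
  have pp : 0 < (p%:R : R) by rewrite ltr0n ltnW.
  have -> : 2 * (2 * K / (p ^ e.+1)%:R) = (2 / p%:R) * (2 * K / (p ^ e)%:R).
    by rewrite expnS natrM; field; rewrite !gt_eqF.
  by rewrite ler_piMl ?ler_pdivrMr ?mul1r // mulr_ge0 ?mulr_ge0 // invr_ge0 ltW.
have bd e : `|u e.+1 - u e| <= 2 * K / (p ^ e)%:R - 2 * K / (p ^ e.+1)%:R.
  by apply: le_trans (hu e) _; have := step e; lra.
pose v e := u e - 2 * K / (p ^ e)%:R; pose w e := u e + 2 * K / (p ^ e)%:R.
have vS : nondecreasing_seq v.
  by apply/nondecreasing_seqP => e; rewrite /v; have := bd e; rewrite ler_norml; lra.
have wS : nonincreasing_seq w.
  by apply/nonincreasing_seqP => e; rewrite /w; have := bd e; rewrite ler_norml; lra.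
have h0 e : 0 <= 2 * K / (p ^ e)%:R by rewrite mulr_ge0 ?mulr_ge0 // invr_ge0 ltW.
have vw e : v e <= w e by rewrite /v /w; have := h0 e; lra.
have cv : cvgn v.
  apply: nondecreasing_is_cvgn => //; exists (w 0%N) => _ [e _ <-].
  by apply: le_trans (vw e) _; apply: wS.
have c0 : 2 * K / (p ^ e)%:R @[e --> \oo] --> (0 : R).
  rewrite -[X in _ --> X](mulr0 (2 * K)); apply: cvgM; [exact: cvg_cst|exact: cvg_pow_inv].
have eu : u = (fun e => v e + 2 * K / (p ^ e)%:R) by apply/funext => e; rewrite /v subrK.
have cu : u @ \oo --> limn v.
  by rewrite [X in X @ _]eu -[X in _ --> X]addr0; apply: cvgD.
have cuu : cvgn u by apply/cvg_ex; exists (limn v).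
split=> // e; have lu : limn u = limn v := cvg_lim (@Rhausdorff R) cu.
have h1 : v e <= limn u by rewrite lu; apply: nondecreasing_cvgn_le.
have h2 : limn u <= w e.
  rewrite lu; apply: limr_le => //; exists e => // j /= ej.
  by apply: le_trans (vw j) _; apply: wS.
by move: h1 h2; rewrite /v /w ler_norml; lra.
Qed.

End GeometricCauchy.

Section DFunction.
Variables (R : realType) (k : fieldType) (p : nat).
Hypothesis pk : p \in [pchar k].
Implicit Types (x y z : R).

Let p1 : (1 < p)%N. Proof. exact: prime_gt1 (pcharf_prime pk). Qed.

(** The approximation to D(x, y, z) at q = p^e. *)
Definition tlen_at x y z e : R :=
  (tlen k (cnat ((p ^ e)%:R * x)) (cnat ((p ^ e)%:R * y)) (cnat ((p ^ e)%:R * z)))%:R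
  / (p ^ e)%:R ^+ 2.

Lemma D_sumE x y z : D_sum k p x y z = limn (tlen_at x y z).
Proof.
rewrite /D_sum /h_fun; congr (limn _); apply/funext => e.
rewrite D_sum_length ?expn_gt0 ?(ltnW p1) // local_dim_mpoly // => i.
case: i => -[|[|//]] hi; apply: ideal_gen_sub; right.
  exists ord0 => //; rewrite (tnth_nth 0) /=; congr Xvar; exact: val_inj.
exists (Ordinal (isT : (1 < 3)%N)) => //; rewrite (tnth_nth 0) /=; congr Xvar; exact: val_inj.
Qed.

Lemma tlen_dist a b c a' b' c' : (a <= a')%N -> (b <= b')%N -> (c <= c')%N ->
  `|(tlen k a' b' c')%:R - (tlen k a b c)%:R : R| <=
    4 * ((a' - a) + (b' - b) + (c' - c))%:R * (a' + b' + c')%:R.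
Proof.
move=> ha hb hc.
have := tlen_shift k a b c (a' - a) (b' - b) (c' - c); rewrite !subnKC // => -[h1 h2].
move: h1 h2; rewrite -!(ler_nat R) !natrD !natrM => h1 h2; rewrite ler_norml.
by rewrite !natrD in h1 h2 *; lra.
Qed.

(** The length at level e scales exactly to level e + 1, up to rounding errors below p in the
    exponents. *)
Lemma tlen_at_step x y z e : 0 <= x -> 0 <= y -> 0 <= z ->
  `|tlen_at x y z e.+1 - tlen_at x y z e| <= 12 * (x + y + z + 3) / (p ^ e)%:R.
Proof.
move=> x0 y0 z0; set Q := (p ^ e)%N.
have Q0 : 0 < (Q%:R : R) by rewrite ltr0n expn_gt0 ltnW.
have Q1 : 1 <= (Q%:R : R) by rewrite ler1n expn_gt0 ltnW.
have pp : 0 < (p%:R : R) by rewrite ltr0n ltnW.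
rewrite /tlen_at expnS -/Q.
set a := cnat (Q%:R * x); set b := cnat (Q%:R * y); set c := cnat (Q%:R * z).
have -> : ((tlen k a b c)%:R / Q%:R ^+ 2 : R) = (tlen k (p * a) (p * b) (p * c))%:R / (p * Q)%:R ^+ 2.
  by rewrite (tlen_mulp pk) !natrM; field; rewrite !gt_eqF.
rewrite -mulrBl normrM [X in _ * X]ger0_norm ?invr_ge0 ?exprn_ge0 //.
have E w : (p * Q)%:R * w = p%:R * (Q%:R * w) :> R by rewrite natrM mulrA.
rewrite !E distrC.
apply: le_trans (ler_wpM2r _ (tlen_dist _ _ _)) _; rewrite ?cnat_mul_le ?invr_ge0 ?exprn_ge0 //.
rewrite -/a -/b -/c.
have hd (w : R) : (p * cnat w - cnat (p%:R * w) <= p)%N by rewrite leq_subLR cnat_mul_ge.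
have hs : ((p * a - cnat (p%:R * (Q%:R * x)) + (p * b - cnat (p%:R * (Q%:R * y))) +
   (p * c - cnat (p%:R * (Q%:R * z))))%:R : R) <= 3 * p%:R.
  have := leq_add (leq_add (hd (Q%:R * x)) (hd (Q%:R * y))) (hd (Q%:R * z)).
  rewrite -/a -/b -/c -(ler_nat R) => /le_trans; apply.
  by rewrite !natrD; lra.
have hn : ((p * a + p * b + p * c)%:R : R) <= p%:R * (Q%:R * (x + y + z + 3)).
  rewrite -!mulnDr natrM ler_pM2l // !natrD.
  have := cnat_lt (mulr_ge0 (ltW Q0) x0); have := cnat_lt (mulr_ge0 (ltW Q0) y0).
  have := cnat_lt (mulr_ge0 (ltW Q0) z0); rewrite -/a -/b -/c => ha hb hc.
  apply: (@le_trans _ _ (Q%:R * (x + y + z) + 3)); first by rewrite !mulrDr; lra.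
  by rewrite [X in _ <= X]mulrDr lerD2l; lra.
set s := _%:R in hs *; set n := _%:R in hn *.
have s0 : 0 <= s by rewrite ler0n.
have n0 : 0 <= n by rewrite ler0n.
rewrite ler_pdivrMr; last by rewrite exprn_gt0 // ltr0n muln_gt0 (ltnW p1) expn_gt0 (ltnW p1).
have -> : 12 * (x + y + z + 3) / Q%:R * (p * Q)%:R ^+ 2 =
   4 * (3 * p%:R) * (p%:R * (Q%:R * (x + y + z + 3))).
  by rewrite natrM; field; rewrite gt_eqF.
by apply: ler_pM; rewrite ?mulr_ge0 ?ler_pM2l.
Qed.

(** The rate of convergence is uniform in the field. *)
Lemma D_sum_cvg x y z : 0 <= x -> 0 <= y -> 0 <= z ->
  forall e, `|D_sum k p x y z - tlen_at x y z e| <= 24 * (x + y + z + 3) / (p ^ e)%:R.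
Proof.
move=> x0 y0 z0 e; rewrite D_sumE.
have K0 : 0 <= 12 * (x + y + z + 3) by lra.
have [_ h] := geometric_cauchy p1 K0 (fun e => tlen_at_step e x0 y0 z0).
by apply: le_trans (h e) _; rewrite le_eqVlt; apply/orP; left; apply/eqP; congr (_ / _); lra.
Qed.

Lemma tlen0 b c : tlen k 0 b c = 0%N. Proof. by rewrite /tlen mul0n. Qed.
Lemma tlenx0 a c : tlen k a 0 c = 0%N. Proof. by rewrite /tlen muln0. Qed.

Lemma D_sum0l y z : D_sum k p 0 y z = 0.
Proof.
rewrite D_sumE; have -> : tlen_at 0 y z = fun=> 0; last exact: lim_cst.
by apply/funext => e; rewrite /tlen_at mulr0 (cnat0 (lexx 0)) tlen0 mul0r.
Qed.

Lemma D_sum0r x z : D_sum k p x 0 z = 0.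
Proof.
rewrite D_sumE; have -> : tlen_at x 0 z = fun=> 0; last exact: lim_cst.
by apply/funext => e; rewrite /tlen_at mulr0 (cnat0 (lexx 0)) tlenx0 mul0r.
Qed.

Lemma tlen_at_lip x y z x' y' e : 0 <= x -> x <= x' -> 0 <= y -> y <= y' -> 0 <= z ->
  `|tlen_at x' y' z e - tlen_at x y z e| <=
  4 * (x' - x + (y' - y) + 2 / (p ^ e)%:R) * (x' + y' + z + 3 / (p ^ e)%:R).
Proof.
move=> x0 xx y0 yy z0; set Q := (p ^ e)%N.
have Q0 : 0 < (Q%:R : R) by rewrite ltr0n expn_gt0 ltnW.
rewrite /tlen_at -/Q -mulrBl normrM [X in _ * X]ger0_norm ?invr_ge0 ?exprn_ge0 //.
have mono u v : u <= v -> (cnat ((Q%:R : R) * u) <= cnat (Q%:R * v))%N.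
  by move=> uv; apply: cnat_homo; rewrite ler_pM2l.
apply: le_trans (ler_wpM2r _ (tlen_dist _ _ _)) _; rewrite ?mono ?invr_ge0 ?exprn_ge0 //.
rewrite subnn addn0.
have hd u v : 0 <= u -> u <= v ->
   ((cnat ((Q%:R : R) * v) - cnat (Q%:R * u))%:R : R) <= Q%:R * (v - u) + 1.
  move=> u0 uv; rewrite natrB ?mono //.
  have h1 := cnat_lt (mulr_ge0 (ltW Q0) (le_trans u0 uv)); have h2 := cnat_ge (Q%:R * u).
  by rewrite mulrBr; lra.
have hx := hd _ _ x0 xx; have hy := hd _ _ y0 yy.
have hn : ((cnat ((Q%:R : R) * x') + cnat (Q%:R * y') + cnat (Q%:R * z))%:R : R) <=
   Q%:R * (x' + y' + z) + 3.
  rewrite !natrD.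
  have := cnat_lt (mulr_ge0 (ltW Q0) (le_trans x0 xx)); have := cnat_lt (mulr_ge0 (ltW Q0) (le_trans y0 yy)).
  have := cnat_lt (mulr_ge0 (ltW Q0) z0); rewrite !mulrDr; lra.
set s := (_ + _)%:R; set n := (_ + _ + _)%:R in hn *.
have hs : s <= Q%:R * (x' - x + (y' - y)) + 2 by rewrite /s natrD mulrDr; lra.
have s0 : 0 <= s by rewrite ler0n.
have n0 : 0 <= n by rewrite ler0n.
rewrite ler_pdivrMr ?exprn_gt0 //.
have -> : 4 * (x' - x + (y' - y) + 2 / Q%:R) * (x' + y' + z + 3 / Q%:R) * Q%:R ^+ 2 =
   4 * ((Q%:R * (x' - x + (y' - y)) + 2) * (Q%:R * (x' + y' + z) + 3)).
  by field; rewrite gt_eqF.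
by rewrite [4 * (_ * _)]mulrA; apply: ler_pM; rewrite ?mulr_ge0 ?ler_pM2l.
Qed.

Lemma D_sum_lip x y z x' y' : 0 <= x -> x <= x' -> 0 <= y -> y <= y' -> 0 <= z ->
  `|D_sum k p x' y' z - D_sum k p x y z| <= 4 * (x' - x + (y' - y)) * (x' + y' + z).
Proof.
move=> x0 xx y0 yy z0.
have x'0 := le_trans x0 xx; have y'0 := le_trans y0 yy.
have c1 := D_sum_cvg x'0 y'0 z0; have c0 := D_sum_cvg x0 y0 z0.
set D1 := D_sum _ _ _ _ _ in c1 *; set D0 := D_sum _ _ _ _ _ in c0 *.
pose S := x' + y' + z; pose d := x' - x + (y' - y).
apply: (@le_pow_inv _ p _ _ (4 * (3 * d + 2 * S + 6) + 24 * (S + 3) + 24 * (x + y + z + 3)) p1) => e.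
have := tlen_at_lip e x0 xx y0 yy z0; have := c1 e; have := c0 e.
rewrite -/S -/d.
have Q0 : 0 < ((p ^ e)%:R : R) by rewrite ltr0n expn_gt0 ltnW.
have Q1 : 1 <= ((p ^ e)%:R : R) by rewrite ler1n expn_gt0 ltnW.
have i0 : 0 < ((p ^ e)%:R : R)^-1 by rewrite invr_gt0.
have i1 : ((p ^ e)%:R : R)^-1 <= 1 by rewrite invf_le1.
move: ((p ^ e)%:R^-1) i0 i1 (tlen_at _ _ _ _) (tlen_at _ _ _ _) => i i0 i1 t1 t0.
have d0 : 0 <= d by rewrite /d; lra.
have S0 : 0 <= S by rewrite /S; lra.
have h : 4 * (d + 2 * i) * (S + 3 * i) <= 4 * d * S + 4 * (3 * d + 2 * S + 6) * i by nra.
rewrite !ler_norml => h0 h1 h2.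
rewrite [X in _ + X]mulrDl [X in _ + (X + _)]mulrDl.
clear -h h0 h1 h2; lra.
Qed.

End DFunction.

(** * The limit of D as the characteristic grows *)

Lemma primes_oo_filter : ProperFilter primes_oo.
Proof.
split; last exact: within_filter.
move=> [N _ hN]; have [q Nq pq] := prime_above N.
by apply: (hN q) => //=; apply: ltnW.
Qed.

#[local] Existing Instance primes_oo_filter.

Lemma primes_oo_near (P : nat -> Prop) : (\forall n \near \oo, P n) -> \forall p \near primes_oo, P p.
Proof. exact: cvg_within. Qed.

Lemma primes_oo_prime : \forall p \near primes_oo, prime p.
Proof. by rewrite /primes_oo near_withinE; apply: nearW. Qed.

Section Ratios.
Variable R : realType.
Implicit Types (f g : nat -> nat) (x y : R).

Lemma cvg_inv_nat : (n%:R^-1 : R) @[n --> \oo] --> 0.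
Proof.
rewrite -(cvg_shiftS (fun n => n%:R^-1 : R)); exact: cvg_harmonic.
Qed.

Lemma ratio_near f (x : R) (c : R) :
  (forall n, `|(f n)%:R - x * n%:R| <= c) -> (f n)%:R / n%:R @[n --> \oo] --> x.
Proof.
move=> h.
have h1 : x + c / n%:R @[n --> \oo] --> x.
  rewrite -[X in _ --> X]addr0; apply: cvgD; first exact: cvg_cst.
  by rewrite -[X in _ --> X](mulr0 c); apply: cvgM; [exact: cvg_cst|exact: cvg_inv_nat].
have h2 : x - c / n%:R @[n --> \oo] --> x.
  rewrite -[X in _ --> X]subr0; apply: cvgB; first exact: cvg_cst.
  by rewrite -[X in _ --> X](mulr0 c); apply: cvgM; [exact: cvg_cst|exact: cvg_inv_nat].
apply: (squeeze_cvgr _ h2 h1); exists 1%N => // n /= n1.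
have n0 : 0 < (n%:R : R) by rewrite ltr0n.
have := h n; rewrite ler_norml => /andP[a b].
rewrite ler_pdivlMr // ler_pdivrMr // mulrBl mulrDl divfK ?gt_eqF //.
by apply/andP; split; lra.
Qed.

Lemma ratio_cnat x : 0 <= x -> (cnat (n%:R * x))%:R / n%:R @[n --> \oo] --> x.
Proof.
move=> x0; apply: (@ratio_near _ _ 1) => n.
have h : 0 <= n%:R * x by rewrite mulr_ge0.
by have := cnat_lt h; have := cnat_ge (n%:R * x); rewrite ler_norml => ? ?; lra.
Qed.

Lemma ratio_trunc x : 0 <= x -> (Num.trunc (n%:R * x))%:R / n%:R @[n --> \oo] --> x.
Proof.
move=> x0; apply: (@ratio_near _ _ 1) => n.
have h : 0 <= n%:R * x by rewrite mulr_ge0.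
have h1 : (Num.trunc (n%:R * x))%:R <= n%:R * x by rewrite -truncn_ge_nat.
have h2 : n%:R * x < (Num.trunc (n%:R * x)).+1%:R by rewrite -truncn_lt_nat.
by move: h2; rewrite -natr1 ler_norml => ?; lra.
Qed.

Lemma ratio_mul f x c : (f n)%:R / n%:R @[n --> \oo] --> x ->
  (f n * c)%:R / n%:R @[n --> \oo] --> x * c%:R.
Proof.
move=> hf; under eq_fun do rewrite natrM mulrAC.
by apply: cvgM; last exact: cvg_cst.
Qed.

Lemma ratio_id : (n%:R : R) / n%:R @[n --> \oo] --> (1 : R).
Proof. by apply: cvg_near_cst; exists 1%N => // n /= n1; rewrite divff // pnatr_eq0 -lt0n. Qed.

Lemma ratio_sub f g x y : (f n)%:R / n%:R @[n --> \oo] --> x ->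
  (g n)%:R / n%:R @[n --> \oo] --> y ->
  (f n - g n)%:R / n%:R @[n --> \oo] --> Num.max 0 (x - y).
Proof.
move=> cf cg.
have -> : Num.max 0 (x - y) = (x - y + `|x - y|) * 2^-1.
  by case: (leP 0 (x - y)) => h; [rewrite ger0_norm //|rewrite ltr0_norm //]; lra.
have cM : ((f n)%:R / n%:R - (g n)%:R / n%:R + `|(f n)%:R / n%:R - (g n)%:R / n%:R|) * 2^-1
    @[n --> \oo] --> (x - y + `|x - y|) * 2^-1.
  apply: cvgM; last exact: cvg_cst.
  by apply: cvgD; [|apply: cvg_norm]; apply: cvgB.
apply: cvg_trans cM; apply: near_eq_cvg; apply: nearW => n.
have n0 : 0 <= (n%:R^-1 : R) by rewrite invr_ge0.
rewrite -mulrBl normrM (ger0_norm n0) -mulrDl mulrAC; congr (_ * _).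
have [h|h] := leqP (g n) (f n).
  have : ((g n)%:R : R) <= (f n)%:R by rewrite ler_nat.
  by move=> h'; rewrite natrB // ger0_norm ?subr_ge0 //; lra.
have h' : ((f n)%:R : R) <= (g n)%:R by rewrite ler_nat ltnW.
rewrite ler0_norm ?subr_le0 //.
have -> : (f n - g n = 0)%N by move: h; clear; lia.
lra.
Qed.

Lemma ratio_prod s (f : 'I_s -> nat -> nat) (x : 'I_s -> R) :
  (forall i, (f i n)%:R / n%:R @[n --> \oo] --> x i) ->
  (\prod_i f i n)%:R / n%:R ^+ s @[n --> \oo] --> \prod_i x i.
Proof.
move=> h.
have E n : (\prod_i f i n)%:R / n%:R ^+ s = \prod_(i < s) ((f i n)%:R / n%:R) :> R.
  by rewrite prodf_div natr_prod prodr_const card_ord.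
under eq_fun do rewrite E.
by apply: cvg_big => //; exact: mul_continuous.
Qed.

Lemma cvg_expn_oo p : (1 < p)%N -> (p ^ e)%N @[e --> \oo] --> \oo.
Proof.
move=> p1 A [N _ hN]; exists N => // e /= Ne; apply: hN => /=.
by apply: leq_trans Ne _; apply/ltnW/ltn_expl.
Qed.

End Ratios.

Section LinearGrowth.
Variable R : realType.
Implicit Types (f g : nat -> nat).

Definition lin_growth f := cvg ((fun n => (f n)%:R / n%:R : R) @ \oo).

Lemma lin_growth_ext f g : f =1 g -> lin_growth f -> lin_growth g.
Proof. by move=> /funext ->. Qed.

Lemma lin_growth_fun f (h : nat -> R) : cvg (h @ \oo) ->
  (forall n, (f n)%:R / n%:R = h n) -> lin_growth f.
Proof. by move=> ch e; rewrite /lin_growth; under eq_fun do rewrite e. Qed.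

Lemma lin_growthD f g : lin_growth f -> lin_growth g -> lin_growth (fun n => f n + g n)%N.
Proof.
move=> cf cg; have cD : cvg ((fun n => (f n)%:R / n%:R + (g n)%:R / n%:R : R) @ \oo) by apply: is_cvgD.
apply: (lin_growth_fun cD) => n.
by rewrite natrD mulrDl.
Qed.

Lemma lin_growthB f g : lin_growth f -> lin_growth g -> lin_growth (fun n => f n - g n)%N.
Proof.
move=> /cvg_ex[x cf] /cvg_ex[y cg]; apply/cvg_ex; exists (Num.max 0 (x - y)).
exact: ratio_sub.
Qed.

Lemma lin_growth_min f g : lin_growth f -> lin_growth g -> lin_growth (fun n => minn (f n) (g n)).
Proof.
move=> cf cg; apply: (@lin_growth_ext (fun n => f n - (f n - g n))%N) => [n|]; first by rewrite minnE.
by apply: lin_growthB => //; apply: lin_growthB.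
Qed.

Lemma lin_growth_mul c : lin_growth (fun n => n * c)%N.
Proof.
apply/cvg_ex; exists (c%:R : R).
apply: cvg_near_cst; exists 1%N => // n /= n1.
by rewrite natrM mulrC mulKf // pnatr_eq0 -lt0n.
Qed.

Lemma lin_growth_cnat (x : R) : 0 <= x -> lin_growth (fun n => cnat (n%:R * x)).
Proof. by move=> x0; apply/cvg_ex; exists x; exact: ratio_cnat. Qed.

Lemma lin_growth_half f : lin_growth f -> lin_growth (fun n => (f n)./2).
Proof.
move=> cf; pose g n := nat_of_bool (odd (f n)).
have cg : lin_growth g.
  apply/cvg_ex; exists 0; apply: (@ratio_near R _ _ 1) => n.
  by rewrite mul0r subr0 ger0_norm // /g; case: odd; rewrite ?lexx ?ler01.
have cM : cvg ((fun n => (f n - g n)%:R / n%:R * 2^-1 : R) @ \oo).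
  by apply: is_cvgM; [exact: lin_growthB|exact: is_cvg_cst].
apply: (lin_growth_fun cM) => n /=.
have -> : (f n - g n = (f n)./2 * 2)%N by rewrite /g -[X in (X - _)%N]odd_double_half addKn -muln2.
by rewrite natrM; move: (n%:R^-1) => i; field.
Qed.

Lemma lin_growth_foldr_min f (I : Type) (F : I -> nat -> nat) (s : seq I) :
  lin_growth f -> (forall i, lin_growth (F i)) ->
  lin_growth (fun n => foldr minn (f n) [seq F i n | i <- s]).
Proof.
move=> cf cF; elim: s => [|i s IH] //=; exact: lin_growth_min.
Qed.

Lemma lin_growth_mindeg0 f g h : lin_growth f -> lin_growth g -> lin_growth h ->
  lin_growth (fun n => mindeg0 (f n) (g n) (h n)).
Proof.
move=> cf cg ch; rewrite /mindeg0; do 2![apply: lin_growth_min].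
- by apply: lin_growth_half; apply: lin_growthD => //; apply: lin_growthD.
- exact: lin_growthD.
- exact: lin_growthD.
exact: lin_growthD.
Qed.

Lemma lin_growth_mindeg E f g h : lin_growth f -> lin_growth g -> lin_growth h ->
  lin_growth (fun n => foldr minn (mindeg0 (f n) (g n) (h n)) (mindeg_cands n E (f n) (g n) (h n))).
Proof.
move=> cf cg ch.
rewrite /mindeg_cands /image_mem; move: (enum_mem _) => s.
apply: (@lin_growth_foldr_min _ _ (fun (t : 'I_E.+1 * 'I_E.+1 * 'I_E.+1) n => (n * mindeg0 t.1.1 t.1.2 t.2 + (f n - n * t.1.1)
    + (g n - n * t.1.2) + (h n - n * t.2))%N)); first exact: lin_growth_mindeg0.
move=> t; apply: lin_growthD; last by apply: lin_growthB => //; exact: lin_growth_mul.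
apply: lin_growthD; last by apply: lin_growthB => //; exact: lin_growth_mul.
apply: lin_growthD; last by apply: lin_growthB => //; exact: lin_growth_mul.
exact: lin_growth_mul.
Qed.

End LinearGrowth.

Section DInfinity.
Variables (R : realType) (k : nat -> fieldType).
Hypothesis kp : forall p, prime p -> p \in [pchar (k p)].
Implicit Types (x y z : R).

(** Up to an error of order 1 / p the function D_p is given by syzygies with exponents of the order of
    p, and the least degree of such a syzygy is a minimum of finitely many quantities which do
    not depend on the field and grow linearly with p. *)
Lemma D_sum_primes_cvg x y z : 0 <= x -> 0 <= y -> 0 <= z ->
  cvg (D_sum (k p) p x y z @[p --> primes_oo]).
Proof.
move=> x0 y0 z0.
pose a n := cnat (n%:R * x); pose b n := cnat (n%:R * y); pose c n := cnat (n%:R * z).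
have ca : lin_growth R a by apply: lin_growth_cnat.
have cb : lin_growth R b by apply: lin_growth_cnat.
have cc : lin_growth R c by apply: lin_growth_cnat.
pose E := (cnat (x + y + z) + 3)%N.
pose m n := foldr minn (mindeg0 (a n) (b n) (c n)) (mindeg_cands n E (a n) (b n) (c n)).
have cm : lin_growth R m by apply: lin_growth_mindeg.
have cM : lin_growth R (fun n => a n + b n + c n - m n)%N.
  by apply: lin_growthB => //; apply: lin_growthD => //; apply: lin_growthD.
pose q f n : R := (f n)%:R / n%:R.
pose T n : R := 2^-1 * (q m n * q m n + q (fun n => a n + b n + c n - m n)%N n *
   q (fun n => a n + b n + c n - m n)%N n - q a n * q a n - q b n * q b n - q c n * q c n).
have cT : cvg (T @ \oo).
  apply: is_cvgM; first exact: is_cvg_cst.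
  apply: is_cvgB; last exact: is_cvgM.
  apply: is_cvgB; last exact: is_cvgM.
  apply: is_cvgB; last exact: is_cvgM.
  by apply: is_cvgD; apply: is_cvgM.
pose l := lim (T @ \oo).
have tE : \forall p \near primes_oo, tlen_at (k p) p x y z 1 = T p.
  near=> p.
  have pp : prime p by near: p; exact: primes_oo_prime.
  have pE : (3 * E < p)%N by near: p; apply: primes_oo_near; exists (3 * E).+1.
  have p0 : 0 < (p%:R : R) by rewrite ltr0n prime_gt0.
  have hS : (a p + b p + c p <= p * E)%N.
    have := cnat_mul_le p (x + y + z); have hh w : 0 <= w -> (cnat (p%:R * w))%:R < p%:R * w + 1 :> R.
      by move=> w0; apply: cnat_lt; rewrite mulr_ge0 // ltW.
    have := hh _ x0; have := hh _ y0; have := hh _ z0 => h1 h2 h3 _.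
    rewrite -(ler_nat R) natrM !natrD.
    have := cnat_ge (x + y + z) => h4.
    have : p%:R * (x + y + z) <= p%:R * (cnat (x + y + z))%:R by rewrite ler_pM2l.
    have : 1 <= (p%:R : R) by rewrite ler1n prime_gt0.
    rewrite /a /b /c [p%:R * (_ + 3)]mulrDr [p%:R * (x + y + z)]mulrDr [p%:R * (x + y)]mulrDr; lra.
  have em := mindegE (kp pp) hS pE.
  have := tlenE (k p) (a p) (b p) (c p); rewrite em -/(m p) /=.
  move=> /(congr1 (fun n => n%:R : R)); rewrite !natrD !natrM => e.
  rewrite /tlen_at expn1 -/(a p) -/(b p) -/(c p) /T /q.
  have -> : (tlen (k p) (a p) (b p) (c p))%:R = 2^-1 * ((m p)%:R * (m p)%:R
     + (a p + b p + c p - m p)%:R * (a p + b p + c p - m p)%:R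
     - (a p)%:R * (a p)%:R - (b p)%:R * (b p)%:R - (c p)%:R * (c p)%:R) :> R by lra.
  by field; rewrite gt_eqF.
have dE : \forall p \near primes_oo, `|D_sum (k p) p x y z - T p| <= 24 * (x + y + z + 3) * p%:R^-1.
  near=> p.
  have pp : prime p by near: p; exact: primes_oo_prime.
  have <- : tlen_at (k p) p x y z 1 = T p by near: p.
  by have := D_sum_cvg (kp pp) x0 y0 z0 1; rewrite expn1.
apply/cvg_ex; exists l.
have cTp : T @ primes_oo --> l by apply: cvg_trans cT; apply: cvg_app; apply: cvg_within.
have ci : 24 * (x + y + z + 3) * p%:R^-1 @[p --> primes_oo] --> (0 : R).
  rewrite -[X in _ --> X](mulr0 (24 * (x + y + z + 3))); apply: cvgM; first exact: cvg_cst.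
  by apply: cvg_trans (@cvg_inv_nat R); apply: cvg_app; apply: cvg_within.
have h1 : T p + 24 * (x + y + z + 3) * p%:R^-1 @[p --> primes_oo] --> l.
  by rewrite -[X in _ --> X]addr0; apply: cvgD.
have h2 : T p - 24 * (x + y + z + 3) * p%:R^-1 @[p --> primes_oo] --> l.
  by rewrite -[X in _ --> X]subr0; apply: cvgB.
apply: (squeeze_cvgr _ h2 h1).
near=> p.
have : `|D_sum (k p) p x y z - T p| <= 24 * (x + y + z + 3) * p%:R^-1 by near: p.
by rewrite ler_norml; lra.
Unshelve. all: by end_near.
Qed.

End DInfinity.

(** * Riemann-Stieltjes sums *)

Section RiemannStieltjesSums.
Variable R : realType.
Implicit Types (F : R -> R -> R) (al be ga : R -> R) (s : seq R) (xi eta : nat -> nat -> R).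

Definition tagged (C delta : R) s1 s2 xi eta : Prop :=
  [/\ fine_partition C delta s1, fine_partition C delta s2 &
    forall i j, (i < size s1)%N -> (j < size s2)%N ->
      (0 :: s1)`_i <= xi i j <= (0 :: s1)`_i.+1 /\
      (0 :: s2)`_j <= eta i j <= (0 :: s2)`_j.+1].

Definition lipschitz_sq (C K : R) F : Prop :=
  forall x y x' y', 0 <= x <= C -> 0 <= y <= C -> 0 <= x' <= C -> 0 <= y' <= C ->
    `|F x' y' - F x y| <= K * (`|x' - x| + `|y' - y|).

Definition vanish_axes F : Prop := (forall y, F 0 y = 0) /\ (forall x, F x 0 = 0).

(** The integrators: monotone away from 0, where the value is arbitrary, and normalized by the
    value at C. *)
Definition tame (C M : R) (g : R -> R) : Prop :=
  [/\ forall u v, 0 < u -> u <= v -> g u <= g v, g C = 0 &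
      forall x, 0 <= x <= C -> `|g x| <= M].

(** The integrator of a unit mass at x. *)
Definition step (x : R) : R -> R := fun y => - (y < x)%R%:R.

Lemma tagged_sym C delta s1 s2 xi eta : tagged C delta s1 s2 xi eta ->
  tagged C delta s2 s1 (fun j i => eta i j) (fun j i => xi i j).
Proof. by move=> [h1 h2 h]; split=> // j i hj hi; have [] := h i j hi hj. Qed.

Lemma lipschitz_sq_sym C K F : lipschitz_sq C K F -> lipschitz_sq C K (fun y x => F x y).
Proof. by move=> h x y x' y' *; rewrite [X in _ * X]addrC; apply: h. Qed.

Lemma RS_sum_sym F al be s1 s2 xi eta :
  RS_sum F al be s1 s2 xi eta =
  RS_sum (fun y x => F x y) be al s2 s1 (fun j i => eta i j) (fun j i => xi i j).
Proof.
rewrite /RS_sum exchange_big; apply: eq_bigr => j _; apply: eq_bigr => i _.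
by rewrite mulrAC.
Qed.

Lemma RS_sumBl F al al' be s1 s2 xi eta :
  RS_sum F (fun x => al x - al' x) be s1 s2 xi eta =
  RS_sum F al be s1 s2 xi eta - RS_sum F al' be s1 s2 xi eta.
Proof.
rewrite /RS_sum -sumrB; apply: eq_bigr => i _; rewrite -sumrB; apply: eq_bigr => j _; ring.
Qed.

Lemma RS_sumBr F al be be' s1 s2 xi eta :
  RS_sum F al (fun x => be x - be' x) s1 s2 xi eta =
  RS_sum F al be s1 s2 xi eta - RS_sum F al be' s1 s2 xi eta.
Proof.
rewrite /RS_sum -sumrB; apply: eq_bigr => i _; rewrite -sumrB; apply: eq_bigr => j _; ring.
Qed.

Lemma RS_sum_suml F (I : finType) (al : I -> R -> R) (w : R) be s1 s2 xi eta :
  RS_sum F (fun x => w * \sum_t al t x) be s1 s2 xi eta =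
  w * \sum_t RS_sum F (al t) be s1 s2 xi eta.
Proof.
rewrite /RS_sum [in RHS]exchange_big mulr_sumr; apply: eq_bigr => i _.
rewrite [in RHS]exchange_big [in RHS]mulr_sumr; apply: eq_bigr => j _.
rewrite -mulr_suml -mulr_sumr -mulrBr -sumrB; ring.
Qed.

Lemma RS_sum_sumr F (I : finType) (be : I -> R -> R) (w : R) al s1 s2 xi eta :
  RS_sum F al (fun x => w * \sum_t be t x) s1 s2 xi eta =
  w * \sum_t RS_sum F al (be t) s1 s2 xi eta.
Proof.
rewrite RS_sum_sym RS_sum_suml; congr (_ * _).
by apply: eq_bigr => t _; rewrite -RS_sum_sym.
Qed.

Section Partition.
Variables (C delta : R) (s : seq R).
Hypothesis hs : fine_partition C delta s.

Let sorted_s : sorted <%R (0 :: s).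
Proof. by case: hs => -[h _] _. Qed.

Lemma partition_lt i j : (j <= size s)%N -> (i < j)%N -> (0 :: s)`_i < (0 :: s)`_j.
Proof.
move=> hj ij; rewrite (lt_sorted_ltn_nth 0 sorted_s) // inE /= ltnS //.
by apply: ltnW; apply: leq_trans hj.
Qed.

Lemma partition_last : (0 :: s)`_(size s) = C.
Proof.
by case: hs => -[_ /eqP h] _; rewrite -h (last_nth 0).
Qed.

Lemma partition_le i : (i <= size s)%N -> 0 <= (0 :: s)`_i <= C.
Proof.
move=> hi; apply/andP; split.
  by case: i hi => [|i] hi //; apply/ltW; apply: (@partition_lt 0%N).
rewrite -partition_last; move: hi; rewrite leq_eqVlt => /orP[/eqP ->//|hi].
by apply/ltW/partition_lt.
Qed.

Lemma partition_fine i : (i < size s)%N ->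
  0 < (0 :: s)`_i.+1 - (0 :: s)`_i < delta.
Proof.
by move=> hi; rewrite subr_gt0 partition_lt //=; case: hs => _; apply.
Qed.

Lemma sum_at_point (v M : R) : 0 <= M -> \sum_(i < size s | (0 :: s)`_i == v) M <= M.
Proof.
move=> M0; have [i hi|h] := pickP (fun i : 'I_(size s) => (0 :: s)`_i == v).
  rewrite (big_pred1 i) // => j /=; rewrite -(eqP hi); apply: nth_uniq; rewrite ?(lt_sorted_uniq sorted_s) //=; exact/ltnW/ltn_ord.
by rewrite big_pred0.
Qed.

(** Only the first increment can be negative. *)
Lemma tame_variation M g : tame C M g ->
  \sum_(i < size s) `|g (0 :: s)`_i.+1 - g (0 :: s)`_i| <= 3 * M.
Proof.
case=> gm gC gM.
have M0 : 0 <= M.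
  by apply: le_trans (normr_ge0 (g 0)) (gM _ _); rewrite lexx /=; have /andP[] := @partition_le 0%N isT.
case en : (size s) => [|n]; first by rewrite big_ord0 mulr_ge0.
rewrite big_ord_recl.
have h0 i : (i <= n.+1)%N -> `|g (0 :: s)`_i| <= M by move=> hi; apply/gM/partition_le; rewrite en.
have e : \sum_(i < n) `|g (0 :: s)`_(bump 0 i).+1 - g (0 :: s)`_(bump 0 i)|
   = g (0 :: s)`_n.+1 - g (0 :: s)`_1.
  rewrite -(telescope_sumr (fun i => g (0 :: s)`_i.+1) (leq0n n)).
  rewrite big_mkord; apply: eq_bigr => i _; rewrite /bump leq0n add1n ger0_norm // subr_ge0.
  have hi : (i < n)%N := ltn_ord i.
  apply: gm; first by apply: (@partition_lt 0%N); rewrite ?en // ltnW.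
  by apply/ltW/partition_lt; rewrite ?en.
have gl : g (0 :: s)`_n.+1 = 0 by rewrite -en partition_last.
rewrite e gl; have := h0 0%N isT; have := h0 1%N isT.
have := ler_normB (g (0 :: s)`_1) (g (0 :: s)`_0).
have := ler_norm (- g (0 :: s)`_1); rewrite normrN /=.
lra.
Qed.

End Partition.

(** Summation by parts moves the differences from g to the slowly varying f. *)
Lemma abel_bound n (f g : nat -> R) (w : R) : g n = 0 ->
  ((0 < n)%N -> `|f 0%N| <= w) -> (forall i, (i.+1 < n)%N -> `|f i.+1 - f i| <= w) ->
  `|\sum_(i < n) f i * (g i.+1 - g i)| <= w * \sum_(i < n) `|g i|.
Proof.
case: n => [|n] gn f0 fi; first by rewrite !big_ord0 normr0 mulr0.
have -> : \sum_(i < n.+1) f i * (g i.+1 - g i) =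
   f n * g n.+1 - f 0%N * g 0%N - \sum_(i < n) (f i.+1 - f i) * g i.+1.
  elim: n {gn f0 fi} => [|n IH]; first by rewrite big_ord_recr !big_ord0 /= add0r subr0 mulrBr.
  by rewrite big_ord_recr /= IH [in RHS]big_ord_recr /=; ring.
rewrite gn mulr0 sub0r -opprD normrN big_ord_recl mulrDr.
apply: le_trans (ler_normD _ _) _; apply: lerD; first by rewrite normrM ler_wpM2r // f0.
apply: le_trans (ler_norm_sum _ _ _) _; rewrite mulr_sumr; apply: ler_sum => i _.
by rewrite normrM ler_wpM2r // fi // ltnS.
Qed.

Section Perturbation.
Variables (C delta K : R) (F : R -> R -> R) (s1 s2 : seq R) (xi eta : nat -> nat -> R).
Hypothesis K0 : 0 <= K.
Hypothesis hF : lipschitz_sq C K F.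
Hypothesis F0 : vanish_axes F.
Hypothesis ht : tagged C delta s1 s2 xi eta.

Let p1 : fine_partition C delta s1. Proof. by case: ht. Qed.
Let p2 : fine_partition C delta s2. Proof. by case: ht. Qed.

Lemma tag_in i j : (i < size s1)%N -> (j < size s2)%N ->
  (0 <= xi i j <= C) /\ (0 <= eta i j <= C).
Proof.
move=> hi hj; have [_ _ /(_ i j hi hj)[/andP[a b] /andP[c d]]] := ht.
have /andP[a0 _] := partition_le p1 (ltnW hi); have /andP[_ b1] := partition_le p1 hi.
have /andP[c0 _] := partition_le p2 (ltnW hj); have /andP[_ d1] := partition_le p2 hj.
by split; apply/andP; split; lra.
Qed.

(** An integrator which is small except at a few points changes the sum little, because
    summation by parts pairs its values with the oscillations of F over adjacent
    cells, which are of the order of the mesh. *)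
Lemma RS_perturb ga be : ga C = 0 ->
  `|RS_sum F ga be s1 s2 xi eta| <= 3 * K * delta *
    (\sum_(i < size s1) `|ga (0 :: s1)`_i|) *
    \sum_(j < size s2) `|be (0 :: s2)`_j.+1 - be (0 :: s2)`_j|.
Proof.
move=> gC; rewrite /RS_sum exchange_big /= mulr_sumr.
apply: le_trans (ler_norm_sum _ _ _) _; apply: ler_sum => j _.
rewrite -mulr_suml normrM ler_wpM2r //.
have hj := ltn_ord j.
apply: (@abel_bound _ (fun i => F (xi i j) (eta i j)) (fun i => ga (0 :: s1)`_i)).
- by rewrite (partition_last p1).
- move=> hi; have [hx hy] := tag_in hi hj; case: F0 => F0y _.
  have [_ _ /(_ _ _ hi hj)[/= hx1 _]] := ht.
  have /andP[d0 d1] := partition_fine p1 hi.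
  have C0 : 0 <= (0 : R) <= C by apply/andP; split=> //; case/andP: hx; apply: le_trans.
  have := hF C0 hy hx hy; rewrite F0y !subr0 subrr normr0 addr0.
  rewrite [`|xi _ _|]ger0_norm; last by case/andP: hx.
  move=> h; apply: le_trans h _; rewrite -mulrA [3 * _]mulrC -mulrA ler_wpM2l //.
  by move: d0 d1 hx1 => /= d0 d1 /andP[_ hx1]; lra.
move=> i hi; have hi' := ltnW hi; have [hx hy] := tag_in hi' hj; have [hx' hy'] := tag_in hi hj.
apply: le_trans (hF hx hy hx' hy') _; rewrite -mulrA [3 * _]mulrC -mulrA ler_wpM2l //.
have [_ _ h] := ht; have [/andP[a b] /andP[c d]] := h _ _ hi' hj.
have [/andP[a' b'] /andP[c' d']] := h _ _ hi hj.
have /andP[_ e1] := partition_fine p1 hi'; have /andP[_ e2] := partition_fine p1 hi.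
have /andP[_ e3] := partition_fine p2 hj.
have n1 : `|xi i.+1 j - xi i j| <= 2 * delta by rewrite ler_norml; lra.
have n2 : `|eta i.+1 j - eta i j| <= delta by rewrite ler_norml; lra.
lra.
Qed.

(** The sum against two unit masses is the value of F at the tag of the cell which contains them. *)
Lemma RS_step x y : 0 <= x <= C -> 0 <= y <= C ->
  `|RS_sum F (step x) (step y) s1 s2 xi eta - F x y| <= 2 * K * delta * (0 < x)%R%:R * (0 < y)%R%:R.
Proof.
move=> hx hy.
have cell s (hs : fine_partition C delta s) z : 0 < z <= C ->
   exists2 i : 'I_(size s), (0 :: s)`_i < z <= (0 :: s)`_i.+1 &
     forall j : 'I_(size s), step z (0 :: s)`_j.+1 - step z (0 :: s)`_j = (j == i)%:R.
  move=> /andP[z0 zC].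
  have ex : exists n, (n <= size s)%N && (z <= (0 :: s)`_n).
    by exists (size s); rewrite leqnn (partition_last hs).
  have [m /andP[ms zm] mmin] := ex_minnP ex.
  case: m ms zm mmin => [|m] ms zm mmin; first by move: zm; rewrite /= leNgt z0.
  have mz : (0 :: s)`_m < z.
    rewrite ltNge; apply/negP => h; have := mmin m; rewrite (ltnW ms) h => /(_ isT).
    by rewrite ltnn.
  have mono i j : (i <= j)%N -> (j <= size s)%N -> (0 :: s)`_i <= (0 :: s)`_j.
    by rewrite leq_eqVlt => /orP[/eqP ->//|ij] hj; apply/ltW; apply: (partition_lt hs).
  exists (Ordinal ms); first by rewrite mz.
  move=> j; rewrite /step -val_eqE /=.
  have [jm|jm|jm] := ltngtP j m.
  - have h1 : (0 :: s)`_j.+1 < z := le_lt_trans (mono _ _ jm (ltnW ms)) mz.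
    have h2 : (0 :: s)`_j < z := le_lt_trans (mono _ _ (ltnW jm) (ltnW ms)) mz.
    by rewrite h1 h2 subrr.
  - have h1 : z <= (0 :: s)`_j := le_trans zm (mono _ _ jm (ltnW (ltn_ord j))).
    have h2 : z <= (0 :: s)`_j.+1 := le_trans h1 (mono _ _ (leqnSn j) (ltn_ord j)).
    by rewrite !ltNge h1 h2 subrr.
  by rewrite jm mz ltNge zm oppr0 add0r opprK.
have [x0|x0] := eqVneq x 0.
  rewrite x0 ltxx mulr0 mul0r; case: F0 => -> _; rewrite subr0.
  rewrite /RS_sum big1 ?normr0 // => i _; rewrite big1 // => j _.
  have /andP[h1 _] := partition_le p1 (ltn_ord i).
  have /andP[h2 _] := partition_le p1 (ltnW (ltn_ord i)).
  by rewrite /step !ltNge h1 h2 subrr mulr0 mul0r.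
have [y0|y0] := eqVneq y 0.
  rewrite y0 ltxx mulr0; case: F0 => _ ->; rewrite subr0.
  rewrite /RS_sum big1 ?normr0 // => i _; rewrite big1 // => j _.
  have /andP[h1 _] := partition_le p2 (ltn_ord j).
  have /andP[h2 _] := partition_le p2 (ltnW (ltn_ord j)).
  by rewrite /step [_ < 0]ltNge h1 [_ < 0]ltNge h2 subrr mulr0.
have xp : 0 < x by rewrite lt0r x0; case/andP: hx.
have yp : 0 < y by rewrite lt0r y0; case/andP: hy.
have [i /andP[xi1 xi2] ei] : exists2 i : 'I_(size s1), (0 :: s1)`_i < x <= (0 :: s1)`_i.+1 &
     forall j : 'I_(size s1), step x (0 :: s1)`_j.+1 - step x (0 :: s1)`_j = (j == i)%:R.
  by apply: (cell _ p1); rewrite xp; case/andP: hx.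
have [j /andP[yj1 yj2] ej] : exists2 i : 'I_(size s2), (0 :: s2)`_i < y <= (0 :: s2)`_i.+1 &
     forall j : 'I_(size s2), step y (0 :: s2)`_j.+1 - step y (0 :: s2)`_j = (j == i)%:R.
  by apply: (cell _ p2); rewrite yp; case/andP: hy.
have -> : RS_sum F (step x) (step y) s1 s2 xi eta = F (xi i j) (eta i j).
  rewrite /RS_sum (bigD1 i) //= (bigD1 j) //= ei ej !eqxx !mulr1.
  rewrite big1 ?addr0 => [|j' /negPf hj]; last by rewrite ej hj mulr0.
  rewrite big1 ?addr0 // => i' /negPf hi.
  by rewrite big1 // => j' _; rewrite ei hi mulr0 mul0r.
have [hx' hy'] := tag_in (ltn_ord i) (ltn_ord j).
apply: le_trans (hF hx hy hx' hy') _; rewrite xp yp !mulr1 -mulrA [2 * _]mulrC -mulrA ler_wpM2l //.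
have [_ _ /(_ _ _ (ltn_ord i) (ltn_ord j))[/andP[a b] /andP[c d]]] := ht.
have /andP[_ e1] := partition_fine p1 (ltn_ord i).
have /andP[_ e2] := partition_fine p2 (ltn_ord j).
have n1 : `|xi i j - x| <= delta by rewrite ler_norml; lra.
have n2 : `|eta i j - y| <= delta by rewrite ler_norml; lra.
lra.
Qed.

End Perturbation.

End RiemannStieltjesSums.

(** * Limits of Riemann-Stieltjes sums *)

Section RiemannStieltjesLimits.
Variable R : realType.
Implicit Types (F : R -> R -> R) (al be : R -> R) (xi eta : nat -> nat -> R).

Lemma fine_partition_ex (C delta : R) : 0 < C -> 0 < delta -> exists s, fine_partition C delta s.
Proof.
move=> C0 d0; pose n := (Num.trunc (C / delta)).+1.
have n0 : 0 < (n%:R : R) by rewrite ltr0n.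
have hn : C / n%:R < delta.
  rewrite ltr_pdivrMr // mulrC -ltr_pdivrMr //.
  have := truncn_le_nat (C / delta) (Num.trunc (C / delta)); rewrite leqnn => /esym; exact.
pose f i := C * i%:R / n%:R : R.
have nthE i : (i <= n)%N -> (0 :: mkseq (fun i => f i.+1) n)`_i = f i.
  by case: i => [|i] hi; [rewrite /f mulr0 mul0r|rewrite /= nth_mkseq].
have fS i : f i.+1 - f i = C / n%:R by rewrite /f -[i.+1]addn1 natrD; ring.
have cn : 0 < C / n%:R by rewrite divr_gt0.
exists (mkseq (fun i => f i.+1) n); split.
  split; last by rewrite (last_nth 0) size_mkseq nthE // /f mulfK // lt0r_neq0.
  apply/(pathP 0) => i; rewrite size_mkseq => hi; rewrite nthE ?(ltnW hi) //.
  by rewrite nth_mkseq // -subr_gt0 fS.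
by move=> i; rewrite size_mkseq => hi; rewrite !nthE ?(ltnW hi) // fS.
Qed.

Lemma tagged_ex (C delta : R) : 0 < C -> 0 < delta -> exists s1 s2 xi eta, tagged C delta s1 s2 xi eta.
Proof.
move=> C0 d0; have [s hs] := fine_partition_ex C0 d0.
exists s, s, (fun i _ => (0 :: s)`_i), (fun _ j => (0 :: s)`_j); split=> // i j hi hj.
have /andP[h1 _] := partition_fine hs hi; have /andP[h2 _] := partition_fine hs hj.
by rewrite !lexx; split; rewrite -subr_ge0 ltW.
Qed.

Lemma RS_integral_bound F al be (C K L : R) : 0 <= K ->
  (forall delta s1 s2 xi eta, 0 < delta -> tagged C delta s1 s2 xi eta ->
     `|RS_sum F al be s1 s2 xi eta - L| <= K * delta) ->
  is_RS_integral F al be C L.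
Proof.
move=> K0 h eps e0; exists (eps / (K + 1)); first by rewrite divr_gt0 // ltr_wpDl.
move=> s1 s2 xi eta h1 h2 h12; apply: le_lt_trans (h _ _ _ _ _ _ (And3 h1 h2 h12)) _.
  by rewrite divr_gt0 // ltr_wpDl.
by rewrite mulrCA gtr_pMr // ltr_pdivrMr ?mul1r ?ltrDl // ltr_wpDl.
Qed.

(** The quantities S(q) are Cauchy along G, all of them being close to one Riemann-Stieltjes sum,
    and their limit is as close to every sum of small mesh. *)
Lemma RS_limit (T : Type) (G : set_system T) (FG : ProperFilter G) F al be (C K : R) (S : T -> R) :
  0 < C -> 0 <= K ->
  (forall delta eps s1 s2 xi eta, 0 < delta -> 0 < eps -> tagged C delta s1 s2 xi eta ->
     \forall q \near G, `|RS_sum F al be s1 s2 xi eta - S q| <= K * delta + eps) ->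
  exists2 L, S @ G --> L & is_RS_integral F al be C L /\
    forall delta s1 s2 xi eta, 0 < delta -> tagged C delta s1 s2 xi eta ->
     `|RS_sum F al be s1 s2 xi eta - L| <= K * delta.
Proof.
move=> C0 K0 h.
have /cvg_ex[L hL] : cvg (S @ G).
  apply: cauchy_cvg; apply: cauchy_exP => eps e0.
  have K1 : 0 < K + 1 by rewrite ltr_wpDl.
  pose delta := eps / 2 / (K + 1).
  have d0 : 0 < delta by rewrite !divr_gt0.
  have [s1 [s2 [xi [eta ht]]]] := tagged_ex C0 d0.
  exists (RS_sum F al be s1 s2 xi eta).
  have e4 : 0 < eps / 4 by rewrite divr_gt0.
  have kd : K * delta <= eps / 2.
    rewrite /delta mulrCA -{2}[eps / 2]mulr1 ler_wpM2l ?divr_ge0 ?ltW // ltr_pdivrMr //; lra.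
  apply: filterS (h _ _ _ _ _ _ d0 e4 ht) => q hq /=.
  by apply: le_lt_trans hq _; lra.
have bd delta s1 s2 xi eta : 0 < delta -> tagged C delta s1 s2 xi eta ->
    `|RS_sum F al be s1 s2 xi eta - L| <= K * delta.
  move=> d0 ht; apply/ler_addgt0Pr => eps e0.
  have hc : `|RS_sum F al be s1 s2 xi eta - S q| @[q --> G] --> `|RS_sum F al be s1 s2 xi eta - L|.
    by apply: cvg_norm; apply: cvgB => //; exact: cvg_cst.
  by apply: (cvgr_to_le hc); exact: h.
by exists L => //; split=> //; exact: RS_integral_bound bd.
Qed.

Section Empirical.
Variables (T : Type) (G : set_system T) (FG : ProperFilter G).
Variables (C K M : R) (F : R -> R -> R).
Hypothesis (C0 : 0 < C) (K0 : 0 <= K).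
Hypothesis hF : lipschitz_sq C K F.
Hypothesis F0 : vanish_axes F.

Lemma tame_ge0 g : tame C M g -> 0 <= M.
Proof. by case=> _ _ /(_ 0); rewrite lexx ltW //= => /(_ isT); apply: le_trans. Qed.

(** Convergence may fail at the points 0 and u, each of which occurs at most once in a
    partition. *)
Lemma sum_dist_near (g : R -> R) (gq : T -> R -> R) (u delta : R) s :
  fine_partition C delta s -> tame C M g -> (forall q, tame C M (gq q)) ->
  (forall x, 0 < x <= C -> x != u -> gq q x @[q --> G] --> g x) ->
  \forall q \near G, \sum_(i < size s) `|g (0 :: s)`_i - gq q (0 :: s)`_i| <= 4 * M + 1.
Proof.
move=> hs tg tq hc; have M0 := tame_ge0 tg.
pose bad (i : 'I_(size s)) := ((0 :: s)`_i == 0) || ((0 :: s)`_i == u).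
pose e : R := (size s).+1%:R^-1.
have e0 : 0 < e by rewrite invr_gt0.
have hi (i : 'I_(size s)) : 0 <= (0 :: s)`_i <= C by apply: (partition_le hs); exact: ltnW.
have : \forall q \near G, forall i : 'I_(size s), ~~ bad i -> `|g (0 :: s)`_i - gq q (0 :: s)`_i| <= e.
  apply: filter_forall => i; case ei : (bad i); first by apply: nearW.
  move: ei; rewrite /bad => /norP[i0 iu].
  have h : 0 < (0 :: s)`_i <= C by rewrite lt0r i0; have := hi i.
  have := hc _ h iu => /cvgrPdist_le /(_ e e0); apply: filterS => q hq _; exact: hq.
apply: filterS => q hq; rewrite (bigID bad) /=; apply: lerD.
  apply: (@le_trans _ _ (\sum_(i < size s | bad i) (2 * M))).
    apply: ler_sum => i _; apply: le_trans (ler_normB _ _) _.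
    have [_ _ /(_ _ (hi i)) h1] := tg; have [_ _ /(_ _ (hi i)) h2] := tq q; lra.
  have M2 : 0 <= 2 * M by rewrite mulr_ge0.
  rewrite big_mkcond /=.
  apply: (@le_trans _ _ (\sum_(i < size s | (0 :: s)`_i == 0) (2 * M) +
     \sum_(i < size s | (0 :: s)`_i == u) (2 * M))); last first.
    by have := sum_at_point hs 0 M2; have := sum_at_point hs u M2; lra.
  rewrite [X in _ <= X + _]big_mkcond [X in _ <= _ + X]big_mkcond -big_split /=; apply: ler_sum => i _.
  by rewrite /bad; case: eqP => _; case: eqP => _ /=; lra.
apply: (@le_trans _ _ (\sum_(i < size s) e)).
  by rewrite big_mkcond; apply: ler_sum => i _; case: ifP => [/hq //|_]; exact: ltW.
rewrite sumr_const card_ord -mulr_natl /e ler_pdivrMr ?mul1r // ler_nat; exact: leqW.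
Qed.

(** The integrators are replaced one after the other; the mesh pays for the points at which they
    do not converge. *)
Lemma RS_dist_near (al be : R -> R) (alq beq : T -> R -> R) (u v delta : R) s1 s2 xi eta :
  0 < delta -> tagged C delta s1 s2 xi eta ->
  tame C M al -> tame C M be -> (forall q, tame C M (alq q)) -> (forall q, tame C M (beq q)) ->
  (forall x, 0 < x <= C -> x != u -> alq q x @[q --> G] --> al x) ->
  (forall x, 0 < x <= C -> x != v -> beq q x @[q --> G] --> be x) ->
  \forall q \near G, `|RS_sum F al be s1 s2 xi eta - RS_sum F (alq q) (beq q) s1 s2 xi eta|
     <= 18 * K * M * (4 * M + 1) * delta.
Proof.
move=> d0 ht ta tb taq tbq ca cb; have M0 := tame_ge0 ta.
have [p1 p2 _] := ht.
apply: filterS2 (sum_dist_near p1 ta taq ca) (sum_dist_near p2 tb tbq cb) => q ha hb.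
have -> : RS_sum F al be s1 s2 xi eta - RS_sum F (alq q) (beq q) s1 s2 xi eta =
  RS_sum F (fun x => al x - alq q x) be s1 s2 xi eta +
  RS_sum (fun y x => F x y) (fun x => be x - beq q x) (alq q) s2 s1 (fun j i => eta i j) (fun j i => xi i j).
  by rewrite -(RS_sum_sym F (alq q) (fun x => be x - beq q x)) RS_sumBl RS_sumBr; ring.
have Cz g : tame C M g -> g C = 0 by case.
have /(_ be) h1 := RS_perturb K0 hF F0 ht (ga := fun x => al x - alq q x).
have F0' : vanish_axes (fun y x => F x y) by case: F0.
have /(_ (alq q)) h2 := RS_perturb K0 (lipschitz_sq_sym hF) F0' (tagged_sym ht) (ga := fun x => be x - beq q x).
have v1 := tame_variation p2 tb; have v2 := tame_variation p1 (taq q).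
have k0 : 0 <= 3 * K * delta by rewrite !mulr_ge0 // ltW.
have bd (X Y : R) : 0 <= X -> X <= 4 * M + 1 -> 0 <= Y -> Y <= 3 * M ->
   3 * K * delta * X * Y <= 9 * K * M * (4 * M + 1) * delta.
  move=> X0 X1 Y0 Y1.
  have -> : 9 * K * M * (4 * M + 1) * delta = 3 * K * delta * ((4 * M + 1) * (3 * M)) by ring.
  by rewrite -mulrA ler_wpM2l // ler_pM.
apply: le_trans (ler_normD _ _) _.
have := h1; rewrite !Cz // subr0 => /(_ erefl) g1.
have := h2; rewrite !Cz // subr0 => /(_ erefl) g2.
have := bd _ _ _ ha _ v1; have := bd _ _ _ hb _ v2.
have s0 (n : nat) (f : 'I_n -> R) : 0 <= \sum_i `|f i| by apply: sumr_ge0.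
move=> /(_ (s0 _ _) (s0 _ _)) b2 /(_ (s0 _ _) (s0 _ _)) b1.
by move: (le_trans g1 b1) (le_trans g2 b2); lra.
Qed.

Section Weights.
Variables (I : finType) (x : I -> R) (w : R).
Hypothesis w0 : 0 <= w.
Hypothesis hx : forall t, 0 <= x t <= C.
Hypothesis hM : w * \sum_t (0 < x t)%R%:R <= M.

Lemma tame_empirical : tame C M (fun z => w * \sum_t step (x t) z).
Proof.
split=> [z z' z0 zz||z /andP[z0 _]].
- apply: ler_wpM2l => //; apply: ler_sum => t _; rewrite /step lerN2 ler_nat.
  by case h : (z' < x t) => //; rewrite (le_lt_trans zz h).
- rewrite big1 ?mulr0 // => t _; rewrite /step ltNge.
  by have /andP[_ ->] := hx t; rewrite oppr0.
rewrite normrM ger0_norm //; apply: le_trans hM; apply: ler_wpM2l => //.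
apply: le_trans (ler_norm_sum _ _ _) _; apply: ler_sum => t _.
rewrite /step normrN ger0_norm // ler_nat.
by case h : (z < x t) => //; rewrite (le_lt_trans z0 h).
Qed.

End Weights.

(** The sum against counting measures is compared term by term with the values of F. *)
Lemma RS_empirical (I J : finType) (x : I -> R) (y : J -> R) (w w' delta : R) s1 s2 xi eta :
  0 < delta -> tagged C delta s1 s2 xi eta -> 0 <= w -> 0 <= w' ->
  (forall t, 0 <= x t <= C) -> (forall t, 0 <= y t <= C) ->
  w * \sum_t (0 < x t)%R%:R <= M -> w' * \sum_t (0 < y t)%R%:R <= M ->
  `|RS_sum F (fun z => w * \sum_t step (x t) z) (fun z => w' * \sum_t step (y t) z) s1 s2 xi eta -
    w * w' * \sum_t \sum_t' F (x t) (y t')| <= 2 * K * M ^+ 2 * delta.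
Proof.
move=> d0 ht w0 w0' hx hy Mx My.
rewrite RS_sum_suml; under eq_bigr do rewrite RS_sum_sumr.
rewrite -mulr_sumr mulrA -mulrBr -sumrB normrM ger0_norm ?mulr_ge0 //.
have -> : 2 * K * M ^+ 2 * delta = M * (M * (2 * K * delta)) by ring.
have k0 : 0 <= 2 * K * delta by rewrite !mulr_ge0 // ltW.
apply: (@le_trans _ _ (w * w' * \sum_t \sum_t' (2 * K * delta * (0 < x t)%R%:R * (0 < y t')%R%:R))).
  apply: ler_wpM2l; first exact: mulr_ge0.
  apply: le_trans (ler_norm_sum _ _ _) _; apply: ler_sum => t _; rewrite -sumrB.
  apply: le_trans (ler_norm_sum _ _ _) _; apply: ler_sum => t' _.
  exact: (RS_step K0 hF F0 ht).
under eq_bigr do rewrite -mulr_sumr.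
rewrite -mulr_suml -mulr_sumr.
have -> X Y : w * w' * (2 * K * delta * X * Y) = (w * X) * ((w' * Y) * (2 * K * delta)) by ring.
have s0 (A : finType) (f : A -> R) : 0 <= \sum_t (0 < f t)%R%:R :> R by apply: sumr_ge0.
apply: ler_pM => //; first by apply: mulr_ge0.
  by apply: mulr_ge0 => //; apply: mulr_ge0.
by apply: ler_wpM2r.
Qed.

End Empirical.

End RiemannStieltjesLimits.

(** * The h-function of a monomial *)

Section Shrunk.
Variables (R : realType) (s : nat) (c : 'I_s -> nat) (t : 'I_s -> R).

(** The volume of the box of sides t_i after x c_i has been taken off each of them. *)
Definition shrunk (x : R) : R := \prod_i Num.max 0 (t i - x * (c i)%:R).

Lemma h_monomialE (k : fieldType) p x : p \in [pchar k] -> (forall i, 0 <= t i) ->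
  h_monomial k p c t x = \prod_i t i - shrunk (Num.max 0 x).
Proof.
move=> pk t0; have p1 := prime_gt1 (pcharf_prime pk).
set z := Num.max 0 x; have z0 : 0 <= z by rewrite le_max lexx.
have cz n : cnat (n%:R * x) = cnat (n%:R * z).
  rewrite /z; case: (leP 0 x) => // /ltW x0.
  by rewrite mulr0 !cnat0 // mulr_ge0_le0.
rewrite /h_monomial /h_fun local_dim_mpoly; last first.
  move=> i; apply: ideal_gen_sub; right; exists (widen_ord (leqnSn s) i) => //.
  rewrite (tnth_nth 0) /= nth_rcons size_map size_enum_ord ltn_ord.
  by rewrite -[nth _ _ _]/(nth 0 [tuple Xvar k j | j < s] i) -tnth_nth tnth_mktuple.
apply: cvg_lim; first exact: Rhausdorff.
under eq_fun do rewrite h_monomial_length ?expn_gt0 ?(ltnW p1) //= cz.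
have hc : (\prod_i cnat (n%:R * t i) - \prod_i (cnat (n%:R * t i) - cnat (n%:R * z) * c i))%:R
   / n%:R ^+ s @[n --> \oo] --> \prod_i t i - shrunk z.
  have le n : (\prod_(i < s) (cnat (n%:R * t i) - cnat (n%:R * z) * c i) <= \prod_i cnat (n%:R * t i))%N.
    by apply: leq_prod => i _; apply: leq_subr.
  under eq_fun do rewrite natrB // mulrBl.
  apply: cvgB; apply: (@ratio_prod _ _ (fun i n => _)) => i; first exact: ratio_cnat.
  by apply: ratio_sub; [exact: ratio_cnat|apply: ratio_mul; exact: ratio_cnat].
exact: (cvg_comp _ _ (cvg_expn_oo p1) hc).
Qed.

(** Beyond the point where the first factor vanishes the product is zero, and before it
    the product is a polynomial. *)
Lemma shrunk_derivable : (forall i, 0 <= t i <= 1) -> (exists i, c i <> 0%N) ->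
  exists2 u, u <= 1 & forall x, 0 < x -> x != u -> derivable shrunk x 1.
Proof.
move=> ht [i0 /eqP hi0].
pose F i := t i / (c i)%:R.
case: (@arg_minP _ _ _ i0 (fun i => c i != 0%N) F hi0) => j hj jmin.
have c0 i : c i != 0%N -> 0 < ((c i)%:R : R) by rewrite ltr0n lt0n.
have cj := c0 _ hj.
exists (F j).
  rewrite ler_pdivrMr // mul1r; have /andP[_ h] := ht j; apply: le_trans h _.
  by rewrite ler1n lt0n.
move=> x x0; rewrite neq_lt => /orP[xu|xu].
  pose P (y : R) := \prod_i (t i - y * (c i)%:R).
  have dP : derivable P x 1.
    rewrite /P; elim: (index_enum _) => [|i l IH].
      have -> : (fun y : R => \prod_(i <- [::]) (t i - y * (c i)%:R)) = cst 1.
        by apply/funext => y; rewrite big_nil.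
      exact: derivable_cst.
    have -> : (fun y : R => \prod_(i <- i :: l) (t i - y * (c i)%:R)) =
       (cst (t i) - id * cst (c i)%:R) * (fun y : R => \prod_(i <- l) (t i - y * (c i)%:R)).
      by apply/funext => y; rewrite big_cons.
    by apply: derivableM.
  apply: near_eq_derivable dP; near=> y.
  have yu : y < F j by near: y; exact: lt_nbhsl.
  apply: eq_bigr => i _; rewrite max_r // subr_ge0.
  have [ci|ci] := eqVneq (c i) 0%N; first by rewrite ci mulr0; have /andP[] := ht i.
  by rewrite -ler_pdivlMr ?c0 //; apply: le_trans (ltW yu) (jmin _ ci).
have d0 : derivable (cst (0 : R)) x (1 : R) by exact: derivable_cst.
apply: near_eq_derivable d0; near=> y.
have yu : F j < y by near: y; exact: lt_nbhsr.
rewrite /shrunk (bigD1 j) //= max_l ?mul0r //.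
by rewrite subr_le0 -ler_pdivrMr // ltW.
Unshelve. all: by end_near.
Qed.

End Shrunk.

Section ConcaveLimit.
Variable R : realType.

Section Counting.
Variables (K cnt : nat -> nat).
Hypothesis cnt_mono : forall y y', (y <= y')%N -> (cnt y' <= cnt y)%N.
Hypothesis Kcnt : forall y, K y = (K y.+1 + cnt y)%N.

Lemma count_slope_l y j : (K (y + j) + j * cnt (y + j) <= K y)%N.
Proof.
elim: j => [|j IH]; first by rewrite addn0 mul0n addn0.
apply: leq_trans IH; rewrite (Kcnt (y + j)) addnS mulSn.
rewrite -addnA leq_add2l leq_add ?leq_mul ?cnt_mono //.
Qed.

Lemma count_slope_r y j : (K y <= K (y + j) + j * cnt y)%N.
Proof.
elim: j => [|j IH]; first by rewrite addn0 mul0n addn0.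
apply: leq_trans IH _; rewrite (Kcnt (y + j)) addnS mulSn addnA leq_add2r leq_add2l.
by apply: cnt_mono; rewrite leq_addr.
Qed.

End Counting.

(** K(n, .) is a discrete convex function with slopes - cnt(n, .). Difference quotients of convex
    functions bound the slopes from both sides, so that pointwise convergence of the functions
    gives convergence of the slopes wherever the limit is differentiable. *)
Lemma concave_slope_limit (K cnt : nat -> nat -> nat) (s V : nat) (H : R -> R) (h0 x : R) :
  (forall n y y', (y <= y')%N -> (cnt n y' <= cnt n y)%N) ->
  (forall n y, K n y = (K n y.+1 + cnt n y)%N) ->
  (forall n y, (cnt n y <= V * n ^ s)%N) ->
  (forall z, 0 <= z -> (K n (Num.trunc (n%:R * z)))%:R / n%:R ^+ s.+1 @[n --> \oo] --> h0 - H z) ->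
  0 < x -> derivable H x 1 ->
  (cnt n (Num.trunc (n%:R * x)))%:R / n%:R ^+ s @[n --> \oo] --> derive1 H x.
Proof.
move=> cm Kc cV hK x0 dH.
have hd : h^-1 *: (H (h + x) - H x) @[h --> 0^'] --> derive1 H x.
  rewrite /derive1; move: dH; rewrite /derivable.
  have -> : (fun h : R => h^-1 *: ((H \o shift x) (h *: 1) - H x)) =
     (fun h : R => h^-1 *: (H (h + x) - H x)).
    by apply/funext => h /=; rewrite /shift /= [h *: 1]mulr1.
  by [].
apply/cvgrPdist_le => e e0.
have e4 : 0 < e / 4 by rewrite divr_gt0.
have /cvgrPdist_le /(_ _ e4) := hd.
rewrite near_withinE => /nbhs_ballP[r /= r0 hr].
pose a := Num.min r x / 2.
have a0 : 0 < a by rewrite divr_gt0 // lt_min r0.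
have ar : a < r.
  have : Num.min r x <= r by rewrite ge_min lexx.
  by rewrite /a => ?; lra.
have ax : a < x.
  have : Num.min r x <= x by rewrite ge_min lexx orbT.
  by rewrite /a => ?; lra.
set D := derive1 H x in hr *.
have hp : `|H (x + a) - H x - a * D| <= a * (e / 4).
  have := hr a; rewrite /ball /= sub0r normrN gtr0_norm // ar gt_eqF // => /(_ isT isT).
  move=> h; rewrite distrC.
  have -> : a * D - (H (x + a) - H x) = a * (D - a^-1 *: (H (a + x) - H x)).
    by rewrite mulrBr [a * (_ *: _)]mulrA mulfV ?gt_eqF // mul1r [a + x]addrC.
  by rewrite normrM gtr0_norm // ler_pM2l.
have hm : `|H (x - a) - H x + a * D| <= a * (e / 4).
  have := hr (- a); rewrite /ball /= sub0r normrN normrN gtr0_norm // ar oppr_eq0 gt_eqF // => /(_ isT isT).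
  move=> h.
  have -> : H (x - a) - H x + a * D = a * (D - (- a)^-1 *: (H (- a + x) - H x)).
    rewrite mulrBr [a * (_ *: _)]mulrA invrN mulrN mulfV ?gt_eqF // mulN1r opprK [- a + x]addrC; ring.
  by rewrite normrM gtr0_norm // ler_pM2l.
(* Four errors of size b are allowed: two from the values of K, one from rounding in the abscissas,
   one from the difference quotient. *)
pose b := a * (e / 4); have b0 : 0 < b by rewrite mulr_gt0.
pose bV := b / (V%:R + 1); have bV0 : 0 < bV by rewrite divr_gt0 // ltr_wpDl.
have xa0 : 0 <= x - a by lra.
have xa1 : 0 <= x + a by lra.
have /cvgrPdist_le /(_ _ b0) Nk0 := hK _ (ltW x0).
have /cvgrPdist_le /(_ _ b0) Nk1 := hK _ xa0.
have /cvgrPdist_le /(_ _ b0) Nk2 := hK _ xa1.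
have bV2 : 0 < bV / 2 by rewrite divr_gt0.
have /cvgrPdist_le /(_ _ bV2) Nr0' := @ratio_trunc R _ (ltW x0).
have /cvgrPdist_le /(_ _ bV2) Nr1 := @ratio_trunc R _ xa0.
have /cvgrPdist_le /(_ _ bV2) Nr2 := @ratio_trunc R _ xa1.
near=> n.
have n0 : 0 < (n%:R : R) by rewrite ltr0n; near: n; exists 1%N.
have : `|h0 - H x - (K n (Num.trunc (n%:R * x)))%:R / n%:R ^+ s.+1| <= b by near: n.
have : `|h0 - H (x - a) - (K n (Num.trunc (n%:R * (x - a))))%:R / n%:R ^+ s.+1| <= b by near: n.
have : `|h0 - H (x + a) - (K n (Num.trunc (n%:R * (x + a))))%:R / n%:R ^+ s.+1| <= b by near: n.
have : `|x - (Num.trunc (n%:R * x))%:R / n%:R| <= bV / 2 by near: n.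
have : `|x - a - (Num.trunc (n%:R * (x - a)))%:R / n%:R| <= bV / 2 by near: n.
have : `|x + a - (Num.trunc (n%:R * (x + a)))%:R / n%:R| <= bV / 2 by near: n.
have m1 : (Num.trunc (n%:R * (x - a)) <= Num.trunc (n%:R * x))%N.
  by apply: le_truncn; rewrite ler_pM2l //; lra.
have m2 : (Num.trunc (n%:R * x) <= Num.trunc (n%:R * (x + a)))%N.
  by apply: le_truncn; rewrite ler_pM2l //; lra.
move: (Num.trunc (n%:R * (x - a))) (Num.trunc (n%:R * x)) (Num.trunc (n%:R * (x + a))) m1 m2.
move=> y1 y y2 m1 m2 r2 r1 r0' k2 k1 k0.
have sl := count_slope_l (cm n) (Kc n) y1 (y - y1).
have sr := count_slope_r (cm n) (Kc n) y (y2 - y).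
rewrite (subnKC m1) in sl; rewrite (subnKC m2) in sr.
pose w : R := (cnt n y)%:R / n%:R ^+ s.
have w0 : 0 <= w by rewrite divr_ge0 // exprn_ge0 // ltW.
have wV : w <= V%:R by rewrite ler_pdivrMr ?exprn_gt0 // -natrX -natrM ler_nat.
have ns : 0 < (n%:R : R) ^+ s.+1 by rewrite exprn_gt0.
pose q z : R := (z%:R) / n%:R.
pose k z : R := (K n z)%:R / n%:R ^+ s.+1.
have sl' : k y + (q y - q y1) * w <= k y1.
  rewrite /k ler_pdivlMr // mulrDl divfK ?gt_eqF // /q /w -mulrBl exprS.
  have -> : (y%:R - y1%:R) / n%:R * ((cnt n y)%:R / n%:R ^+ s) * (n%:R * n%:R ^+ s) =
    (y%:R - y1%:R) * (cnt n y)%:R :> R by field; rewrite !gt_eqF // exprn_gt0.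
  by move: sl; rewrite -(ler_nat R) natrD natrM natrB.
have sr' : k y <= k y2 + (q y2 - q y) * w.
  rewrite /k ler_pdivrMr // mulrDl divfK ?gt_eqF // /q /w -mulrBl exprS.
  have -> : (y2%:R - y%:R) / n%:R * ((cnt n y)%:R / n%:R ^+ s) * (n%:R * n%:R ^+ s) =
    (y2%:R - y%:R) * (cnt n y)%:R :> R by field; rewrite !gt_eqF // exprn_gt0.
  by move: sr; rewrite -(ler_nat R) natrD natrM natrB.
have Vb : V%:R * bV <= b.
  rewrite /bV mulrCA ger_pMr // ler_pdivrMr ?mul1r; first by rewrite lerDl.
  by rewrite ltr_wpDl.
have wb : w * bV <= b by apply: le_trans Vb; rewrite ler_wpM2r // ltW.
have q1 : (q y - q y1 - a) * w >= - (w * bV).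
  rewrite -mulrN [X in _ <= X]mulrC ler_wpM2l //.
  by move: r1 r0'; rewrite -/(q _) -/(q y) !ler_norml => /andP[? ?] /andP[? ?]; lra.
have q2 : (q y2 - q y - a) * w <= w * bV.
  rewrite mulrC ler_wpM2l //.
  by move: r2 r0'; rewrite -/(q _) -/(q y) !ler_norml => /andP[? ?] /andP[? ?]; lra.
rewrite -/w.
have up : a * (w - D) <= a * e.
  move: k1 k0 hm; rewrite -/(k _) -/(k y) -/b !ler_norml => /andP[? ?] /andP[? ?] /andP[? ?].
  have -> : a * e = 4 * b by rewrite /b; field.
  rewrite mulrBr; nra.
have lo : a * (D - w) <= a * e.
  move: k2 k0 hp; rewrite -/(k _) -/(k y) -/b !ler_norml => /andP[? ?] /andP[? ?] /andP[? ?].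
  have -> : a * e = 4 * b by rewrite /b; field.
  rewrite mulrBr; nra.
rewrite !ler_pM2l // in up lo.
by rewrite ler_norml; apply/andP; split; lra.
Unshelve. all: by end_near.
Qed.

End ConcaveLimit.

(** The points of a box of sides at most n which are within c of a face, with both sides
    multiplied by n to stay clear of a predecessor in the exponent. *)
Lemma prod_sub_bound n s (v c : 'I_s -> nat) : (forall i, (v i <= n)%N) ->
  (n * \prod_i v i <= n * \prod_i (v i - c i) + (\sum_i c i) * n ^ s)%N.
Proof.
elim: s v c => [|s IH] v c hv; first by rewrite !big_ord0 leq_addr.
have hP : (\prod_(i < s) (v (lift ord0 i) - c (lift ord0 i)) <= n ^ s)%N.
  apply: (@leq_trans (\prod_(i < s) n)).
    by apply: leq_prod => i _; apply: leq_trans (leq_subr _ _) (hv _).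
  by rewrite prod_nat_const card_ord.
have := IH (fun i => v (lift ord0 i)) (fun i => c (lift ord0 i)) (fun i => hv _).
rewrite !big_ord_recl expnS; have := hv ord0.
move: (\prod_(i < s) v _)%N (\prod_(i < s) (v _ - c _))%N (\sum_(i < s) c _)%N (v ord0) (c ord0) (n ^ s)%N hP.
move=> P P' C v0 c0 N hP hv0 h.
apply: (@leq_trans (v0 * (n * P' + C * N))).
  by rewrite mulnCA leq_mul2l h orbT.
have e1 : (v0 <= (v0 - c0) + c0)%N by rewrite addnC -leq_subLR.
have h1 : (v0 * (n * P' + C * N) <= ((v0 - c0) + c0) * (n * P') + n * (C * N))%N.
  by rewrite mulnDr leq_add // leq_mul.
apply: leq_trans h1 _.
have hP' : (c0 * (n * P') <= c0 * (n * N))%N by rewrite leq_mul // leq_mul.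
rewrite mulnDl [(n * (_ * P'))%N]mulnCA -addnA leq_add2l mulnDl.
by rewrite [(n * (C * N))%N]mulnCA leq_add2r.
Qed.

(** * The distribution of the lengths of chains *)

Section ChainMeasure.
Variables (R : realType) (s : nat) (a c : 'I_s.+1 -> nat) (r : R).
Hypothesis hc : exists i, c i <> 0%N.
Hypothesis r0 : 0 <= r.
Hypothesis ha : forall i, (a i)%:R * r <= 1.

(** The sides of the box of monomials which remains after multiplication by x^(a N),
    N = ceil(q r). *)
Definition side (q : nat) (i : 'I_s.+1) : nat := (q - cnat (q%:R * r) * a i)%N.

Definition chain_length (q : nat) (t : box (fun _ : 'I_s.+1 => q)) : nat :=
  mlen c (side q) (nat_of_box t).

Definition scaled_length (q : nat) (t : box (fun _ : 'I_s.+1 => q)) : R :=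
  (chain_length t)%:R / q%:R.

(** Minus the normalized number of chains of scaled length greater than z. It is the integrator of
    a counting measure, and it converges to -h'. *)
Definition chain_tail (q : nat) (z : R) : R :=
  q%:R ^- s * \sum_(t : box (fun _ : 'I_s.+1 => q)) step (scaled_length t) z.

Let ta i : R := 1 - r * (a i)%:R.
Let h0 (k : fieldType) p := h_monomial k p c ta.
Let V := (\sum_i c i)%N.

Lemma ta_01 i : 0 <= ta i <= 1.
Proof.
by rewrite /ta; have := ha i; rewrite mulrC => h; have := mulr_ge0 r0 (ler0n R (a i)); lra.
Qed.

Lemma side_le q i : (side q i <= q)%N. Proof. exact: leq_subr. Qed.

Lemma count_chains q y :
  #|[pred t : box (fun _ : 'I_s.+1 => q) | (y < chain_length t)%N]| =
  (\prod_i (side q i - y * c i) - \prod_i (side q i - y.+1 * c i))%N.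
Proof. exact: (count_mlen hc (side_le q)). Qed.

Lemma count_chains_mono q y y' : (y <= y')%N ->
  (#|[pred t : box (fun _ : 'I_s.+1 => q) | (y' < chain_length t)%N]| <=
   #|[pred t : box (fun _ : 'I_s.+1 => q) | (y < chain_length t)%N]|)%N.
Proof.
by move=> yy; apply: subset_leq_card; apply/fintype.subsetP => t; rewrite !inE; apply: leq_ltn_trans.
Qed.

Lemma count_chains_bound q y :
  (#|[pred t : box (fun _ : 'I_s.+1 => q) | (y < chain_length t)%N]| <= V * q ^ s)%N.
Proof.
apply: leq_trans (@count_chains_mono q 0 y (leq0n y)) _.
rewrite count_chains; case: q => [|q].
  rewrite (_ : \prod_i _ = 0)%N // big_ord_recl.
  by rewrite /side sub0n mul0n.
under eq_bigr do rewrite mul0n subn0.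
under [X in (_ - X)%N]eq_bigr do rewrite mul1n.
have := prod_sub_bound c (fun i => side_le q.+1 i); rewrite -/V.
move: (\prod_i _)%N (\prod_i (_ - _))%N => P P'.
rewrite [(_ ^ s.+1)%N]expnS [(V * _)%N]mulnCA -mulnDr leq_pmul2l // => h.
by rewrite leq_subLR.
Qed.

Lemma scaled_length01 q (t : box (fun _ : 'I_s.+1 => q)) : 0 <= scaled_length t <= 1.
Proof.
rewrite /scaled_length divr_ge0 //=.
have hm : (chain_length t <= q)%N.
  rewrite leqNgt /chain_length mlen_spec //; apply/negP => /andP[_ /forallP h].
  have [i /eqP ci] := hc; have := h i; apply/negP; rewrite -leqNgt.
  apply: leq_trans (side_le q i) _; apply: leq_trans (leq_addl _ _); rewrite leq_pmulr // lt0n.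
  exact/negP/negP.
case: q t hm => [|q] t hm; first by rewrite invr0 mulr0.
by rewrite ler_pdivrMr // mul1r ler_nat.
Qed.

Lemma sum_chains q z : (0 < q)%N -> 0 <= z ->
  \sum_(t : box (fun _ : 'I_s.+1 => q)) (z < scaled_length t)%R%:R =
  #|[pred t : box (fun _ : 'I_s.+1 => q) | (Num.trunc (q%:R * z) < chain_length t)%N]|%:R :> R.
Proof.
move=> q0 z0; rewrite -sum1_card natr_sum [RHS]big_mkcond; apply: eq_bigr => t _.
rewrite inE truncn_lt_nat ?mulr_ge0 // /scaled_length ltr_pdivlMr ?ltr0n // mulrC.
by case: ifP.
Qed.

(** The total mass stays bounded: chains start close to a face of the box. *)
Lemma mass_le q : (0 < q)%N ->
  q%:R ^- s * \sum_(t : box (fun _ : 'I_s.+1 => q)) (0 < scaled_length t)%R%:R <= V%:R :> R.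
Proof.
move=> q0; have qs : 0 < (q%:R : R) ^+ s by rewrite exprn_gt0 // ltr0n.
rewrite sum_chains // mulrC ler_pdivrMr // -natrX -natrM ler_nat; exact: count_chains_bound.
Qed.

Section Limit.
Variables (k : fieldType) (p : nat).
Hypothesis pk : p \in [pchar k].

Lemma chain_tail_cvg z : 0 < z -> derivable (h0 k p) z 1 ->
  chain_tail q z @[q --> \oo] --> - derive1 (h0 k p) z.
Proof.
move=> z0 dz.
pose K q y := (\prod_i (side q i - y * c i))%N.
pose cnt q y := #|[pred t : box (fun _ : 'I_s.+1 => q) | (y < chain_length t)%N]|.
have Kc q y : K q y = (K q y.+1 + cnt q y)%N.
  rewrite /cnt count_chains subnKC //; apply: leq_prod => i _.
  by apply: leq_sub2l; rewrite leq_mul2r leqnSn orbT.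
have hK x : 0 <= x -> (K n (Num.trunc (n%:R * x)))%:R / n%:R ^+ s.+1 @[n --> \oo] -->
    \prod_i ta i - h0 k p x.
  move=> x0; rewrite /h0 h_monomialE //; last by move=> i; have /andP[] := ta_01 i.
  rewrite subKr (max_r x0) /shrunk.
  apply: (@ratio_prod _ _ (fun i n => _)) => i.
  apply: ratio_sub; last by apply: ratio_mul; exact: ratio_trunc.
  have -> : ta i = Num.max 0 (1 - r * (a i)%:R) by rewrite max_r //; have /andP[] := ta_01 i.
  by apply: ratio_sub; [exact: ratio_id|apply: ratio_mul; exact: ratio_cnat].
have hl := concave_slope_limit (cnt := cnt) (fun n y y' => @count_chains_mono n y y') Kc
  (fun n y => count_chains_bound n y) hK z0 dz.
have : - ((cnt n (Num.trunc (n%:R * z)))%:R / n%:R ^+ s) @[n --> \oo] --> - derive1 (h0 k p) z.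
  exact: cvgN.
apply: cvg_trans; apply: near_eq_cvg; exists 1%N => // n /= n1.
rewrite /chain_tail /step sumrN mulrN mulrC sum_chains //; exact: ltW.
Qed.

Variable phi : R -> R.
Hypothesis hphi : monotone_derivative (h0 k p) phi.

(** The exceptional point is the limit of the largest scaled length, at which the remaining box
    degenerates. *)
Lemma chain_tail_cvg_phi : exists2 u, u <= 1 &
  forall z, 0 < z -> z != u -> chain_tail (p ^ e) z @[e --> \oo] --> - phi z.
Proof.
have [u u1 hu] := shrunk_derivable ta_01 hc.
exists u => // z z0 zu; have p1 := prime_gt1 (pcharf_prime pk).
have dz : derivable (h0 k p) z 1.
  have d1 : derivable (cst (\prod_i ta i) - shrunk c ta) z 1.
    by apply: derivableB; [exact: derivable_cst|exact: hu].
  apply: near_eq_derivable d1; near=> y.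
  have y0 : 0 < y by near: y; exact: lt_nbhsr.
  rewrite /h0 h_monomialE //; last by move=> i; have /andP[] := ta_01 i.
  by rewrite (max_r (ltW y0)).
have [_ ->] // := hphi.
exact: (cvg_comp _ _ (cvg_expn_oo p1) (chain_tail_cvg z0 dz)).
Unshelve. all: by end_near.
Qed.

(** The bounds for counting measures pass to the limit wherever there is convergence, and to the
    exceptional point by monotonicity. *)
Lemma tame_phi (C M : R) : 2 <= C -> V%:R <= M -> `|phi 0| <= M -> tame C M (fun z => - phi z).
Proof.
move=> C2 VM pM; have p1 := prime_gt1 (pcharf_prime pk).
have [u u1 hu] := chain_tail_cvg_phi.
have q0 e : (0 < p ^ e)%N by rewrite expn_gt0 ltnW.
have tt e : tame C V%:R (chain_tail (p ^ e)).
  apply: tame_empirical.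
  - by rewrite invr_ge0 exprn_ge0.
  - by move=> t; have /andP[h1 h2] := scaled_length01 t; rewrite h1 (le_trans h2) //; lra.
  exact: mass_le.
have C0 : 0 < C by lra.
have bd z : 0 < z -> z <= C -> z != u -> `|- phi z| <= M.
  move=> z0 zC zu; have hcv := hu z z0 zu.
  have hn : `|chain_tail (p ^ e) z| @[e --> \oo] --> `|- phi z| by exact: cvg_norm.
  apply: le_trans VM; apply: (cvgr_to_le hn); apply: nearW => e.
  by have [_ _ ->] := tt e; rewrite // (ltW z0).
have pC : phi C = 0.
  have Cu : C != u by apply/negP => /eqP e; move: C2 u1; rewrite e; lra.
  have hcv := hu C C0 Cu.
  have h0' : chain_tail (p ^ e) C @[e --> \oo] --> (0 : R).
    by apply: cvg_near_cst; apply: nearW => e; have [] := tt e.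
  have e : - phi C = 0 by rewrite -(cvg_lim (@Rhausdorff R) hcv) (cvg_lim (@Rhausdorff R) h0').
  by rewrite -[phi C]opprK e oppr0.
have mono z z' : 0 < z -> z <= z' -> - phi z <= - phi z'.
  by move=> z0 zz; rewrite lerN2; case: hphi => h _; apply: h.
split=> //; first by rewrite pC oppr0.
move=> z /andP[z0 zC]; have [e|zn0] := eqVneq z 0; first by rewrite e normrN.
have zp : 0 < z by rewrite lt0r zn0.
have [e|zu] := eqVneq z u; last exact: bd.
have z2 : 0 < z / 2 by rewrite divr_gt0.
have h1 : `|- phi (z / 2)| <= M by apply: bd => //; [lra|apply/negP => /eqP; rewrite -e; lra].
have h2 : - phi (z / 2) <= - phi z by apply: mono => //; lra.
have h3 : - phi z <= - phi C by apply: mono.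
have M0 : 0 <= M by apply: le_trans h1.
move: h1 h2 h3; rewrite pC oppr0 !ler_norml => /andP[? ?] ? ?; apply/andP; split; lra.
Qed.

End Limit.
End ChainMeasure.

(** * The h-function of f *)

(** Any two points are compared through the upper right corner of the rectangle they span. *)
Lemma lipschitz_sq_corner (R : realType) (C K : R) (F : R -> R -> R) :
  (forall x y x' y', 0 <= x -> x <= x' -> x' <= C -> 0 <= y -> y <= y' -> y' <= C ->
     `|F x' y' - F x y| <= K * (x' - x + (y' - y))) -> lipschitz_sq C K F.
Proof.
move=> h x y x' y' /andP[x0 xC] /andP[y0 yC] /andP[x0' xC'] /andP[y0' yC'].
have ge (u v : R) : v <= Num.max u v /\ u <= Num.max u v by rewrite !le_max !lexx orbT.
have dist (u v : R) : `|v - u| = Num.max u v - u + (Num.max u v - v).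
  by clear; case: (leP u v) => h; [rewrite ger0_norm|rewrite ltr0_norm]; lra.
have [x1 x2] := ge x x'; have [y1 y2] := ge y y'.
have [mx my] : Num.max x x' <= C /\ Num.max y y' <= C by rewrite !ge_max xC xC' yC yC'.
have l1 := h _ _ _ _ x0 x2 mx y0 y2 my; have l2 := h _ _ _ _ x0' x1 mx y0' y1 my.
rewrite (dist x x') (dist y y'); move: (Num.max x x') (Num.max y y') l1 l2 => X Y l1 l2.
move: (F x' y') (F x y) (F X Y) l1 l2 => f1 f0 f l1 l2.
have -> : f1 - f0 = (f - f0) - (f - f1) by clear; ring.
apply: le_trans (ler_normB _ _) _; apply: le_trans (lerD l1 l2) _.
by rewrite -mulrDr le_eqVlt; apply/orP; left; apply/eqP; clear; ring.
Qed.

Section Main.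
Variables (R : realType) (s1 s2 : nat) (a c : 'I_s1.+1 -> nat) (b d : 'I_s2.+1 -> nat) (r : R).
Hypothesis hc : exists i, c i <> 0%N.
Hypothesis hd : exists j, d j <> 0%N.
Hypothesis r0 : 0 <= r.
Hypothesis ha : forall i, (a i)%:R * r <= 1.
Hypothesis hb : forall j, (b j)%:R * r <= 1.

Let ta i : R := 1 - r * (a i)%:R.
Let tb j : R := 1 - r * (b j)%:R.
Let P : R := \prod_i (1 - (a i)%:R * r) * \prod_j (1 - (b j)%:R * r).

(** The contribution of the pairs of chains to the length, normalized. *)
Definition chain_sum (k : fieldType) (q : nat) : R :=
  (\sum_(t1 : box (fun _ : 'I_s1.+1 => q)) \sum_(t2 : box (fun _ : 'I_s2.+1 => q))
     tlen k (chain_length a c r t1) (chain_length b d r t2) (cnat (q%:R * r)))%:R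
  / q%:R ^+ (s1.+1 + s2.+1).

(** The integral of D against the counting measures of the scaled chain lengths. *)
Definition empirical_sum (k : fieldType) (p q : nat) : R :=
  q%:R ^- s1 * q%:R ^- s2 *
  (\sum_(t1 : box (fun _ : 'I_s1.+1 => q)) \sum_(t2 : box (fun _ : 'I_s2.+1 => q))
     D_sum k p (scaled_length a c r t1) (scaled_length b d r t2) r).

Lemma D_sum_lipschitz (k : fieldType) p C : p \in [pchar k] ->
  lipschitz_sq C (4 * (2 * C + r)) (fun x y => D_sum k p x y r).
Proof.
move=> pk; apply: lipschitz_sq_corner => x y x' y' x0 xx xC y0 yy yC.
apply: le_trans (D_sum_lip pk x0 xx y0 yy r0) _.
have hA : 0 <= x' - x + (y' - y) by rewrite addr_ge0 // subr_ge0.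
move: (x' - x + (y' - y)) hA => A A0; rewrite -mulrA [A * _]mulrC mulrA; apply: ler_wpM2r => //.
by rewrite ler_pM2l // lerD2r mulr_natl mulr2n lerD.
Qed.

Lemma h_f_cvg (k : fieldType) p L : p \in [pchar k] ->
  chain_sum k (p ^ e) @[e --> \oo] --> L -> h_f k p a c b d r = 1 - P + L.
Proof.
move=> pk hL; have p1 := prime_gt1 (pcharf_prime pk).
have q0 e : (0 < p ^ e)%N by rewrite expn_gt0 ltnW.
rewrite /h_f /h_fun local_dim_mpoly; last first.
  move=> i; apply: ideal_gen_sub; left; apply: ideal_gen_sub.
  rewrite -(fintype.splitK i); case: (fintype.split i) => j /=; [left|right]; by exists j.
apply: cvg_lim; first exact: Rhausdorff.
have hside s (a' : 'I_s.+1 -> nat) : (forall i, (a' i)%:R * r <= 1) ->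
    (\prod_i (n - cnat (n%:R * r) * a' i))%N%:R / n%:R ^+ s.+1 @[n --> \oo]
      --> \prod_i (1 - (a' i)%:R * r).
  move=> ha'; apply: (@ratio_prod _ _ (fun i n => _)) => i.
  have -> : 1 - (a' i)%:R * r = Num.max 0 (1 - r * (a' i)%:R).
    by rewrite [r * _]mulrC max_r // subr_ge0.
  by apply: ratio_sub; [exact: ratio_id|apply: ratio_mul; exact: ratio_cnat].
have cA := cvg_comp _ _ (cvg_expn_oo p1) (hside _ _ ha).
have cB := cvg_comp _ _ (cvg_expn_oo p1) (hside _ _ hb).
have cS : 1 - ((\prod_i (p ^ e - cnat ((p ^ e)%:R * r) * a i))%N%:R / (p ^ e)%:R ^+ s1.+1 *
   ((\prod_i (p ^ e - cnat ((p ^ e)%:R * r) * b i))%N%:R / (p ^ e)%:R ^+ s2.+1))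
   + chain_sum k (p ^ e) @[e --> \oo] --> 1 - P + L.
  apply: cvgD => //; apply: cvgB; first exact: cvg_cst.
  by apply: cvgM; [exact: cA|exact: cB].
apply: cvg_trans cS; apply: near_eq_cvg; apply: nearW => e.
have q1 : (p ^ e)%:R != 0 :> R by rewrite pnatr_eq0 -lt0n.
rewrite (h_f_length a b pk hc hd) /chain_sum mulrDl mulrBl divff ?expf_neq0 //.
congr (_ - _ + _); rewrite exprD; field; by rewrite ?q1 // !expf_neq0.
Qed.

Section FixedField.
Variables (k : fieldType) (p : nat) (phi1 phi2 : R -> R).
Hypothesis pk : p \in [pchar k].
Hypothesis h1 : monotone_derivative (h_monomial k p c ta) phi1.
Hypothesis h2 : monotone_derivative (h_monomial k p d tb) phi2.

Definition mass_bound : R :=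
  (\sum_i c i)%N%:R + (\sum_j d j)%N%:R + `|phi1 0| + `|phi2 0|.

(** The constant in front of the mesh. Its independence of the field makes the estimates uniform
    in p. *)
Definition mesh_bound (C : R) : R :=
  18 * (4 * (2 * C + r)) * mass_bound * (4 * mass_bound + 1)
  + 2 * (4 * (2 * C + r)) * mass_bound ^+ 2.

Let M := mass_bound.

Lemma mass_boundP :
  [/\ (\sum_i c i)%N%:R <= M, (\sum_j d j)%N%:R <= M, `|phi1 0| <= M, `|phi2 0| <= M & 0 <= M].
Proof.
have n1 := normr_ge0 (phi1 0); have n2 := normr_ge0 (phi2 0).
have m1 : 0 <= (\sum_i c i)%N%:R :> R by [].
have m2 : 0 <= (\sum_i d i)%N%:R :> R by [].
by split; rewrite /M /mass_bound; lra.
Qed.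

Lemma mesh_bound_ge0 (C : R) : 2 <= C -> 0 <= mesh_bound C.
Proof.
move=> C2; have [_ _ _ _ M0] := mass_boundP.
have : 0 <= 4 * (2 * C + r) by rewrite mulr_ge0 // addr_ge0 // mulr_ge0 // (le_trans _ C2).
rewrite /mesh_bound -/M; move: (4 * (2 * C + r)) => K K0.
apply: addr_ge0; last by apply: mulr_ge0; [exact: mulr_ge0|exact: exprn_ge0].
apply: mulr_ge0; first by apply: mulr_ge0 => //; exact: mulr_ge0.
by apply: addr_ge0 => //; exact: mulr_ge0.
Qed.

Let p1 : (1 < p)%N. Proof. exact: prime_gt1 (pcharf_prime pk). Qed.

(** At scaled lengths x and y the finite-level length differs from q^2 D(x, y, r) by O(q), and both
    vanish on the axes, where the mass of the counting measures is not bounded. *)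
Lemma chain_sum_empirical (C : R) e : 2 <= C -> let q := (p ^ e)%N in
  `|empirical_sum k p q - chain_sum k q|
  <= M ^+ 2 * (24 * (r + 5)) / q%:R.
Proof.
move=> C2; set q := (p ^ e)%N; cbv zeta; have q0 : (0 < q)%N by rewrite expn_gt0 ltnW.
have qn : q%:R != 0 :> R by rewrite pnatr_eq0 -lt0n.
have qp : 0 < (q%:R : R) by rewrite ltr0n.
have [M1 M2 _ _ M0] := mass_boundP.
pose E : R := 24 * (r + 5) / q%:R.
have E0 : 0 <= E by apply: divr_ge0 => //; apply: mulr_ge0 => //; apply: addr_ge0.
have -> : chain_sum k q = (q%:R : R) ^- s1 * (q%:R : R) ^- s2 *
   (\sum_(t1 : box (fun _ : 'I_s1.+1 => q)) \sum_(t2 : box (fun _ : 'I_s2.+1 => q))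
      tlen_at k p (scaled_length a c r t1) (scaled_length b d r t2) r e).
  rewrite /chain_sum natr_sum.
  have eq2 (t1 : box (fun _ : 'I_s1.+1 => q)) (t2 : box (fun _ : 'I_s2.+1 => q)) :
      tlen_at k p (scaled_length a c r t1) (scaled_length b d r t2) r e =
      (tlen k (chain_length a c r t1) (chain_length b d r t2) (cnat (q%:R * r)))%:R / q%:R ^+ 2.
    by rewrite /tlen_at -/q /scaled_length ![q%:R * (_ / _)]mulrC !divfK // !cnat_nat.
  under [in RHS]eq_bigr do under eq_bigr do rewrite eq2.
  under [in RHS]eq_bigr do rewrite -mulr_suml.
  rewrite -mulr_suml; under eq_bigr do rewrite natr_sum.
  rewrite addSn addnS !exprS exprD; move: (\sum_i _) => S.
  by field; rewrite qn !expf_neq0.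
rewrite /empirical_sum -mulrBr -sumrB normrM [X in X * _]ger0_norm; last first.
  by rewrite mulr_ge0 // invr_ge0 exprn_ge0.
have bd (t1 : box (fun _ : 'I_s1.+1 => q)) (t2 : box (fun _ : 'I_s2.+1 => q)) :
   `|D_sum k p (scaled_length a c r t1) (scaled_length b d r t2) r -
      tlen_at k p (scaled_length a c r t1) (scaled_length b d r t2) r e| <=
   E * (0 < scaled_length a c r t1)%R%:R * (0 < scaled_length b d r t2)%R%:R.
  have /andP[x0 x1] := scaled_length01 a r hc t1.
  have /andP[y0 y1] := scaled_length01 b r hd t2.
  move: (scaled_length _ _ _ t1) (scaled_length _ _ _ t2) x0 x1 y0 y1 => y x x0 x1 y0 y1.
  have [->|xn] := eqVneq y 0.
    by rewrite D_sum0l // /tlen_at mulr0 (cnat0 (lexx 0)) tlen0 mul0r subrr normr0 ltxx mulr0 mul0r.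
  have [->|yn] := eqVneq x 0.
    by rewrite D_sum0r // /tlen_at mulr0 (cnat0 (lexx 0)) tlenx0 mul0r subrr normr0 ltxx mulr0.
  rewrite !lt0r xn yn y0 x0 /= !mulr1.
  apply: le_trans (D_sum_cvg pk _ _ r0 e) _ => //.
  by rewrite /E ler_wpM2r ?invr_ge0 // ler_wpM2l //; lra.
apply: (@le_trans _ _ ((q%:R : R) ^- s1 * (q%:R : R) ^- s2 *
   \sum_(t1 : box (fun _ : 'I_s1.+1 => q)) \sum_(t2 : box (fun _ : 'I_s2.+1 => q))
   (E * (0 < scaled_length a c r t1)%R%:R * (0 < scaled_length b d r t2)%R%:R))).
  apply: ler_wpM2l; first by rewrite mulr_ge0 // invr_ge0 exprn_ge0.
  apply: le_trans (ler_norm_sum _ _ _) _; apply: ler_sum => t1 _; rewrite -sumrB.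
  by apply: le_trans (ler_norm_sum _ _ _) _; apply: ler_sum => t2 _.
under eq_bigr do rewrite -mulr_sumr.
rewrite -mulr_suml -mulr_sumr.
have m1 := le_trans (mass_le a r hc q0) M1; have m2 := le_trans (mass_le b r hd q0) M2.
move: m1 m2.
have X0 (A : finType) (f : A -> R) : 0 <= \sum_t (0 < f t)%R%:R :> R by apply: sumr_ge0.
move: (X0 _ (@scaled_length R s1 a c r q)) (X0 _ (@scaled_length R s2 b d r q)).
set X := \sum_t _; set Y := \sum_t (0 < scaled_length b d r t)%R%:R.
move=> hX hY m1 m2.
have -> : (q%:R : R) ^- s1 * (q%:R : R) ^- s2 * (E * X * Y) = ((q%:R : R) ^- s1 * X) * (q%:R ^- s2 * Y) * E by ring.
have -> : M ^+ 2 * (24 * (r + 5)) / q%:R = M * M * E by rewrite /E; ring.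
apply: ler_wpM2r => //; apply: ler_pM => //; by rewrite mulr_ge0 // invr_ge0 exprn_ge0.
Qed.

Lemma chain_sum_RS_near (C : R) delta eps t1 t2 xi eta : 2 <= C -> 0 < delta -> 0 < eps ->
  tagged C delta t1 t2 xi eta ->
  \forall e \near \oo,
    `|RS_sum (fun x y => D_sum k p x y r) (fun x => - phi1 x) (fun y => - phi2 y) t1 t2 xi eta
      - chain_sum k (p ^ e)| <= mesh_bound C * delta + eps.
Proof.
move=> C2 d0 e0 ht; have C0 : 0 < C by lra.
have [M1 M2 M3 M4 M0] := mass_boundP.
have K0 : 0 <= 4 * (2 * C + r) by rewrite mulr_ge0 // addr_ge0 // mulr_ge0 // ltW.
have hF := @D_sum_lipschitz k p C pk.
have F0 : vanish_axes (fun x y => D_sum k p x y r).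
  by split=> z; [exact: D_sum0l|exact: D_sum0r].
have q0 e : (0 < p ^ e)%N by rewrite expn_gt0 ltnW.
have [u _ hu] := chain_tail_cvg_phi hc r0 ha pk h1.
have [v _ hv] := chain_tail_cvg_phi hd r0 hb pk h2.
have w0 s e : 0 <= ((p ^ e)%:R ^- s : R) by rewrite invr_ge0 exprn_ge0.
have x01 e (t : box (fun _ : 'I_s1.+1 => p ^ e)%N) : 0 <= scaled_length a c r t <= C.
  by have /andP[-> h] := scaled_length01 a r hc t; lra.
have y01 e (t : box (fun _ : 'I_s2.+1 => p ^ e)%N) : 0 <= scaled_length b d r t <= C.
  by have /andP[-> h] := scaled_length01 b r hd t; lra.
have m1 e := le_trans (mass_le a r hc (q0 e)) M1.
have m2 e := le_trans (mass_le b r hd (q0 e)) M2.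
have near1 := RS_dist_near eventually_filter C0 K0 hF F0 d0 ht (tame_phi hc r0 ha pk h1 C2 M1 M3)
  (tame_phi hd r0 hb pk h2 C2 M2 M4)
  (alq := fun e => chain_tail a c r (p ^ e)) (beq := fun e => chain_tail b d r (p ^ e))
  (fun e => tame_empirical (w0 s1 e) (x01 e) (m1 e))
  (fun e => tame_empirical (w0 s2 e) (y01 e) (m2 e))
  (fun x hx xu => hu x (proj1 (andP hx)) xu) (fun x hx xu => hv x (proj1 (andP hx)) xu).
have near2 : \forall e \near \oo, M ^+ 2 * (24 * (r + 5)) / (p ^ e)%:R <= eps.
  have hcv : M ^+ 2 * (24 * (r + 5)) / (p ^ e)%:R @[e --> \oo] --> (0 : R).
    rewrite -[X in _ --> X](mulr0 (M ^+ 2 * (24 * (r + 5)))).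
    by apply: cvgM; [exact: cvg_cst|exact: cvg_pow_inv].
  have /cvgrPdist_le /(_ _ e0) := hcv; apply: filterS => e.
  by rewrite sub0r normrN; apply: le_trans (ler_norm _).
apply: filterS2 near1 near2 => e n1 n2.
have n3 := RS_empirical K0 hF F0 d0 ht (w0 s1 e) (w0 s2 e) (x01 e) (y01 e) (m1 e) (m2 e).
have n4 := chain_sum_empirical e C2.
rewrite /mesh_bound -/M mulrDl.
apply: le_trans (ler_distD _ _ _) _; last 1 first.
apply: le_trans (lerD n1 (le_trans (ler_distD _ _ _) (lerD n3 n4))) _.
lra.
Qed.

Lemma chain_sum_limit : exists2 L, chain_sum k (p ^ e) @[e --> \oo] --> L &
  forall C : R, 2 <= C ->
    is_RS_integral (fun x y => D_sum k p x y r) (fun x => - phi1 x) (fun y => - phi2 y) C L /\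
    forall delta t1 t2 xi eta, 0 < delta -> tagged C delta t1 t2 xi eta ->
    `|RS_sum (fun x y => D_sum k p x y r) (fun x => - phi1 x) (fun y => - phi2 y) t1 t2 xi eta - L|
      <= mesh_bound C * delta.
Proof.
have B0 := mesh_bound_ge0.
have h (C : R) : 2 <= C -> _ := fun C2 => RS_limit eventually_filter (lt_le_trans (ltr0n R 2) C2) (B0 C C2)
  (fun dl ep t1 t2 xi eta d0 e0 ht => @chain_sum_RS_near C dl ep t1 t2 xi eta C2 d0 e0 ht).
have [L hL _] := h 2 (lexx _); exists L => // C C2.
have [L' hL' hC] := h C C2.
by have -> : L = L' by rewrite -(cvg_lim (@Rhausdorff R) hL) (cvg_lim (@Rhausdorff R) hL').
Qed.

End FixedField.

(** Lengths of quotients by monomials do not depend on the field. *)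
Lemma h_monomial_indep s (e : 'I_s -> nat) (t : 'I_s -> R) (k k' : fieldType) p p' : (forall i, 0 <= t i) ->
  p \in [pchar k] -> p' \in [pchar k'] -> h_monomial k p e t = h_monomial k' p' e t.
Proof. by move=> t0 pk pk'; apply/funext => x; rewrite !h_monomialE. Qed.

Section VaryingField.
Variables (k : nat -> fieldType) (p0 : nat) (phi1 phi2 : R -> R).
Hypothesis kp : forall p, prime p -> p \in [pchar (k p)].
Hypothesis pp0 : prime p0.
Hypothesis h1 : monotone_derivative (h_monomial (k p0) p0 c ta) phi1.
Hypothesis h2 : monotone_derivative (h_monomial (k p0) p0 d tb) phi2.

Let Lp p : R := limn (fun e => chain_sum (k p) (p ^ e)).

Lemma Lp_spec p : prime p -> h_f (k p) p a c b d r = 1 - P + Lp p /\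
  forall C : R, 2 <= C -> forall delta t1 t2 xi eta, 0 < delta -> tagged C delta t1 t2 xi eta ->
    `|RS_sum (fun x y => D_sum (k p) p x y r) (fun x => - phi1 x) (fun y => - phi2 y) t1 t2 xi eta
      - Lp p| <= mesh_bound phi1 phi2 C * delta.
Proof.
move=> pp; have t1 i : 0 <= ta i by have /andP[] := ta_01 r0 ha i.
have t2 i : 0 <= tb i by have /andP[] := ta_01 r0 hb i.
have g1 : monotone_derivative (h_monomial (k p) p c ta) phi1.
  by rewrite (h_monomial_indep _ t1 (kp pp) (kp pp0)).
have g2 : monotone_derivative (h_monomial (k p) p d tb) phi2.
  by rewrite (h_monomial_indep _ t2 (kp pp) (kp pp0)).
have [L hL hC] := chain_sum_limit (kp pp) g1 g2.
have -> : Lp p = L := cvg_lim (@Rhausdorff R) hL.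
split; first exact: (h_f_cvg (kp pp)).
by move=> C C2; have [] := hC C C2.
Qed.

Lemma RS_sum_primes_cvg C delta t1 t2 xi eta : tagged C delta t1 t2 xi eta ->
  RS_sum (fun x y => D_sum (k p) p x y r) (fun x => - phi1 x) (fun y => - phi2 y) t1 t2 xi eta
    @[p --> primes_oo] -->
  RS_sum (fun x y => D_sum_infty k x y r) (fun x => - phi1 x) (fun y => - phi2 y) t1 t2 xi eta.
Proof.
move=> ht; rewrite /RS_sum.
apply: cvg_big => [|i _]; first exact: add_continuous.
apply: cvg_big => [|j _]; first exact: add_continuous.
apply: cvgM; last exact: cvg_cst.
apply: cvgM; last exact: cvg_cst.
have [/andP[x0 _] /andP[y0 _]] := tag_in ht (ltn_ord i) (ltn_ord j).
exact: (D_sum_primes_cvg kp x0 y0 r0).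
Qed.

(** The estimates for a fixed p are uniform, so that the limits in p and in the mesh can be
    exchanged. *)
Lemma h_f_primes_limit : exists2 L, h_f (k p) p a c b d r @[p --> primes_oo] --> 1 - P + L &
  forall C : R, 2 <= C ->
    is_RS_integral (fun x y => D_sum_infty k x y r) (fun x => - phi1 x) (fun y => - phi2 y) C L.
Proof.
have B0 := @mesh_bound_ge0 phi1 phi2.
have hn (C : R) : 2 <= C -> forall delta eps t1 t2 xi eta, 0 < delta -> 0 < eps ->
   tagged C delta t1 t2 xi eta -> \forall p \near primes_oo,
   `|RS_sum (fun x y => D_sum_infty k x y r) (fun x => - phi1 x) (fun y => - phi2 y) t1 t2 xi eta
      - Lp p| <= mesh_bound phi1 phi2 C * delta + eps.
  move=> C2 delta eps t1 t2 xi eta d0 e0 ht.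
  have /cvgrPdist_le /(_ _ e0) := RS_sum_primes_cvg ht.
  apply: filterS2 primes_oo_prime => p pp hp.
  have [_ /(_ C C2 _ _ _ _ _ d0 ht) hl] := Lp_spec pp.
  by apply: le_trans (ler_distD _ _ _) _; last apply: le_trans (lerD hp hl) _; rewrite addrC.
have h (C : R) : 2 <= C -> _ := fun C2 => RS_limit primes_oo_filter (lt_le_trans (ltr0n R 2) C2) (B0 C C2) (hn C C2).
have [L hL _] := h 2 (lexx _); exists L.
  have hl : 1 - P + Lp p @[p --> primes_oo] --> 1 - P + L by apply: cvgD => //; exact: cvg_cst.
  apply: cvg_trans hl; apply: near_eq_cvg; apply: filterS primes_oo_prime => p pp.
  by have [->] := Lp_spec pp.
move=> C C2; have [L' hL' [hC _]] := h C C2.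
by have -> : L = L' by rewrite -(cvg_lim (@Rhausdorff R) hL) (cvg_lim (@Rhausdorff R) hL').
Qed.

End VaryingField.
End Main.

Unset Implicit Arguments.

Theorem theorem6p10 (R : realType) (s1 s2 : nat) (hs1 : (1 <= s1)%N)
  (hs2 : (1 <= s2)%N) (a c : 'I_s1 -> nat) (b d : 'I_s2 -> nat)
  (hc : exists i, c i <> 0%N) (hd : exists j, d j <> 0%N)
  (r : R) (hr : 0 <= r)
  (ha : forall i, (a i)%:R * r <= 1) (hb : forall j, (b j)%:R * r <= 1) :
  let ta (i : 'I_s1) : R := 1 - r * (a i)%:R in
  let tb (j : 'I_s2) : R := 1 - r * (b j)%:R in
  let P : R := \prod_(i < s1) (1 - (a i)%:R * r)
               * \prod_(j < s2) (1 - (b j)%:R * r) in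
  (forall (p : nat) (k : fieldType) (phi1 phi2 : R -> R),
     p \in [pchar k] ->
     monotone_derivative (h_monomial k p c ta) phi1 ->
     monotone_derivative (h_monomial k p d tb) phi2 ->
     exists L : R,
       is_RS_integral_oo (fun r1 r2 => D_sum k p r1 r2 r)
         (fun r1 => - phi1 r1) (fun r2 => - phi2 r2) L
       /\ h_f k p a c b d r = 1 - P + L)
  /\
  (forall (k : nat -> fieldType) (p0 : nat) (phi1 phi2 : R -> R),
     (forall p, prime p -> p \in [pchar (k p)]) ->
     prime p0 ->
     monotone_derivative (h_monomial (k p0) p0 c ta) phi1 ->
     monotone_derivative (h_monomial (k p0) p0 d tb) phi2 ->
     exists L : R,
       is_RS_integral_oo (fun r1 r2 => D_sum_infty k r1 r2 r)
         (fun r1 => - phi1 r1) (fun r2 => - phi2 r2) L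
       /\ h_f (k p) p a c b d r @[p --> primes_oo] --> 1 - P + L).
Proof.
case: s1 hs1 a c hc ha => [//|s1'] _ {}a {}c {}hc {}ha.
case: s2 hs2 b d hd hb => [//|s2'] _ {}b {}d {}hd {}hb.
move=> ta tb P; split=> [p k phi1 phi2 pk h1 h2|k p0 phi1 phi2 kp pp0 h1 h2].
  have [L hL hC] := chain_sum_limit hc hd hr ha hb pk h1 h2.
  exists L; split; last exact: (h_f_cvg hc hd hr ha hb pk hL).
  by exists 2 => C C2; have [] := hC C C2.
have [L hL hC] := h_f_primes_limit hc hd hr ha hb kp pp0 h1 h2.
by exists L; split=> //; exists 2.
Qed.
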